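(* Let $n\ge1$, suppose $\varphi\in\mathcal F^2(\mathbb C^n)$ is such that $S_\varphi$ is bounded on $\mathcal F^2(\mathbb C^n)$, and let $$\varphi(z)=\left(\frac{2}{\pi}\right)^{n/2}\int_{\mathbb R^n}m(x)\,e^{-2\left(x-\frac i2 z\right)^2}\,dx,\qquad z\in\mathbb C^n,$$ for some $m\in L^\infty(\mathbb R^n)$. Then: (1) $\sigma(S_\varphi)=\mathcal R(m)(\mathbb R^n)$, where $\mathcal R(m)(\mathbb R^n)$ is the essential range of $m$; (2) $\mu\in\mathcal R(m)(\mathbb R^n)$ is an eigenvalue of $S_\varphi$ if and only if $|\{x\in\mathbb R^n:\ m(x)=\mu\}|>0$; (3) $\sigma(S_\varphi)=\sigma_a(S_\varphi)$, where $\sigma_a(S_\varphi)$ denotes the approximate point spectrum of $S_\varphi$; (4) $\sigma(S_\varphi)=\sigma_e(S_\varphi)$, where $\sigma_e(S_\varphi)$ denotes the essential spectrum of $S_\varphi$.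
   Context: $d\lambda(z)=\pi^{-n}e^{-|z|^2}\,dz$ is the Gaussian measure on $\mathbb C^n$. The Fock space $\mathcal F^2(\mathbb C^n)$ is the Hilbert space of all entire functions $F$ on $\mathbb C^n$ with $\|F\|^2_{\mathcal F^2(\mathbb C^n)}=\int_{\mathbb C^n}|F(z)|^2\,d\lambda(z)<\infty$, with the inner product inherited from $L^2(\mathbb C^n,d\lambda)$. For $\varphi\in\mathcal F^2(\mathbb C^n)$, $$S_\varphi F(z)=\int_{\mathbb C^n}F(w)\,e^{z\cdot\bar w}\,\varphi(z-\bar w)\,d\lambda(w),\qquad z\in\mathbb C^n,$$ where $z\cdot\bar w=\sum_j z_j\bar w_j$; for $a\in\mathbb C^n$, $a^2=\sum_j a_j^2$ (bilinear). ''$S_\varphi$ is bounded'' means that this formula defines a bounded linear operator from $\mathcal F^2(\mathbb C^n)$ to itself; such a bounded $m$ representing $\varphi$ is then known to exist. $|E|$ denotes Lebesgue measure of $E\subset\mathbb R^n$; the essential range of $m$ is the set of $\mu\in\mathbb C$ with $|\{x:|m(x)-\mu|<\epsilon\}|>0$ for every $\epsilon>0$. $\sigma$ is the spectrum; the essential spectrum $\sigma_e(T)$ is the set of $\mu\in\mathbb C$ such that $T-\mu$ is not Fredholm. *)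

(* Defs.v *)
From HB Require Import structures.
From mathcomp Require Import all_boot all_order all_algebra.
From mathcomp Require Import complex.
From mathcomp Require Import all_classical all_reals all_analysis.

Set Implicit Arguments.
Unset Strict Implicit.
Unset Printing Implicit Defensive.
Import Order.TTheory GRing.Theory Num.Theory.
Import numFieldNormedType.Exports.
Import ComplexField.Normc.
Local Open Scope classical_set_scope.
Local Open Scope complex_scope.
Local Open Scope ring_scope.

(* R^n is the type of n-tuples of reals with its product (= Borel)
   sigma-algebra; the measure on R^(n+1) is the image of the product measure on
   R * R^n under (x, t) |-> x :: t. *)
Section cons_measure.
Context d (T : measurableType d) (R : realType) (n : nat).
Variable mu : {sigma_finite_measure set T -> \bar R}.
Variable nu : {sigma_finite_measure set (n.-tuple T) -> \bar R}.

Definition tcons (p : T * n.-tuple T) : n.+1.-tuple T := [tuple of p.1 :: p.2].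

Lemma measurable_tcons : measurable_fun setT tcons.
Proof. exact: measurable_cons. Qed.

Definition cons_measure : set (n.+1.-tuple T) -> \bar R :=
  pushforward (mu \x nu)%E tcons.

HB.instance Definition _ := Measure.copy cons_measure
  (measure_function_pushforward__canonical__measure_function_Measure
     (mu \x nu)%E measurable_tcons).

Lemma tcons_preimage (A : set T) (B : set (n.-tuple T)) :
  tcons @^-1` [set t : n.+1.-tuple T | A (thead t) /\ B [tuple of behead t]]
  = A `*` B.
Proof.
apply/seteqP; split => -[x t] /= [Ax Bt]; split => //=.
- by have -> : t = [tuple of behead (tcons (x, t))] by exact: val_inj.
- by have <- : t = [tuple of behead (tcons (x, t))] by exact: val_inj.
Qed.

Lemma measurable_cons_set (A : set T) (B : set (n.-tuple T)) :
  measurable A -> measurable B ->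
  measurable [set t : n.+1.-tuple T | A (thead t) /\ B [tuple of behead t]].
Proof.
move=> mA mB; apply: measurableI.
- by rewrite -[X in measurable X]setTI; exact: (measurable_tnth ord0).
- by rewrite -[X in measurable X]setTI; exact: measurable_behead.
Qed.

Lemma cons_measureE (A : set T) (B : set (n.-tuple T)) :
  measurable A -> measurable B ->
  cons_measure [set t : n.+1.-tuple T | A (thead t) /\ B [tuple of behead t]]
  = (mu A * nu B)%E.
Proof.
by move=> mA mB; rewrite /cons_measure /pushforward tcons_preimage
  product_measure1E.
Qed.

Lemma cons_measure_sigma_finite : sigma_finite setT cons_measure.
Proof.
have /sigma_finiteP[F [FT ndF mF]] := sigma_finiteT mu.
have /sigma_finiteP[G [GT ndG mG]] := sigma_finiteT nu.
exists (fun k => [set t : n.+1.-tuple T |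
    F k (thead t) /\ G k [tuple of behead t]]).
  apply/esym; rewrite -subTset => t _.
  have [i _ Fi] : (\bigcup_i F i) (thead t) by rewrite -FT.
  have [j _ Gj] : (\bigcup_j G j) [tuple of behead t] by rewrite -GT.
  exists (maxn i j) => //; split.
    by move: Fi; apply/subsetPset/ndF; exact: leq_maxl.
  by move: Gj; apply/subsetPset/ndG; exact: leq_maxr.
move=> k; have [mFk Fk] := mF k; have [mGk Gk] := mG k.
split; first exact: measurable_cons_set.
by rewrite cons_measureE// lte_mul_pinfty// ge0_fin_numE.
Qed.

HB.instance Definition _ :=
  @Measure_isSigmaFinite.Build _ _ _ cons_measure cons_measure_sigma_finite.

End cons_measure.

Section lebesgue_n.
Variable R : realType.

Fixpoint lebesgue_n (n : nat) :
    {sigma_finite_measure set (n.-tuple (measurableTypeR R)) -> \bar R} :=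
  match n with
  | 0 => @dirac _ (0.-tuple (measurableTypeR R)) [tuple] R
  | k.+1 => cons_measure (@lebesgue_measure R) (lebesgue_n k)
  end.

Lemma lebesgue_n_box (n : nat) (A : 'I_n -> set (measurableTypeR R)) :
  (forall i, measurable (A i)) ->
  lebesgue_n n [set t | forall i, A i (tnth t i)]
  = (\prod_(i < n) lebesgue_measure (A i))%E.
Proof.
elim: n A => [|n IHn] A mA.
  rewrite big_ord0 /= diracE mem_set//= => -[]//.
rewrite big_ord_recl -(IHn (A \o lift ord0)); last by move=> i; exact: mA.
rewrite -cons_measureE//; last first.
  rewrite [X in measurable X](_ : _ = \bigcap_(i in setT)
    ((fun t => tnth t i) @^-1` A (lift ord0 i))); last first.
    by apply/seteqP; split => [t At i _|t At i]; [exact: At|exact: At].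
  apply: fin_bigcap_measurable => // i _.
  by rewrite -[X in measurable X]setTI; exact: measurable_tnth.
congr (cons_measure _ _ _); apply/seteqP; split => t /=.
  move=> At; split; first exact: At.
  by move=> i; have := At (lift ord0 i); rewrite !(tnth_nth 0) /= -nth_behead.
move=> [At0 At] i; case: (unliftP ord0 i) => [j ->|->//].
by have := At j; rewrite !(tnth_nth 0) /= -nth_behead.
Qed.

End lebesgue_n.

Section complex_integral.
Context d (T : measurableType d) (R : realType).
Variable mu : {measure set T -> \bar R}.
Implicit Type f : T -> R[i].

Definition cmeasurable f :=
  measurable_fun setT (fun x => complex.Re (f x)) /\
  measurable_fun setT (fun x => complex.Im (f x)).

Definition cintegrable f :=
  mu.-integrable setT (fun x => (complex.Re (f x))%:E) /\
  mu.-integrable setT (fun x => (complex.Im (f x))%:E).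

Definition cintegral f : R[i] :=
  (\int[mu]_x complex.Re (f x)) +i* (\int[mu]_x complex.Im (f x)).

Definition Linfty f :=
  cmeasurable f /\ ('N[mu]_+oo[(fun x => (normc (f x))%:E)] < +oo)%E.

Definition essential_range f : set R[i] :=
  [set a | forall e : R, 0 < e -> (0 < mu [set x | (normc (f x - a) < e)%R])%E].

End complex_integral.

(* The Hilbert space is a subset H of an ambient vector space V with norm N;
   only the values of N and of the operators on H are relevant. *)
Section operators.
Variables (R : realType) (V : lmodType R[i]) (H : set V) (N : V -> R).
Implicit Types (T : V -> V) (a : R[i]).

Definition bounded_operator T :=
  [/\ forall F, H F -> H (T F),
      forall a F G, H F -> H G -> T (a *: F + G) = a *: T F + T G &
      exists M : R, forall F, H F -> N (T F) <= M * N F].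

Definition invertible_operator T :=
  exists S : V -> V,
    [/\ bounded_operator S,
        forall F, H F -> S (T F) = F &
        forall F, H F -> T (S F) = F].

Definition shift_operator T a : V -> V := fun F => T F - a *: F.

Definition spectrum T : set R[i] :=
  [set a | ~ invertible_operator (shift_operator T a)].

Definition is_eigenvalue T a := exists F, [/\ H F, F <> 0 & T F = a *: F].

Definition approximate_point_spectrum T : set R[i] :=
  [set a | exists F : nat -> V,
    [/\ forall k, H (F k),
        forall k, N (F k) = 1 &
        N (shift_operator T a (F k)) @[k --> \oo] --> (0 : R)]].

Definition finite_dim_kernel T :=
  exists (k : nat) (b : 'I_k -> V),
    (forall i, H (b i) /\ T (b i) = 0) /\
    forall F, H F -> T F = 0 ->
      exists c : 'I_k -> R[i], F = \sum_(i < k) c i *: b i.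

Definition finite_codim_range T :=
  exists (k : nat) (b : 'I_k -> V),
    (forall i, H (b i)) /\
    forall G, H G ->
      exists (F : V) (c : 'I_k -> R[i]), H F /\ G = T F + \sum_(i < k) c i *: b i.

Definition closed_range T :=
  forall (F : nat -> V) (G : V), (forall k, H (F k)) -> H G ->
    N (T (F k) - G) @[k --> \oo] --> (0 : R) ->
    exists2 F0, H F0 & T F0 = G.

Definition fredholm T :=
  [/\ finite_dim_kernel T, closed_range T & finite_codim_range T].

Definition essential_spectrum T : set R[i] :=
  [set a | ~ fredholm (shift_operator T a)].

End operators.

Section fock.
Variable R : realType.

Definition cexp (z : R[i]) : R[i] :=
  (expR (complex.Re z))%:C * (cos (complex.Im z) +i* sin (complex.Im z)).

Definition dotc n (a b : 'rV[R[i]]_n) : R[i] := \sum_(j < n) a 0 j * b 0 j.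

Definition conj_vec n (w : 'rV[R[i]]_n) : 'rV[R[i]]_n := map_mx conjc w.

Definition real_vec n (x : n.-tuple (measurableTypeR R)) : 'rV[R[i]]_n :=
  \row_j (tnth x j)%:C.

(* The identification (x, y) |-> x + i y of R^n * R^n with C^n, through which
   integrals over C^n are defined. *)
Definition complex_vec n
    (p : n.-tuple (measurableTypeR R) * n.-tuple (measurableTypeR R)) :
    'rV[R[i]]_n :=
  \row_j ((tnth p.1 j : R) +i* (tnth p.2 j : R)).

Definition lebesgue_C n :
    {measure set (n.-tuple (measurableTypeR R) * n.-tuple (measurableTypeR R))
      -> \bar R} :=
  (lebesgue_n R n \x lebesgue_n R n)%E.

Definition gauss_density n (z : 'rV[R[i]]_n) : R :=
  pi ^- n * expR (- \sum_(j < n) normc (z 0 j) ^+ 2).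

Definition gauss_integrable n (f : 'rV[R[i]]_n -> R[i]) :=
  cintegrable (lebesgue_C n)
    (fun p => f (complex_vec p) * (gauss_density (complex_vec p))%:C).

Definition gauss_integral n (f : 'rV[R[i]]_n -> R[i]) : R[i] :=
  cintegral (lebesgue_C n)
    (fun p => f (complex_vec p) * (gauss_density (complex_vec p))%:C).

Definition fock_sqnorm n (F : 'rV[R[i]]_n -> R[i]) : \bar R :=
  (\int[lebesgue_C n]_p
    (normc (F (complex_vec p)) ^+ 2 * gauss_density (complex_vec p))%:E)%E.

Definition fock_norm n (F : 'rV[R[i]]_n -> R[i]) : R :=
  Num.sqrt (fine (fock_sqnorm F)).

(* Here 'differentiable' is over the field R[i]: complex differentiability. *)
Definition entire n (F : 'rV[R[i]]_n.+1 -> R[i]^o) :=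
  forall z, differentiable F z.

Definition fock_space n : set ('rV[R[i]]_n.+1 -> R[i]^o) :=
  [set F | entire F /\ (fock_sqnorm F < +oo)%E].

Section S_operator.
Variables (n : nat) (phi : 'rV[R[i]]_n.+1 -> R[i]^o).

Definition S_integrand (F : 'rV[R[i]]_n.+1 -> R[i]^o) (z w : 'rV[R[i]]_n.+1) :
    R[i] :=
  F w * cexp (dotc z (conj_vec w)) * phi (z - conj_vec w).

Definition S_operator (F : 'rV[R[i]]_n.+1 -> R[i]^o) :
    'rV[R[i]]_n.+1 -> R[i]^o :=
  fun z => gauss_integral (S_integrand F z).

(* cintegral is total, so convergence of the defining integral is required
   explicitly. *)
Definition S_bounded :=
  (forall F, fock_space F -> forall z, gauss_integrable (S_integrand F z)) /\
  bounded_operator (@fock_space n) (@fock_norm n.+1) S_operator.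

End S_operator.

Definition gauss_transform n (m : n.-tuple (measurableTypeR R) -> R[i])
    (z : 'rV[R[i]]_n) : R[i] :=
  ((2 / pi) `^ (n%:R / 2))%:C *
  cintegral (lebesgue_n R n) (fun x =>
    let u := real_vec x - ('i%C / 2) *: z in m x * cexp (- 2 * dotc u u)).

End fock.

(* Main.v *)
(* The Bargmann transform
     [B f (z) = (2/pi)^(n/4) \int f(x) e^(2i x.z + z.z/2 - x.x) dx]
   (with kernel in the variable [i z], to match the normalization of [m]) is unitary from
   [L^2(R^n)] onto the Fock space and conjugates [S_phi] to multiplication by [m], since
   [e^(z.w~) phi(z - w~)] is the integral of [m] against [k_z * conj k_w], where [k_z] is its
   kernel at [z].  Isometry: against the square root of the Gaussian weight, [B f] is a windowed
   Fourier transform, so Plancherel applies.  Surjectivity: an [F] in the Fock space is reproduced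
   by the functions [B (conj k_z)], and the Riesz-type adjoint of [B] yields [f] with
   [<f, conj k_z> = <F, B (conj k_z)> = F z].

   For multiplication by a bounded [m], [(m - a)^-1] is an inverse off the essential range; on
   it, unit vectors supported where [|m - a| < 1/k] are approximate eigenvectors.  [m - a] is
   not Fredholm there: if [m = a] has positive measure the kernel is infinite-dimensional because
   Lebesgue measure has no atoms, and otherwise the range is not closed. *)

Require Import Defs.
From HB Require Import structures.
From mathcomp Require Import all_boot all_order all_algebra.
From mathcomp Require Import complex.
From mathcomp Require Import all_classical all_reals all_analysis.
From mathcomp Require Import measurable_realfun.
From mathcomp Require Import ring lra.

Set Implicit Arguments.
Unset Strict Implicit.
Unset Printing Implicit Defensive.
Import Order.TTheory GRing.Theory Num.Theory.
Import numFieldNormedType.Exports.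
Import ComplexField.Normc.
Local Open Scope classical_set_scope.
Local Open Scope complex_scope.
Local Open Scope ring_scope.

(** * Complex-valued integration *)

(** The analytic input is reduced to one fact, the mean value property of a holomorphic function of
    one variable on the unit circle, obtained from Goursat's theorem. Averaging over the rotations
    [v |-> e^(it) v] turns it into a formula, in any dimension, for the integral of a holomorphic
    function against a centred Gaussian. That formula gives both the Fourier integral of the
    Gaussian and the reproducing formula of the Fock space. Plancherel is needed only for functions
    that are integrable as well as square integrable, because the Gaussian window makes each slice
    of the transform the Fourier transform of such a function. For surjectivity the difficulty is
    that [L^2] consists of honest functions, not classes, and its duality has to be made explicit:
    the weighted kernel of [B] is bounded, so on integrable functions the adjoint is an integral and
    Fubini applies, and completeness of [L^2] then removes the integrability. *)

Section complex_numbers.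
Variable R : realType.
Implicit Types (x y : R[i]) (r : R).

Lemma Re_mk (a b : R) : complex.Re (a +i* b) = a. Proof. by []. Qed.
Lemma Im_mk (a b : R) : complex.Im (a +i* b) = b. Proof. by []. Qed.

Lemma complex_ext x y :
  complex.Re x = complex.Re y -> complex.Im x = complex.Im y -> x = y.
Proof. by case: x y => a b [c d] /= -> ->. Qed.

Lemma cReD x y : complex.Re (x + y) = complex.Re x + complex.Re y.
Proof. by case: x y => a b [c d]. Qed.

Lemma cImD x y : complex.Im (x + y) = complex.Im x + complex.Im y.
Proof. by case: x y => a b [c d]. Qed.

Lemma cReN x : complex.Re (- x) = - complex.Re x. Proof. by case: x. Qed.
Lemma cImN x : complex.Im (- x) = - complex.Im x. Proof. by case: x. Qed.

Lemma cReM x y : complex.Re (x * y) =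
  complex.Re x * complex.Re y - complex.Im x * complex.Im y.
Proof. by case: x y => a b [c d]. Qed.

Lemma cImM x y : complex.Im (x * y) =
  complex.Re x * complex.Im y + complex.Im x * complex.Re y.
Proof. by case: x y => a b [c d]. Qed.

Lemma cReJ x : complex.Re (conjc x) = complex.Re x. Proof. by case: x. Qed.
Lemma cImJ x : complex.Im (conjc x) = - complex.Im x. Proof. by case: x. Qed.

Lemma cRe1 : complex.Re (1 : R[i]) = 1. Proof. by []. Qed.
Lemma cIm1 : complex.Im (1 : R[i]) = 0. Proof. by []. Qed.
Lemma cRe0 : complex.Re (0 : R[i]) = 0. Proof. by []. Qed.
Lemma cIm0 : complex.Im (0 : R[i]) = 0. Proof. by []. Qed.

Definition ReImE := (cReD, cImD, cReN, cImN, cReM, cImM, cReJ, cImJ, Re_mk, Im_mk,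
  cRe1, cIm1, cRe0, cIm0).

Lemma Re_sum (I : Type) (s : seq I) (P : pred I) (F : I -> R[i]) :
  complex.Re (\sum_(i <- s | P i) F i) = \sum_(i <- s | P i) complex.Re (F i).
Proof. by elim/big_ind2 : _ => // x a y b <- <-; rewrite cReD. Qed.

Lemma Im_sum (I : Type) (s : seq I) (P : pred I) (F : I -> R[i]) :
  complex.Im (\sum_(i <- s | P i) F i) = \sum_(i <- s | P i) complex.Im (F i).
Proof. by elim/big_ind2 : _ => // x a y b <- <-; rewrite cImD. Qed.

Lemma conjcM x y : conjc (x * y) = conjc x * conjc y.
Proof. exact: rmorphM. Qed.

Lemma conjcD x y : conjc (x + y) = conjc x + conjc y.
Proof. exact: rmorphD. Qed.

Lemma conjcB x y : conjc (x - y) = conjc x - conjc y.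
Proof. exact: rmorphB. Qed.

Lemma conjcN x : conjc (- x) = - conjc x.
Proof. exact: rmorphN. Qed.

Lemma conjcr r : conjc r%:C = r%:C :> R[i].
Proof. exact: conjc_real. Qed.

Lemma normc_ge0 x : 0 <= normc x.
Proof. by case: x => a b /=; exact: sqrtr_ge0. Qed.

Lemma sqr_normc_ReIm x : normc x ^+ 2 = complex.Re x ^+ 2 + complex.Im x ^+ 2.
Proof. by case: x => a b /=; rewrite sqr_sqrtr// addr_ge0// sqr_ge0. Qed.

Lemma normr_normc x : `|x| = (normc x)%:C.
Proof. by rewrite normc_def; case: x. Qed.

Lemma mulcJ x : x * conjc x = (normc x ^+ 2)%:C.
Proof.
by apply: complex_ext; rewrite sqr_normc_ReIm !ReImE/=; ring.
Qed.

Lemma le_Re_normc x : `|complex.Re x| <= normc x.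
Proof.
case: x => a b /=; rewrite -sqrtr_sqr ler_wsqrtr// lerDl sqr_ge0//.
Qed.

Lemma le_Im_normc x : `|complex.Im x| <= normc x.
Proof.
case: x => a b /=; rewrite -sqrtr_sqr ler_wsqrtr// lerDr sqr_ge0//.
Qed.

Lemma normc_le_ReIm x : normc x <= `|complex.Re x| + `|complex.Im x|.
Proof.
rewrite -(@ler_pXn2r _ 2)// ?nnegrE ?addr_ge0 ?normc_ge0//.
rewrite sqr_normc_ReIm sqrrD !real_normK ?num_real//.
by rewrite lerD2r lerDl mulrn_wge0// mulr_ge0.
Qed.

Lemma normcr r : normc r%:C = `|r|.
Proof. by rewrite /= expr0n addr0 sqrtr_sqr. Qed.

Lemma normc_conj x : normc (conjc x) = normc x.
Proof. by case: x => a b /=; rewrite sqrrN. Qed.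

Lemma le_normcB x y : normc (x - y) <= normc x + normc y.
Proof. by rewrite (le_trans (le_normcD _ _))// normcN. Qed.

Lemma normc_distC x y : normc (x - y) = normc (y - x).
Proof. by rewrite -normcN opprB. Qed.

Lemma normc_sum (I : Type) (s : seq I) (P : pred I) (F : I -> R[i]) :
  normc (\sum_(i <- s | P i) F i) <= \sum_(i <- s | P i) normc (F i).
Proof.
elim/big_ind2 : _ => [|x a y b xa yb|i _]; rewrite ?normc0//.
by rewrite (le_trans (le_normcD _ _))// lerD.
Qed.

Lemma normc_eq0 x : (normc x == 0) = (x == 0).
Proof. by apply/eqP/eqP => [/eq0_normc|->]//; rewrite normc0. Qed.

Lemma normc_gt0 x : (0 < normc x) = (x != 0).
Proof. by rewrite lt0r normc_eq0 normc_ge0 andbT. Qed.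

Lemma sqr_normcD_le x y :
  normc (x + y) ^+ 2 <= 2 * normc x ^+ 2 + 2 * normc y ^+ 2.
Proof.
rewrite !sqr_normc_ReIm !ReImE.
by have := sqr_ge0 (complex.Re x - complex.Re y);
  have := sqr_ge0 (complex.Im x - complex.Im y); nra.
Qed.

Lemma cexpD x y : cexp (x + y) = cexp x * cexp y.
Proof.
rewrite /cexp !ReImE expRD cosD sinD; apply: complex_ext; rewrite !ReImE/=; ring.
Qed.

Lemma cexp0 : cexp 0 = 1 :> R[i].
Proof.
rewrite /cexp !ReImE expR0 cos0 sin0; apply: complex_ext; rewrite !ReImE/=; ring.
Qed.

Lemma conj_cexp x : conjc (cexp x) = cexp (conjc x).
Proof.
rewrite /cexp !ReImE cosN sinN; apply: complex_ext; rewrite !ReImE/=; ring.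
Qed.

Lemma normc_cexp x : normc (cexp x) = expR (complex.Re x).
Proof.
rewrite /cexp normcM normcr ger0_norm ?expR_ge0//.
by rewrite [X in _ * X]/= cos2Dsin2 sqrtr1 mulr1.
Qed.

Lemma cexp_neq0 x : cexp x != 0.
Proof. by rewrite -normc_gt0 normc_cexp expR_gt0. Qed.

Lemma cexpr r : cexp r%:C = (expR r)%:C.
Proof. by rewrite /cexp/= cos0 sin0; apply: complex_ext; rewrite !ReImE/=; ring. Qed.

Lemma cexpN x : cexp (- x) = (cexp x)^-1.
Proof.
apply: (mulIf (cexp_neq0 x)); rewrite -cexpD addNr cexp0 mulVf//.
exact: cexp_neq0.
Qed.

End complex_numbers.

Arguments normc : simpl never.
Arguments cexp : simpl never.
Arguments cintegral : simpl never.

Section cmeasurable.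
Context d (T : measurableType d) (R : realType).
Implicit Types f g : T -> R[i].

Lemma cmeasurable_cst (c : R[i]) : cmeasurable (fun _ : T => c).
Proof. by split; exact: measurable_cst. Qed.

Lemma cmeasurable_real (h : T -> R) : measurable_fun setT h ->
  cmeasurable (fun x => (h x)%:C).
Proof. by move=> mh; split => //=; exact: measurable_cst. Qed.

Lemma cmeasurableD f g : cmeasurable f -> cmeasurable g ->
  cmeasurable (fun x => f x + g x).
Proof.
move=> [f1 f2] [g1 g2]; split.
- by under eq_fun do rewrite cReD; exact: measurable_funD.
- by under eq_fun do rewrite cImD; exact: measurable_funD.
Qed.

Lemma cmeasurableM f g : cmeasurable f -> cmeasurable g ->
  cmeasurable (fun x => f x * g x).
Proof.
move=> [f1 f2] [g1 g2]; split.
- by under eq_fun do rewrite cReM; apply: measurable_funB; exact: measurable_funM.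
- by under eq_fun do rewrite cImM; apply: measurable_funD; exact: measurable_funM.
Qed.

Lemma cmeasurableN f : cmeasurable f -> cmeasurable (fun x => - f x).
Proof.
move=> [f1 f2]; split.
- by under eq_fun do rewrite cReN; exact: measurableT_comp.
- by under eq_fun do rewrite cImN; exact: measurableT_comp.
Qed.

Lemma cmeasurableB f g : cmeasurable f -> cmeasurable g ->
  cmeasurable (fun x => f x - g x).
Proof. by move=> mf mg; apply: cmeasurableD => //; exact: cmeasurableN. Qed.

Lemma cmeasurableJ f : cmeasurable f -> cmeasurable (fun x => conjc (f x)).
Proof.
move=> [f1 f2]; split.
- by under eq_fun do rewrite cReJ.
- by under eq_fun do rewrite cImJ; exact: measurableT_comp.
Qed.

Lemma cmeasurable_sum (I : Type) (s : seq I) (F : I -> T -> R[i]) :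
  (forall i, cmeasurable (F i)) -> cmeasurable (fun x => \sum_(i <- s) F i x).
Proof.
move=> mF; elim: s => [|i s IH].
  by under eq_fun do rewrite big_nil; exact: cmeasurable_cst.
by under eq_fun do rewrite big_cons; exact: cmeasurableD.
Qed.

Lemma cmeasurable_cexp f : cmeasurable f -> cmeasurable (fun x => cexp (f x)).
Proof.
move=> [f1 f2]; rewrite /cexp; apply: cmeasurableM.
  by apply: cmeasurable_real; exact: measurableT_comp.
split => /=.
  by apply: measurableT_comp f2; apply: continuous_measurable_fun; exact: continuous_cos.
by apply: measurableT_comp f2; apply: continuous_measurable_fun; exact: continuous_sin.
Qed.

Lemma measurable_normc f : cmeasurable f ->
  measurable_fun setT (fun x => normc (f x)).
Proof.
move=> [f1 f2].
rewrite (_ : (fun x => _) = (fun x =>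
   Num.sqrt (complex.Re (f x) ^+ 2 + complex.Im (f x) ^+ 2))); last first.
  by apply/funext => x; case: (f x).
apply: (@measurableT_comp _ _ _ _ _ _ (@Num.sqrt R)).
  by apply: continuous_measurable_fun; exact: sqrt_continuous.
by apply: measurable_funD; exact: measurable_funX.
Qed.

Lemma cmeasurable_comp d' (T' : measurableType d') (h : T' -> T) f :
  measurable_fun setT h -> cmeasurable f -> cmeasurable (f \o h).
Proof. by move=> mh [f1 f2]; split; [exact: (measurableT_comp f1)|exact: (measurableT_comp f2)]. Qed.

Lemma cmeasurable_restrict (A : set T) f : measurable A -> cmeasurable f ->
  cmeasurable (fun x => f x * (\1_A x)%:C).
Proof.
by move=> mA mf; apply: cmeasurableM => //; exact: cmeasurable_real.
Qed.

End cmeasurable.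

Section cintegral.
Context d (T : measurableType d) (R : realType).
Variable mu : {measure set T -> \bar R}.
Implicit Types f g : T -> R[i].

Lemma eq_cintegral f g : f =1 g -> cintegral mu f = cintegral mu g.
Proof. by move=> /funext ->. Qed.

Lemma cintegrable_cmeasurable f : cintegrable mu f -> cmeasurable f.
Proof.
by move=> [] /measurable_int/measurable_EFinP h1 /measurable_int/measurable_EFinP h2.
Qed.

Lemma cintegrableP f : cintegrable mu f <->
  cmeasurable f /\ (\int[mu]_x (normc (f x))%:E < +oo)%E.
Proof.
split=> [fi|[mf fi]].
  have mf := cintegrable_cmeasurable fi.
  split => //; case: fi => /integrableP[m1 i1] /integrableP[m2 i2].
  apply: le_lt_trans (lte_add_pinfty i1 i2).
  rewrite -ge0_integralD//; [|exact: measurableT_comp|exact: measurableT_comp].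
  apply: ge0_le_integral => //.
  - by move=> x _; rewrite lee_fin normc_ge0.
  - by apply/measurable_EFinP; exact: measurable_normc.
  - by apply: emeasurable_funD; exact: measurableT_comp.
  - by move=> x _ /=; rewrite -EFinD lee_fin normc_le_ReIm.
case: (mf) => m1 m2; split; apply/integrableP; split.
- exact/measurable_EFinP.
- apply: le_lt_trans fi; apply: ge0_le_integral => //.
  + by do 2 apply: measurableT_comp => //.
  + by apply/measurable_EFinP; exact: measurable_normc.
  + by move=> x _ /=; rewrite lee_fin le_Re_normc.
- exact/measurable_EFinP.
- apply: le_lt_trans fi; apply: ge0_le_integral => //.
  + by do 2 apply: measurableT_comp => //.
  + by apply/measurable_EFinP; exact: measurable_normc.
  + by move=> x _ /=; rewrite lee_fin le_Im_normc.
Qed.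

Lemma cintegrable_le f (g : T -> R) : cmeasurable f ->
  mu.-integrable setT (EFin \o g) -> (forall x, normc (f x) <= g x) ->
  cintegrable mu f.
Proof.
move=> mf /integrableP[mg gi] fg; apply/cintegrableP; split => //.
apply: le_lt_trans gi; apply: ge0_le_integral => //.
- by move=> x _; rewrite lee_fin normc_ge0.
- by apply/measurable_EFinP; exact: measurable_normc.
- exact: measurableT_comp.
- by move=> x _ /=; rewrite lee_fin (le_trans (fg x)) ?ler_norm.
Qed.

Lemma integrable_normc f : cintegrable mu f ->
  mu.-integrable setT (EFin \o (fun x => normc (f x))).
Proof.
move=> /cintegrableP[mf fi]; apply/integrableP; split.
  by apply/measurable_EFinP; exact: measurable_normc.
by under eq_integral do rewrite gee0_abs ?lee_fin ?normc_ge0//.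
Qed.

Lemma cintegrableD f g : cintegrable mu f -> cintegrable mu g ->
  cintegrable mu (fun x => f x + g x).
Proof.
move=> [f1 f2] [g1 g2]; split.
- by under eq_fun do rewrite cReD EFinD; exact: integrableD.
- by under eq_fun do rewrite cImD EFinD; exact: integrableD.
Qed.

Lemma cintegrableZ (c : R[i]) f : cintegrable mu f ->
  cintegrable mu (fun x => c * f x).
Proof.
move=> [f1 f2]; split.
- under eq_fun do rewrite cReM EFinB !EFinM.
  by apply: integrableB => //; exact: integrableZl.
- under eq_fun do rewrite cImM EFinD !EFinM.
  by apply: integrableD => //; exact: integrableZl.
Qed.

Lemma cintegrableN f : cintegrable mu f -> cintegrable mu (fun x => - f x).
Proof. by under eq_fun do rewrite -mulN1r; exact: cintegrableZ. Qed.

Lemma cintegrableB f g : cintegrable mu f -> cintegrable mu g ->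
  cintegrable mu (fun x => f x - g x).
Proof. by move=> fi gi; apply: cintegrableD => //; exact: cintegrableN. Qed.

Lemma cintegrableJ f : cintegrable mu f -> cintegrable mu (fun x => conjc (f x)).
Proof.
move=> [f1 f2]; split; first by under eq_fun do rewrite cReJ.
under eq_fun do rewrite cImJ EFinN; exact: integrableN.
Qed.

Lemma cintegralD f g : cintegrable mu f -> cintegrable mu g ->
  cintegral mu (fun x => f x + g x) = cintegral mu f + cintegral mu g.
Proof.
move=> [f1 f2] [g1 g2]; apply: complex_ext; rewrite !ReImE -RintegralD//.
- by apply: eq_Rintegral => x _; rewrite cReD.
- by apply: eq_Rintegral => x _; rewrite cImD.
Qed.

Lemma cintegralZ (c : R[i]) f : cintegrable mu f ->
  cintegral mu (fun x => c * f x) = c * cintegral mu f.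
Proof.
move=> [f1 f2]; apply: complex_ext; rewrite !ReImE -!RintegralZl//.
- rewrite -RintegralB//.
  + by apply: eq_Rintegral => x _; rewrite cReM.
  + exact: (integrableZl measurableT _ f1).
  + exact: (integrableZl measurableT _ f2).
- rewrite -RintegralD//.
  + by apply: eq_Rintegral => x _; rewrite cImM.
  + exact: (integrableZl measurableT _ f2).
  + exact: (integrableZl measurableT _ f1).
Qed.

Lemma cintegralN f : cintegrable mu f ->
  cintegral mu (fun x => - f x) = - cintegral mu f.
Proof.
by move=> fi; rewrite -mulN1r -cintegralZ//; apply: eq_cintegral => x; rewrite mulN1r.
Qed.

Lemma cintegralB f g : cintegrable mu f -> cintegrable mu g ->
  cintegral mu (fun x => f x - g x) = cintegral mu f - cintegral mu g.
Proof. by move=> fi gi; rewrite cintegralD ?cintegralN//; exact: cintegrableN. Qed.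

Lemma cintegralJ f : cintegrable mu f ->
  cintegral mu (fun x => conjc (f x)) = conjc (cintegral mu f).
Proof.
move=> [f1 f2]; apply: complex_ext; rewrite !ReImE.
  by apply: eq_Rintegral => x _; rewrite cReJ.
rewrite -mulN1r -RintegralZl//.
by apply: eq_Rintegral => x _; rewrite cImJ mulN1r.
Qed.

Lemma cintegral_real (h : T -> R) :
  cintegral mu (fun x => (h x)%:C) = (\int[mu]_x h x)%:C.
Proof.
by apply: complex_ext; rewrite !ReImE//= /Rintegral integral0.
Qed.

(** A unimodular factor [u] rotates the integral onto the positive real axis. Its modulus is then
    the integral of [Re (u f)], which is at most that of [|f|]. *)
Lemma normc_cintegral f : cintegrable mu f ->
  normc (cintegral mu f) <= \int[mu]_x normc (f x).
Proof.
move=> fi; set c := cintegral mu f.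
have [c0|c0] := eqVneq c 0.
  by rewrite c0 normc0; apply: Rintegral_ge0 => x _; exact: normc_ge0.
pose u := conjc c / (normc c)%:C.
have nc : (normc c)%:C != 0 :> R[i] by rewrite fmorph_eq0 normc_eq0.
have uc : u * c = (normc c)%:C.
  by rewrite /u mulrAC (mulrC (conjc c)) mulcJ expr2 rmorphM/= mulfK.
have nu : normc u = 1.
  by rewrite /u normcM normcV normc_conj normcr ger0_norm ?normc_ge0// divff// normc_eq0.
have -> : normc c = complex.Re (u * c) by rewrite uc.
have ui : cintegrable mu (fun x => u * f x) by exact: cintegrableZ.
rewrite /c -cintegralZ// Re_mk; apply: le_Rintegral => //.
- by case: ui.
- exact: integrable_normc.
- move=> x _; apply: le_trans (ler_norm _) _.
  by rewrite (le_trans (le_Re_normc _))// normcM nu mul1r.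
Qed.

Lemma cintegral_sum (I : eqType) (s : seq I) (F : I -> T -> R[i]) :
  (forall i, cintegrable mu (F i)) ->
  cintegral mu (fun x => \sum_(i <- s) F i x) = \sum_(i <- s) cintegral mu (F i).
Proof.
move=> Fi.
have c0 : cintegral mu (fun=> 0) = 0 :> R[i].
  by rewrite cintegral_real /Rintegral integral0.
suff [] : cintegrable mu (fun x => \sum_(i <- s) F i x) /\
    cintegral mu (fun x => \sum_(i <- s) F i x) = \sum_(i <- s) cintegral mu (F i) by [].
elim: s => [|i s [IH1 IH2]].
  rewrite big_nil; under eq_fun do rewrite big_nil.
  split => //; apply/cintegrableP; split; first exact: cmeasurable_cst.
  by under eq_integral do rewrite normc0; rewrite integral0.
rewrite big_cons; under eq_fun do rewrite big_cons.
by split; [exact: cintegrableD|rewrite cintegralD// IH2].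
Qed.

Lemma integral_dominated0 (h_ : nat -> T -> R) (g : T -> R) :
  (forall n, measurable_fun setT (h_ n)) ->
  (forall n x, 0 <= h_ n x) ->
  (forall x, h_ n x @[n --> \oo] --> (0 : R)) ->
  mu.-integrable setT (EFin \o g) -> (forall n x, h_ n x <= g x) ->
  (\int[mu]_x (h_ n x)%:E @[n --> \oo] --> 0)%E.
Proof.
move=> mh h0 hcvg ig hg.
have := @dominated_convergence _ _ _ mu setT measurableT
  (fun n x => (h_ n x)%:E) (cst 0%E) (EFin \o g).
case.
- by move=> n; exact/measurable_EFinP.
- exact: measurable_cst.
- by apply: aeW => x _; apply: cvg_EFin; [exact: nearW|exact: hcvg].
- exact: ig.
- by apply: aeW => x n _ /=; rewrite lee_fin ger0_norm.
- by move=> _ _; rewrite integral0.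
Qed.

Lemma cintegral_dominated (f_ : nat -> T -> R[i]) f (g : T -> R) :
  (forall n, cmeasurable (f_ n)) -> cmeasurable f ->
  (forall x, normc (f_ n x - f x) @[n --> \oo] --> (0 : R)) ->
  mu.-integrable setT (EFin \o g) -> (forall n x, normc (f_ n x) <= g x) ->
  cintegrable mu f /\
  normc (cintegral mu (f_ n) - cintegral mu f) @[n --> \oo] --> (0 : R).
Proof.
move=> mf_ mf fcvg ig fg.
have fg' x : normc (f x) <= g x.
  apply/ler_addgt0Pr => e e0.
  have /cvgrPdist_le/(_ _ e0)[N _ /(_ N (leqnn N))] := fcvg x.
  rewrite sub0r normrN ger0_norm ?normc_ge0// => le_e.
  rewrite -[f x](subrK (f_ N x)) addrC (le_trans (le_normcD _ _))//.
  by rewrite lerD// normc_distC.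
have fi : cintegrable mu f by exact: cintegrable_le ig fg'.
have fi_ n : cintegrable mu (f_ n) by exact: cintegrable_le ig (fg n).
split => //.
have h0 := @integral_dominated0 (fun n x => normc (f_ n x - f x))
  (fun x => 2 * g x).
have /h0 {}h0 : forall n, measurable_fun setT (fun x => normc (f_ n x - f x)).
  by move=> n; apply: measurable_normc; exact: cmeasurableB.
have {}h0 := h0 (fun n x => normc_ge0 _) fcvg (integrableZl measurableT 2 ig).
have {}h0 : (\int[mu]_x (normc (f_ n x - f x))%:E @[n --> \oo] --> 0)%E.
  apply: h0 => n x; rewrite (le_trans (le_normcB _ _))// mulr2n mulrDl !mul1r.
  by rewrite lerD.
move/fine_cvgP : h0 => [_ h0].
apply: squeeze_cvgr h0; last exact: cvg_cst.
apply: nearW => n /=; rewrite normc_ge0 -(cintegralB (fi_ n) fi).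
by apply: normc_cintegral; exact: cintegrableB.
Qed.

End cintegral.

Section cfubini.
Context d1 d2 (T1 : measurableType d1) (T2 : measurableType d2) (R : realType).
Variable m1 : {sigma_finite_measure set T1 -> \bar R}.
Variable m2 : {sigma_finite_measure set T2 -> \bar R}.
Implicit Type f : T1 * T2 -> R[i].

(** The inner integrals are [fine] values. They agree with those of the extended-real Fubini theorem
    wherever the slice is integrable, hence almost everywhere. *)
Lemma Rfubini (f : T1 * T2 -> R) :
  (m1 \x m2)%E.-integrable setT (EFin \o f) ->
  \int[m1]_x \int[m2]_y f (x, y) = \int[(m1 \x m2)%E]_z f z /\
  \int[m2]_y \int[m1]_x f (x, y) = \int[(m1 \x m2)%E]_z f z.
Proof.
move=> fi; split.
- rewrite /Rintegral -(integral12_prod_meas1 fi); congr fine.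
  apply: ae_eq_integral => //.
  + apply/measurable_EFinP; apply: measurableT_comp => //.
    exact: (measurable_fubini_F fi).
  + exact: (measurable_fubini_F fi).
  + apply: filterS (ae_integrable1 fi) => x xi _.
    by rewrite fineK//; exact: integrable_fin_num xi.
- rewrite /Rintegral -(integral21_prod_meas1 fi); congr fine.
  apply: ae_eq_integral => //.
  + apply/measurable_EFinP; apply: measurableT_comp => //.
    exact: (measurable_fubini_G fi).
  + exact: (measurable_fubini_G fi).
  + apply: filterS (ae_integrable2 fi) => x xi _.
    by rewrite fineK//; exact: integrable_fin_num xi.
Qed.

Lemma cfubini1 f : cintegrable (m1 \x m2)%E f ->
  cintegral m1 (fun x => cintegral m2 (fun y => f (x, y))) =
  cintegral (m1 \x m2)%E f.
Proof.
by move=> [f1 f2]; apply: complex_ext; rewrite !ReImE;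
  [exact: (Rfubini f1).1|exact: (Rfubini f2).1].
Qed.

Lemma cfubini2 f : cintegrable (m1 \x m2)%E f ->
  cintegral m2 (fun y => cintegral m1 (fun x => f (x, y))) =
  cintegral (m1 \x m2)%E f.
Proof.
by move=> [f1 f2]; apply: complex_ext; rewrite !ReImE;
  [exact: (Rfubini f1).2|exact: (Rfubini f2).2].
Qed.

Lemma cfubini f : cintegrable (m1 \x m2)%E f ->
  cintegral m1 (fun x => cintegral m2 (fun y => f (x, y))) =
  cintegral m2 (fun y => cintegral m1 (fun x => f (x, y))).
Proof. by move=> fi; rewrite cfubini1// cfubini2. Qed.

(* Where a slice is not integrable, [Rintegral] takes the value of [fine] at an
   infinite or undefined integral; measurability holds regardless. *)
Lemma cmeasurable_cintegral2 f : cmeasurable f ->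
  cmeasurable (fun x => cintegral m2 (fun y => f (x, y))).
Proof.
suff H (g : T1 * T2 -> R) : measurable_fun setT g ->
    measurable_fun setT (fun x => \int[m2]_y g (x, y)).
  by move=> [mf1 mf2]; split => /=; [exact: (H _ mf1)|exact: (H _ mf2)].
move=> mg; apply: measurableT_comp => //=.
under eq_fun do rewrite integralE.
have mg' : measurable_fun setT (EFin \o g) by exact/measurable_EFinP.
apply: emeasurable_funB.
- apply: eq_measurable_fun (measurable_fun_fubini_tonelli_F (m2 := m2)
    (EFin \o g)^\+%E _ _) => //; last exact: measurable_funepos.
  by move=> x _; rewrite /fubini_F funepos.unlock.
- apply: eq_measurable_fun (measurable_fun_fubini_tonelli_F (m2 := m2)
    (EFin \o g)^\-%E _ _) => //; last exact: measurable_funeneg.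
  by move=> x _; rewrite /fubini_F funeneg.unlock.
Qed.

Lemma cintegrable_prod f : cmeasurable f ->
  (\int[m1]_x \int[m2]_y (normc (f (x, y)))%:E < +oo)%E ->
  cintegrable (m1 \x m2)%E f.
Proof.
move=> mf fi; apply/cintegrableP; split => //.
rewrite fubini_tonelli1//.
- by apply/measurable_EFinP; exact: measurable_normc.
- by move=> z; rewrite lee_fin normc_ge0.
Qed.

End cfubini.

(** * Affine changes of variables in R^n *)

Section scaled_transport.
Context d1 d2 d3 (T1 : measurableType d1) (T2 : measurableType d2)
  (T3 : measurableType d3) (R : realType).
Variables (mu1 : {measure set T1 -> \bar R}) (mu2 : {measure set T2 -> \bar R})
  (mu3 : {measure set T3 -> \bar R}).

(** Change of variables with a constant Jacobian: the image of [mu1] under [h] is [k] times [mu2].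
    Testing nonnegative functions keeps integrability out of the definition. *)
Definition transports (k : R) (h : T1 -> T2) :=
  measurable_fun setT h /\
  forall f : T2 -> \bar R, measurable_fun setT f -> (forall x, 0 <= f x)%E ->
    (\int[mu1]_x f (h x) = k%:E * \int[mu2]_x f x)%E.

Variables (k : R) (h : T1 -> T2).
Hypothesis th : transports k h.

Lemma transports_cintegrable f : cintegrable mu2 f -> cintegrable mu1 (f \o h).
Proof.
case: th => mh ih /cintegrableP[mf fi]; apply/cintegrableP; split.
  exact: cmeasurable_comp.
have fi0 : (0 <= \int[mu2]_x (normc (f x))%:E)%E.
  by apply: integral_ge0 => x _; rewrite lee_fin normc_ge0.
rewrite (ih (fun x => (normc (f x))%:E)).
- have /fineK <- : (\int[mu2]_x (normc (f x))%:E)%E \is a fin_num.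
    by rewrite ge0_fin_numE.
  by rewrite -EFinM ltey.
- by apply/measurable_EFinP; exact: measurable_normc.
- by move=> x; rewrite lee_fin normc_ge0.
Qed.

Lemma transports_Rintegral (g : T2 -> R) : mu2.-integrable setT (EFin \o g) ->
  \int[mu1]_x g (h x) = k * \int[mu2]_x g x.
Proof.
case: th => mh ih gi; have mg := measurable_int _ gi.
rewrite /Rintegral integralE [in RHS]integralE.
have -> : (\int[mu1]_x ((fun x => (g (h x))%:E)^\+ x) =
    k%:E * \int[mu2]_x ((EFin \o g)^\+ x))%E.
  rewrite -(ih (EFin \o g)^\+)%E//; last exact: measurable_funepos.
  by rewrite funepos.unlock.
have -> : (\int[mu1]_x ((fun x => (g (h x))%:E)^\- x) =
    k%:E * \int[mu2]_x ((EFin \o g)^\- x))%E.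
  rewrite -(ih (EFin \o g)^\-)%E//; last exact: measurable_funeneg.
  by rewrite funeneg.unlock.
rewrite -(fineK (integrable_pos_fin_num measurableT gi)).
rewrite -(fineK (integrable_neg_fin_num measurableT gi)).
by rewrite -!EFinM -!EFinB/= mulrBr.
Qed.

Lemma transports_cintegral f : cintegrable mu2 f ->
  cintegral mu1 (f \o h) = k%:C * cintegral mu2 f.
Proof.
move=> [f1 f2]; apply: complex_ext; rewrite !ReImE /= ?mul0r ?subr0 ?addr0.
- exact: (transports_Rintegral f1).
- exact: (transports_Rintegral f2).
Qed.

End scaled_transport.

Lemma transports_comp d1 d2 d3 (T1 : measurableType d1) (T2 : measurableType d2)
    (T3 : measurableType d3) (R : realType) (mu1 : {measure set T1 -> \bar R})
    (mu2 : {measure set T2 -> \bar R}) (mu3 : {measure set T3 -> \bar R})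
    (k l : R) (g : T1 -> T2) (h : T2 -> T3) :
  transports mu1 mu2 k g -> transports mu2 mu3 l h ->
  transports mu1 mu3 (k * l) (h \o g).
Proof.
move=> [mg ig] [mh ih]; split; first exact: measurableT_comp.
move=> f mf f0; rewrite EFinM -muleA -ih// -(ig (f \o h))//.
  exact: measurableT_comp.
by move=> x; exact: f0.
Qed.

Lemma transports_id d (T : measurableType d) (R : realType)
    (mu : {measure set T -> \bar R}) : transports mu mu 1 id.
Proof. by split => // f _ _; rewrite mul1e. Qed.

Section transports_product.
Context d1 d2 d3 d4 (T1 : measurableType d1) (T2 : measurableType d2)
  (T3 : measurableType d3) (T4 : measurableType d4) (R : realType).
Variables (mu1 : {sigma_finite_measure set T1 -> \bar R})
  (mu2 : {sigma_finite_measure set T2 -> \bar R})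
  (nu1 : {sigma_finite_measure set T3 -> \bar R})
  (nu2 : {sigma_finite_measure set T4 -> \bar R}).

Lemma transports_prod (k l : R) (g : T1 -> T3) (h : T2 -> T4) : 0 <= k -> 0 <= l ->
  transports mu1 nu1 k g -> transports mu2 nu2 l h ->
  transports (mu1 \x mu2)%E (nu1 \x nu2)%E (k * l) (fun p => (g p.1, h p.2)).
Proof.
move=> k0 l0 [mg ig] [mh ih].
have mgh : measurable_fun setT (fun p : T1 * T2 => (g p.1, h p.2)).
  by apply: measurable_fun_pair; exact: measurableT_comp.
split => // f mf f0.
rewrite fubini_tonelli1//=; last exact: (measurableT_comp mf mgh).
rewrite fubini_tonelli1//= /fubini_F/=.
have mfs x : measurable_fun setT (fun y => f (x, y)).
  by apply: (measurableT_comp mf); exact: measurable_pair1.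
under eq_integral do rewrite (ih (fun y => f (g _, y)))//.
have mF := measurable_fun_fubini_tonelli_F (m2 := nu2) f mf f0.
rewrite (ig (fun x => l%:E * \int[nu2]_y f (x, y))%E).
- rewrite ge0_integralZl//=; last by move=> x _; exact: integral_ge0.
  by rewrite muleA EFinM.
- exact: measurable_funeM.
- by move=> x; rewrite mule_ge0// integral_ge0.
Qed.

(** Tonelli with the second variable outside: every slice is rescaled by the same [k], whichever map
    [g y] acts on it. This is what makes shears measure preserving. *)
Lemma transports_fiber (k : R) (g : T2 -> T1 -> T3) : 0 <= k ->
  measurable_fun setT (fun p : T1 * T2 => g p.2 p.1) ->
  (forall y, transports mu1 nu1 k (g y)) ->
  transports (mu1 \x mu2)%E (nu1 \x mu2)%E k (fun p => (g p.2 p.1, p.2)).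
Proof.
move=> k0 mg tg.
have mgh : measurable_fun setT (fun p : T1 * T2 => (g p.2 p.1, p.2)).
  exact: measurable_fun_pair.
split => // f mf f0.
rewrite fubini_tonelli2//=; last exact: (measurableT_comp mf mgh).
rewrite fubini_tonelli2//= /fubini_G/=.
have mfs y : measurable_fun setT (fun x => f (x, y)).
  by apply: (measurableT_comp mf); exact: measurable_pair2.
have mG := measurable_fun_fubini_tonelli_G (m1 := nu1) f mf f0.
rewrite -ge0_integralZl//=; last by move=> x _; exact: integral_ge0.
by apply: eq_integral => y _; have [_ /(_ (fun x => f (x, y))) ->] := tg y.
Qed.

Lemma transports_swap :
  transports (mu1 \x mu2)%E (mu2 \x mu1)%E 1 (fun p => (p.2, p.1)).
Proof.
have ms : measurable_fun setT (fun p : T1 * T2 => (p.2, p.1)).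
  exact: measurable_fun_pair.
split => // f mf f0; rewrite mul1e fubini_tonelli2//=.
  by rewrite fubini_tonelli1.
exact: (measurableT_comp mf ms).
Qed.

End transports_product.

Section lebesgue_affine.
Variable R : realType.
Notation leb := (@lebesgue_measure R).

(** By uniqueness of Lebesgue measure: [s] times the image of [leb] under the affine map agrees with
    [leb] on every []p, q]]. *)
Lemma transports_affine (a s : R) : 0 < s ->
  transports leb leb s^-1 (fun x : measurableTypeR R => (a + s * x : R)).
Proof.
move=> s0; set h := (fun x => _).
have mh : measurable_fun setT h.
  by apply: measurable_funD => //; apply: measurable_funM.
have mh' : measurable_fun setT (h : measurableTypeR R -> measurableTypeR R) by [].
split => // f mf f0.
pose P : {measure set (measurableTypeR R) -> \bar R} :=
  measure_function_pushforward__canonical__measure_function_Measure leb mh'.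
pose nu : {measure set (measurableTypeR R) -> \bar R} := mscale (NngNum (ltW s0)) P.
have nuE A : measurable A -> leb A = nu A.
  apply: lebesgue_measure_unique => _ [[p q] /= _ <-].
  rewrite /nu/= /mscale/= /pushforward.
  have -> : h @^-1` `]p, q] = `](p - a) / s, (q - a) / s]%classic.
    apply/seteqP; split => x /=; rewrite !in_itv/= /h ltr_pdivrMr// ler_pdivlMr//.
      by rewrite ltrBlDl lerBrDl (mulrC x).
    by rewrite ltrBlDl lerBrDl (mulrC x).
  rewrite !lebesgue_measure_itv/= !lte_fin ltr_pM2r ?invr_gt0// ltrD2r.
  case: ifPn => pq; last by rewrite mule0.
  rewrite -!EFinB -EFinM -mulrBl mulrCA divff ?gt_eqF// mulr1.
  by congr EFin; ring.
rewrite [in RHS](eq_measure_integral nu)//; last by move=> A mA _; exact: nuE.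
rewrite ge0_integral_mscale//= muleA -EFinM mulVf ?gt_eqF// mul1e.
by rewrite ge0_integral_pushforward.
Qed.

Lemma measurable_mktuple d (T : measurableType d) n
    (f : 'I_n -> T -> measurableTypeR R) :
  (forall i, measurable_fun setT (f i)) ->
  measurable_fun setT (fun x => [tuple f i x | i < n]).
Proof.
move=> mf; apply/measurable_fun_tnthP => i.
by rewrite (_ : _ \o _ = f i)//; apply/funext => x /=; rewrite tnth_mktuple.
Qed.

Definition taff n (s : R) (h x : n.-tuple (measurableTypeR R)) :
  n.-tuple (measurableTypeR R) := [tuple (tnth h i + s * tnth x i : R) | i < n].

Lemma measurable_taff n s : measurable_fun setT
  (fun p : n.-tuple (measurableTypeR R) * n.-tuple (measurableTypeR R) =>
    taff s p.1 p.2).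
Proof.
apply: measurable_mktuple => i; apply: measurable_funD.
  by apply: (measurableT_comp (measurable_tnth i)).
apply: measurable_funM => //.
by apply: (measurableT_comp (measurable_tnth i)).
Qed.

Lemma transports_tcons n :
  transports (leb \x lebesgue_n R n)%E (lebesgue_n R n.+1) 1 (@tcons _ _ n).
Proof.
split; first exact: measurable_tcons.
by move=> f mf f0; rewrite mul1e /= ge0_integral_pushforward//; exact: measurable_tcons.
Qed.

Lemma tnth_tcons0 n (p : R * n.-tuple R) : tnth (tcons p) ord0 = p.1.
Proof. by []. Qed.

Lemma tnth_tconsS n (p : R * n.-tuple R) (j : 'I_n) :
  tnth (tcons p) (lift ord0 j) = tnth p.2 j.
Proof. by rewrite !(tnth_nth 0). Qed.

Lemma taff_tcons n s (h0 : R) (h : n.-tuple (measurableTypeR R)) (x0 : R) x :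
  taff s (tcons (h0 : measurableTypeR R, h)) (tcons (x0 : measurableTypeR R, x)) =
  tcons ((h0 + s * x0 : R) : measurableTypeR R, taff s h x).
Proof.
apply: eq_from_tnth => i; rewrite tnth_mktuple.
case: (unliftP ord0 i) => [j ->|->//].
by rewrite !tnth_tconsS tnth_mktuple.
Qed.

Lemma tcons_surj n (t : n.+1.-tuple R) :
  t = tcons (thead t, [tuple of behead t]).
Proof. by case/tupleP: t => x t; apply: val_inj. Qed.

Lemma ge0_integral_lebesgue_nS n (f : n.+1.-tuple (measurableTypeR R) -> \bar R) :
  measurable_fun setT f -> (forall x, 0 <= f x)%E ->
  (\int[lebesgue_n R n.+1]_x f x =
   \int[leb]_x0 \int[lebesgue_n R n]_x f (tcons (x0, x)))%E.
Proof.
move=> mf f0; have [mt /(_ f mf f0)] := transports_tcons n.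
rewrite mul1e => <-; rewrite fubini_tonelli1//; exact: measurableT_comp.
Qed.

Lemma transports_taff n (s : R) h : 0 < s ->
  transports (lebesgue_n R n) (lebesgue_n R n) (s^-1 ^+ n) (taff s h).
Proof.
move=> s0; elim: n h => [|n IH] h.
  rewrite expr0 (_ : taff s h = id); first exact: transports_id.
  by apply/funext => x; apply: eq_from_tnth => -[].
have mt : measurable_fun setT (taff s h).
  apply: measurable_mktuple => i; apply: measurable_funD => //.
  by apply: measurable_funM => //; exact: measurable_tnth.
split=> // f mf f0; have [mtc itc] := transports_tcons n.
have := itc _ (measurableT_comp mf mt).
rewrite mul1e => <-//; last by move=> x; exact: f0.
have := itc f mf f0; rewrite mul1e => <-.
have s0' : 0 <= s^-1 by rewrite invr_ge0 ltW.
have [_ ] := transports_prod s0' (exprn_ge0 n s0')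
  (transports_affine (thead h) s0) (IH [tuple of behead h]).
rewrite exprS => /(_ _ (measurableT_comp mf mtc)) <-; last by move=> x; exact: f0.
by apply: eq_integral => -[x0 x] _ /=; rewrite [in LHS](tcons_surj h) taff_tcons.
Qed.

Notation Rn n := (n.-tuple (measurableTypeR R)).
Notation leb2 n := (lebesgue_n R n \x lebesgue_n R n)%E.

Definition rot2 n (c s : R) (p : Rn n * Rn n) : Rn n * Rn n :=
  ([tuple (c * tnth p.1 i - s * tnth p.2 i : R) | i < n],
   [tuple (s * tnth p.1 i + c * tnth p.2 i : R) | i < n]).

Definition shear n (a : R) (p : Rn n * Rn n) : Rn n * Rn n :=
  (taff 1 [tuple (a * tnth p.2 i : R) | i < n] p.1, p.2).

Lemma transports_shear n a : transports (leb2 n) (leb2 n) 1 (shear a).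
Proof.
have mg : measurable_fun setT (fun p : Rn n * Rn n =>
    taff 1 [tuple (a * tnth p.2 i : R) | i < n] p.1).
  apply: measurable_mktuple => i; apply: measurable_funD.
    under eq_fun do rewrite tnth_mktuple.
    apply: measurable_funM => //.
    exact: (measurableT_comp (measurable_tnth i)).
  apply: measurable_funM => //.
  exact: (measurableT_comp (measurable_tnth i)).
have tg (y : Rn n) : transports (lebesgue_n R n) (lebesgue_n R n) 1
    (taff 1 [tuple (a * tnth y i : R) | i < n]).
  have := transports_taff [tuple (a * tnth y i : R) | i < n] (@ltr01 R).
  by rewrite invr1 expr1n.
exact: (transports_fiber (lebesgue_n R n) ler01 mg tg).
Qed.

Definition pswap n (p : Rn n * Rn n) := (p.2, p.1).

(** A rotation with nonzero sine is a product of three shears, the middle one conjugated by the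
    swap. If the sine is 0, the rotation is the identity or the square of a quarter turn. *)
Lemma transports_rot2 n (c s : R) : c ^+ 2 + s ^+ 2 = 1 ->
  transports (leb2 n) (leb2 n) 1 (@rot2 n c s).
Proof.
have H (a b : R) : b != 0 -> a ^+ 2 + b ^+ 2 = 1 ->
    transports (leb2 n) (leb2 n) 1 (@rot2 n a b).
  move=> b0 ab.
  have -> : @rot2 n a b = shear ((a - 1) / b) \o
      (@pswap n \o (shear b \o (@pswap n \o shear ((a - 1) / b)))).
    apply/funext => -[x y]; rewrite /shear/= /rot2/= /pswap/=.
    congr pair; apply: eq_from_tnth => i; rewrite !tnth_mktuple; last by field.
    have -> : b * tnth y i = (1 - a ^+ 2) / b * tnth y i.
      by rewrite -ab addrAC subrr add0r expr2 mulfK.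
    by field.
  rewrite -(mulr1 1); apply: transports_comp; last exact: transports_shear.
  rewrite -(mulr1 1); apply: transports_comp; last exact: transports_swap.
  rewrite -(mulr1 1); apply: transports_comp; last exact: transports_shear.
  rewrite -(mulr1 1); apply: transports_comp; last exact: transports_swap.
  exact: transports_shear.
move=> cs; have [s0|s0] := eqVneq s 0; last exact: H.
have /eqP := cs; rewrite s0 expr0n addr0 sqrf_eq1 => /orP[]/eqP->.
  rewrite (_ : rot2 _ _ = id); first exact: transports_id.
  apply/funext => -[x y]; rewrite /rot2/=.
  by congr pair; apply: eq_from_tnth => i; rewrite !tnth_mktuple; ring.
rewrite (_ : rot2 _ _ = @rot2 n 0 1 \o @rot2 n 0 1).
  have e01 : (0 : R) ^+ 2 + 1 ^+ 2 = 1 by ring.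
  have H01 := H 0 1 (oner_neq0 R) e01.
  by have := transports_comp H01 H01; rewrite mulr1.
apply/funext => -[x y]; rewrite /rot2/=.
by congr pair; apply: eq_from_tnth => i; rewrite !tnth_mktuple/= ?tnth_mktuple; ring.
Qed.

(** Measurability is joint in the angle and the point, so that Fubini can average over all
    rotations. *)
Lemma measurable_rot2 n : measurable_fun setT
  (fun q : (R * R) * (Rn n * Rn n) => rot2 q.1.1 q.1.2 q.2).
Proof.
have mt i : measurable_fun setT (fun q : (R * R) * (Rn n * Rn n) => tnth q.2.1 i).
  apply: (measurableT_comp (measurable_tnth i)).
  exact: (measurableT_comp measurable_fst).
have mt' i : measurable_fun setT (fun q : (R * R) * (Rn n * Rn n) => tnth q.2.2 i).
  apply: (measurableT_comp (measurable_tnth i)).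
  exact: (measurableT_comp measurable_snd).
have m1 : measurable_fun setT (fun q : (R * R) * (Rn n * Rn n) => q.1.1).
  exact: (measurableT_comp measurable_fst).
have m2 : measurable_fun setT (fun q : (R * R) * (Rn n * Rn n) => q.1.2).
  exact: (measurableT_comp measurable_snd).
apply: measurable_fun_pair; apply: measurable_mktuple => i.
- by apply: measurable_funB; apply: measurable_funM; [exact: m1|exact: mt|exact: m2|exact: mt'].
- by apply: measurable_funD; apply: measurable_funM; [exact: m2|exact: mt|exact: m1|exact: mt'].
Qed.

End lebesgue_affine.

(** * Holomorphic functions of one variable *)

Section exponential_bounds.
Variable R : realType.
Implicit Types (a b x : R) (u z w : R[i]).

Lemma expRB1_le a : `|expR a - 1| <= `|a| * expR `|a|.
Proof.
have e0 : 0 <= expR `|a| by exact: expR_ge0.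
have e1 : 1 <= expR `|a|.
  by rewrite (le_trans _ (expR_ge1Dx _))// lerDl.
have H b : 0 <= b -> expR b - 1 <= b * expR b.
  move=> b0; have := expR_ge1Dx (- b); rewrite expRN => h.
  have eb := expR_gt0 b; have : (1 - b) * expR b <= 1.
    by rewrite -ler_pdivlMr// div1r.
  nra.
have [a0|a0] := leP 0 a.
  rewrite ger0_norm ?subr_ge0; last by rewrite (le_trans _ (expR_ge1Dx _))// lerDl.
  by rewrite ger0_norm//; exact: H.
rewrite ltr0_norm ?subr_lt0; last by rewrite -expR0 ltr_expR.
rewrite ltr0_norm//; have := expR_ge1Dx a.
rewrite ltr0_norm// in e1.
nra.
Qed.

Lemma expRB1B_le a : `|expR a - 1 - a| <= a ^+ 2 * expR `|a|.
Proof.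
rewrite ger0_norm; last by rewrite -addrA -opprD subr_ge0 expR_ge1Dx.
have h : expR a - 1 - a <= a * (expR a - 1).
  have := expR_ge1Dx (- a); rewrite expRN => h.
  have eb := expR_gt0 a; have : (1 - a) * expR a <= 1.
    by rewrite -ler_pdivlMr// div1r.
  nra.
apply: (le_trans h); apply: (le_trans (ler_norm _)).
rewrite normrM -(real_normK (num_real a)) expr2 -mulrA.
by rewrite ler_wpM2l// expRB1_le.
Qed.

Lemma normr_sin_le b : `|sin b| <= `|b|.
Proof.
have H x : 0 <= x -> `|sin x| <= x.
  move=> x0; have [] := @MVT_segment R (@sin R) (@cos R) 0 x x0.
  - by apply: continuous_subspaceT => y; exact: continuous_sin.
  - move=> c _; rewrite sin0 !subr0 => ->; rewrite normrM (ger0_norm x0).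
    by rewrite ler_piMl// cos_max.
have [b0|b0] := leP 0 b; first by rewrite (ger0_norm b0) H.
have -> : sin b = - sin (- b) by rewrite sinN opprK.
by rewrite normrN (ltr0_norm b0) H// oppr_ge0 ltW.
Qed.

Lemma normr_cosB1_le b : `|cos b - 1| <= b ^+ 2.
Proof.
have -> : cos b - 1 = - (sin (b / 2) ^+ 2 *+ 2).
  rewrite {1}(_ : b = (b / 2) *+ 2); last by rewrite -mulr_natr divfK.
  rewrite cos_mulr2n cos2sin2; ring.
rewrite normrN -mulr_natr normrM normrX (ger0_norm (ler0n _ 2)).
have h := normr_sin_le (b / 2).
have -> : b ^+ 2 = `|b / 2| ^+ 2 * 4 by rewrite real_normK ?num_real//; field.
have := normr_ge0 (sin (b / 2)).
have -> : (4 : R) = 2 * 2 by ring.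
move: (`|sin _|) (`|b / 2|) h => s t st s0.
have : s ^+ 2 <= t ^+ 2 by rewrite ler_pXn2r// nnegrE (le_trans s0).
nra.
Qed.

Lemma normr_sinB_le b : `|sin b - b| <= `|b| ^+ 3.
Proof.
have H x : 0 <= x -> `|sin x - x| <= x ^+ 3.
  move=> x0; have [] := @MVT_segment R (fun y => sin y - y) (fun y => cos y - 1) 0 x x0.
  - by apply: continuous_subspaceT => y; apply: continuousB => //; exact: continuous_sin.
  - move=> c; rewrite in_itv/= => /andP[c0 cx]; rewrite sin0 !subr0 => ->.
    rewrite normrM (ger0_norm x0) exprSr ler_wpM2r//.
    by rewrite (le_trans (normr_cosB1_le _))// ler_pXn2r// nnegrE.
have [b0|b0] := leP 0 b; first by rewrite (ger0_norm b0) H.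
have -> : sin b - b = - (sin (- b) - (- b)) by rewrite sinN opprB opprK addrC.
by rewrite normrN (ltr0_norm b0) H// oppr_ge0 ltW.
Qed.

(** For [|u| < 1] the real and the imaginary part each contribute a constant 2. For [1 <= |u|] the
    triangle inequality already gives [2 e^|u|]. *)
Lemma normc_cexpB1B u :
  normc (cexp u - 1 - u) <= 4 * normc u ^+ 2 * expR (normc u).
Proof.
have [u1|u1] := leP 1 (normc u).
  have e1 : 1 + normc u <= expR (normc u) by exact: expR_ge1Dx.
  apply: (@le_trans _ _ (2 * expR (normc u))).
    rewrite (le_trans (le_normcB _ _))//.
    have := le_normcB (cexp u) 1; rewrite normc1 normc_cexp => h.
    have : expR (complex.Re u) <= expR (normc u).
      by rewrite ler_expR (le_trans (ler_norm _))// le_Re_normc.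
    lra.
  rewrite ler_wpM2r ?expR_ge0//.
  have : 1 <= normc u ^+ 2 by rewrite exprn_ege1.
  lra.
case: u u1 => a b; set n := normc _ => n1.
have n0 : 0 <= n by exact: normc_ge0.
have an : `|a| <= n by exact: (le_Re_normc (a +i* b)).
have bn : `|b| <= n by exact: (le_Im_normc (a +i* b)).
rewrite (le_trans (normc_le_ReIm _))// /cexp !ReImE/= !mul0r subr0 addr0 subr0.
have ean : expR `|a| <= expR n by rewrite ler_expR.
have ea : expR a <= expR n by rewrite ler_expR (le_trans (ler_norm _)).
have en : 1 <= expR n by rewrite (le_trans _ (expR_ge1Dx _))// lerDl.
have a2 : a ^+ 2 <= n ^+ 2.
  by rewrite -real_normK ?num_real// ler_pXn2r// nnegrE.
have b2 : b ^+ 2 <= n ^+ 2.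
  by rewrite -real_normK ?num_real// ler_pXn2r// nnegrE.
have n2 : 0 <= n ^+ 2 by exact: sqr_ge0.
have h1 : `|expR a * cos b - 1 - a| <= 2 * n ^+ 2 * expR n.
  have -> : expR a * cos b - 1 - a = expR a * (cos b - 1) + (expR a - 1 - a) by ring.
  rewrite (le_trans (ler_normD _ _))// normrM (ger0_norm (expR_ge0 _)).
  have -> : 2 * n ^+ 2 * expR n = expR n * n ^+ 2 + n ^+ 2 * expR n by ring.
  apply: lerD.
    by apply: ler_pM => //; rewrite ?expR_ge0// (le_trans (normr_cosB1_le _)).
  rewrite (le_trans (expRB1B_le _))//.
  by apply: ler_pM => //; rewrite ?expR_ge0// sqr_ge0.
have h2 : `|expR a * sin b - b| <= 2 * n ^+ 2 * expR n.
  have -> : expR a * sin b - b = expR a * (sin b - b) + (expR a - 1) * b by ring.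
  rewrite (le_trans (ler_normD _ _))// !normrM (ger0_norm (expR_ge0 _)).
  have -> : 2 * n ^+ 2 * expR n = expR n * n ^+ 2 + n * expR n * n by ring.
  apply: lerD; apply: ler_pM => //; rewrite ?expR_ge0//.
  - rewrite (le_trans (normr_sinB_le _))// exprS.
    rewrite -[leRHS]mul1r ler_pM ?exprn_ge0//; first by rewrite (le_trans bn) ?ltW.
    by rewrite real_normK ?num_real.
  - by rewrite (le_trans (expRB1_le _))// ler_pM// expR_ge0.
lra.
Qed.

End exponential_bounds.

(** * Complex differentiability in one variable *)

Section complex_derivative.
Variable R : realType.
Implicit Types (g h : R[i] -> R[i]) (z w : R[i]).

Definition ccontinuous_at z g := forall e : R, 0 < e ->
  exists2 d : R, 0 < d & forall w, normc (w - z) < d -> normc (g w - g z) < e.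

(* Caratheodory's form of complex differentiability. *)
Definition cdiff g := forall z, exists2 phi : R[i] -> R[i],
  ccontinuous_at z phi & forall w, g w = g z + phi w * (w - z).

Lemma ccontinuous_atD z g h : ccontinuous_at z g -> ccontinuous_at z h ->
  ccontinuous_at z (fun w => g w + h w).
Proof.
move=> cg ch e e0; have e20 : 0 < e / 2 by rewrite divr_gt0.
have [d d0 gd] := cg _ e20; have [d' d'0 hd] := ch _ e20.
exists (Num.min d d'); first by rewrite lt_min d0.
move=> w; rewrite lt_min => /andP[/gd {}gd /hd {}hd].
rewrite opprD addrACA (le_lt_trans (le_normcD _ _))//; lra.
Qed.

Lemma ccontinuous_atM z g h : ccontinuous_at z g -> ccontinuous_at z h ->
  ccontinuous_at z (fun w => g w * h w).
Proof.
move=> cg ch e e0.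
have c0 : 0 < normc (g z) + normc (h z) + 1.
  by rewrite ltr_wpDl// addr_ge0 ?normc_ge0.
pose e1 := Num.min 1 (e / (normc (g z) + normc (h z) + 1)).
have e10 : 0 < e1 by rewrite lt_min ltr01/= divr_gt0.
have [d d0 gd] := cg _ e10; have [d' d'0 hd] := ch _ e10.
exists (Num.min d d'); first by rewrite lt_min d0.
move=> w; rewrite lt_min => /andP[/gd {}gd /hd {}hd].
have -> : g w * h w - g z * h z =
  (g w - g z) * (h w - h z) + (g z * (h w - h z) + (g w - g z) * h z) by ring.
have e1e : e1 * (normc (g z) + normc (h z) + 1) <= e.
  by rewrite -ler_pdivlMr// ge_min lexx orbT.
apply: lt_le_trans e1e; rewrite (le_lt_trans (le_normcD _ _))// normcM.
have := le_normcD (g z * (h w - h z)) ((g w - g z) * h z); rewrite !normcM.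
have e11 : e1 <= 1 by rewrite ge_min lexx.
move: gd hd (normc_ge0 (g w - g z)) (normc_ge0 (h w - h z)) (normc_ge0 (g z))
  (normc_ge0 (h z)).
move: (normc (g w - g z)) (normc (h w - h z)) (normc (g z)) (normc (h z)).
move=> p q r s pe qe p0 q0 r0 s0 hn.
have : p * q < e1.
  have [->|pn] := eqVneq p 0; first by rewrite mul0r.
  rewrite (@le_lt_trans _ _ p)// ler_piMr//; lra.
nra.
Qed.

Lemma ccontinuous_at_cst z (c : R[i]) : ccontinuous_at z (fun=> c).
Proof. by move=> e e0; exists 1 => // w _; rewrite subrr normc0. Qed.

Lemma ccontinuous_at_comp z g h : ccontinuous_at z g -> ccontinuous_at (g z) h ->
  ccontinuous_at z (h \o g).
Proof.
move=> cg ch e e0; have [d d0 hd] := ch _ e0; have [d' d'0 gd] := cg _ d0.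
by exists d' => // w /gd/hd.
Qed.

Lemma ccontinuous_at_id z : ccontinuous_at z id.
Proof. by move=> e e0; exists e. Qed.

Lemma cdiff_continuous g z : cdiff g -> ccontinuous_at z g.
Proof.
move=> /(_ z)[phi cphi gE].
rewrite (_ : g = fun w => g z + phi w * (w - z)); last exact/funext.
apply: ccontinuous_atD; first exact: ccontinuous_at_cst.
apply: ccontinuous_atM => //; apply: ccontinuous_atD; first exact: ccontinuous_at_id.
exact: ccontinuous_at_cst.
Qed.

Lemma cdiffM g h : cdiff g -> cdiff h -> cdiff (fun w => g w * h w).
Proof.
move=> dg dh z; have [phi cphi gE] := dg z; have [psi cpsi hE] := dh z.
exists (fun w => phi w * h w + g z * psi w).
  apply: ccontinuous_atD; apply: ccontinuous_atM => //.
  - exact: cdiff_continuous.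
  - exact: ccontinuous_at_cst.
by move=> w; rewrite (gE w) {1}(hE w); rewrite (hE w); ring.
Qed.

Lemma cdiff_comp g h : cdiff g -> cdiff h -> cdiff (h \o g).
Proof.
move=> dg dh z; have [phi cphi gE] := dg z; have [psi cpsi hE] := dh (g z).
exists (fun w => psi (g w) * phi w).
  apply: ccontinuous_atM => //.
  by apply: (@ccontinuous_at_comp _ g psi) => //; exact: cdiff_continuous.
move=> w /=; rewrite (hE (g w)) {2}(gE w); ring.
Qed.

Lemma cdiff_affine (a b : R[i]) : cdiff (fun w => a + b * w).
Proof. by move=> z; exists (fun=> b); [exact: ccontinuous_at_cst|move=> w; ring]. Qed.

Lemma cdiff_cexp : cdiff (@cexp R).
Proof.
move=> z; exists (fun w => if w == z then cexp z else (cexp w - cexp z) / (w - z)).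
  move=> e e0; rewrite eqxx.
  (* For [|w - z| < 1] the quadratic remainder bound makes the error of the slope at most
     [C |w - z|]. *)
  pose C := 4 * normc (cexp z) * expR 1.
  have C0 : 0 < C by rewrite !mulr_gt0 ?expR_gt0// normc_cexp expR_gt0.
  exists (Num.min 1 (e / C)); first by rewrite lt_min ltr01 divr_gt0.
  move=> w; rewrite lt_min => /andP[w1 wC].
  case: eqVneq => [_|wz]; first by rewrite subrr normc0.
  have wz0 : w - z != 0 by rewrite subr_eq0.
  have -> : (cexp w - cexp z) / (w - z) - cexp z =
     cexp z * (cexp (w - z) - 1 - (w - z)) / (w - z).
    have -> : cexp w = cexp z * cexp (w - z) by rewrite -cexpD addrC subrK.
    by field.
  have n0 : 0 < normc (w - z) by rewrite normc_gt0.
  rewrite (normcM _ (w - z)^-1) (normcM (cexp z)) normcV ltr_pdivrMr//.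
  apply: le_lt_trans (_ : C * normc (w - z) * normc (w - z) < _); last first.
    by rewrite ltr_pM2r// mulrC -ltr_pdivlMr.
  have := normc_cexpB1B (w - z).
  have : expR (normc (w - z)) <= expR 1 by rewrite ler_expR ltW.
  rewrite /C; move: (normc (cexp z)) (normc_ge0 (cexp z)) => k k0 le1 le2.
  have -> : 4 * k * expR 1 * normc (w - z) * normc (w - z) =
    k * (4 * normc (w - z) ^+ 2 * expR 1) by ring.
  rewrite ler_wpM2l// (le_trans le2)// ler_wpM2l//.
  by rewrite mulr_ge0// sqr_ge0.
move=> w; case: eqVneq => [->|wz]; first by rewrite subrr mulr0 addr0.
by rewrite divfK ?subr_eq0// addrC subrK.
Qed.

End complex_derivative.

(** * Goursat's theorem for closed forms on rectangles *)

Section bisection.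
Variable R : realType.
Variable Phi : R -> R -> R -> R -> R.
Hypothesis Phi_splitl : forall a m b c d, a <= m -> m <= b -> c <= d ->
  Phi a b c d = Phi a m c d + Phi m b c d.
Hypothesis Phi_splitr : forall a b c m d, a <= b -> c <= m -> m <= d ->
  Phi a b c d = Phi a b c m + Phi a b m d.
Hypothesis Phi_small : forall x0 y0 e, 0 < e -> exists2 r, 0 < r &
  forall a b c d, a <= x0 -> x0 <= b -> c <= y0 -> y0 <= d ->
    b - a < r -> d - c < r -> `|Phi a b c d| <= e * ((b - a) + (d - c)) ^+ 2.

Let rect := ((R * R) * (R * R))%type.
Let val (r : rect) := `|Phi r.1.1 r.1.2 r.2.1 r.2.2|.
Let mid (p : R * R) := (p.1 + p.2) / 2.

Let halfl (r : rect) : rect :=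
  if val r / 2 <= val ((r.1.1, mid r.1), r.2) then ((r.1.1, mid r.1), r.2)
  else ((mid r.1, r.1.2), r.2).

Let halfr (r : rect) : rect :=
  if val r / 2 <= val (r.1, (r.2.1, mid r.2)) then (r.1, (r.2.1, mid r.2))
  else (r.1, (mid r.2, r.2.2)).

Let ok (r : rect) := r.1.1 <= r.1.2 /\ r.2.1 <= r.2.2.

Let mid_itv (p : R * R) : p.1 <= p.2 -> p.1 <= mid p /\ mid p <= p.2.
Proof. by rewrite /mid => h; split; lra. Qed.

Let norm_half (x y z : R) : x = y + z -> ~~ (`|x| / 2 <= `|y|) -> `|x| / 2 <= `|z|.
Proof. by rewrite -ltNge => -> h; have := ler_normD y z; lra. Qed.

Let halflP r : ok r -> [/\ ok (halfl r), val r / 2 <= val (halfl r),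
  (halfl r).1.2 - (halfl r).1.1 = (r.1.2 - r.1.1) / 2,
  r.1.1 <= (halfl r).1.1 /\ (halfl r).1.2 <= r.1.2 & (halfl r).2 = r.2].
Proof.
move=> [r1 r2]; have [m1 m2] := mid_itv r1; rewrite /halfl; case: ifPn => h.
  by split; [split|by []|rewrite /= /mid; lra|split|].
split; [by split| |by rewrite /= /mid; lra|by split|by []].
by apply: (norm_half _ h); rewrite /= (Phi_splitl m1 m2).
Qed.

Let halfrP r : ok r -> [/\ ok (halfr r), val r / 2 <= val (halfr r),
  (halfr r).2.2 - (halfr r).2.1 = (r.2.2 - r.2.1) / 2,
  r.2.1 <= (halfr r).2.1 /\ (halfr r).2.2 <= r.2.2 & (halfr r).1 = r.1].
Proof.
move=> [r1 r2]; have [m1 m2] := mid_itv r2; rewrite /halfr; case: ifPn => h.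
  by split; [split|by []|rewrite /= /mid; lra|split|].
split; [by split| |by rewrite /= /mid; lra|by split|by []].
by apply: (norm_half _ h); rewrite /= (Phi_splitr _ m1 m2).
Qed.

Let sq (r : rect) n := iter n (halfr \o halfl) r.

Let sqP r n : ok r -> [/\ ok (sq r n), val r <= 4 ^+ n * val (sq r n),
  (sq r n).1.2 - (sq r n).1.1 = (r.1.2 - r.1.1) / 2 ^+ n,
  (sq r n).2.2 - (sq r n).2.1 = (r.2.2 - r.2.1) / 2 ^+ n &
  forall k, (k <= n)%N -> [/\ (sq r k).1.1 <= (sq r n).1.1,
    (sq r n).1.2 <= (sq r k).1.2, (sq r k).2.1 <= (sq r n).2.1 &
    (sq r n).2.2 <= (sq r k).2.2]].
Proof.
move=> okr; elim: n => [|n [ok1 v1 l1 l2 mon]].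
  rewrite /sq/= !expr0 mul1r !divr1; split => // k.
  by rewrite leqn0 => /eqP ->.
have [ok2 v2 w2 [i1 i2] e2] := halflP ok1.
have [ok3 v3 w3 [i3 i4] e3] := halfrP ok2.
have sqS : sq r n.+1 = halfr (halfl (sq r n)) by [].
rewrite sqS; split => //.
- rewrite exprS (le_trans v1)// -mulrA mulrCA ler_wpM2l ?exprn_ge0//.
  move: v2 v3; lra.
- by rewrite e3 w2 l1 exprS invfM; ring.
- by rewrite w3 e2 l2 exprS invfM; ring.
- move=> k; rewrite leq_eqVlt => /predU1P[->|]; first by rewrite sqS; split.
  rewrite ltnS => /mon[j1 j2 j3 j4]; rewrite !e3; rewrite e2 in i3 i4.
  split; [exact: le_trans j1 i1|exact: le_trans i2 j2|exact: le_trans j3 i3|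
    exact: le_trans i4 j4].
Qed.

Let limit_point (u v : nat -> R) : (forall n, u n <= v n) ->
  (forall k n, (k <= n)%N -> u k <= u n /\ v n <= v k) ->
  exists x, forall n, u n <= x /\ x <= v n.
Proof.
move=> uv mon; exists (sup (range u)) => n; split.
  apply: ub_le_sup; last by exists n.
  exists (v 0%N) => _ [k _ <-]; rewrite (le_trans (uv k))//.
  by have [] := mon 0%N k (leq0n _).
apply: ge_sup; first by exists (u 0%N), 0%N.
move=> _ [k _ <-]; have [uk vk] := mon _ _ (leq_maxl k n).
have [un vn] := mon _ _ (leq_maxr k n).
by rewrite (le_trans uk)// (le_trans (uv _)).
Qed.

(** Goursat's argument freed from integrals. Halving both sides and keeping the larger value retains
    at least a quarter of [|Phi|], so [|Phi|] is at most [4^n] times its value on the [n]-th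
    rectangle. Smallness at the common point of the nested rectangles bounds that value by
    [e S^2 / 4^n]. *)
Lemma bisection_eq0 a b c d : a <= b -> c <= d -> Phi a b c d = 0.
Proof.
move=> ab cd; apply/eqP/contraT; rewrite -normr_gt0 => v0.
pose r : rect := ((a, b), (c, d)).
have okr : ok r by [].
have [x0 x0P] : exists x, forall n, (sq r n).1.1 <= x /\ x <= (sq r n).1.2.
  apply: limit_point => [n|k n kn]; first by have [[]] := sqP n okr.
  by have [_ _ _ _ /(_ _ kn)[]] := sqP n okr.
have [y0 y0P] : exists x, forall n, (sq r n).2.1 <= x /\ x <= (sq r n).2.2.
  apply: limit_point => [n|k n kn]; first by have [[]] := sqP n okr.
  by have [_ _ _ _ /(_ _ kn)[]] := sqP n okr.
pose S := (b - a) + (d - c).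
have S0 : 0 <= S by rewrite addr_ge0// subr_ge0.
(* This makes [e * S ^+ 2] smaller than half of [|Phi a b c d|]; the [+ 1] covers a rectangle
   reduced to a point. *)
pose e := `|Phi a b c d| / (2 * (S ^+ 2 + 1)).
have s1 : 0 < S ^+ 2 + 1 by rewrite ltr_wpDl// sqr_ge0.
have e0 : 0 < e by rewrite divr_gt0// mulr_gt0.
have [del del0 small] := Phi_small x0 y0 e0.
have [n nS] : exists n, S / 2 ^+ n < del.
  have := near_infty_natSinv_expn_lt (PosNum (divr_gt0 del0 (ltr_wpDl S0 ltr01))).
  move=> [N _ /(_ N (leqnn N))] /= h; exists N.
  apply: le_lt_trans (_ : (S + 1) / 2 ^+ N < _).
    by rewrite ler_wpM2r// ?invr_ge0 ?exprn_ge0// lerDl.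
  have S1 : 0 < S + 1 by rewrite ltr_wpDl.
  by move: h; rewrite div1r ltr_pdivlMr// mulrC.
have [_ v l1 l2 _] := sqP n okr.
have [x1 x2] := x0P n; have [y1 y2] := y0P n.
have p2 : 0 < (2 : R) ^+ n by rewrite exprn_gt0.
have le1 : (sq r n).1.2 - (sq r n).1.1 < del.
  by rewrite l1 (le_lt_trans _ nS)//= ler_pM2r ?invr_gt0// lerDl subr_ge0.
have le2 : (sq r n).2.2 - (sq r n).2.1 < del.
  by rewrite l2 (le_lt_trans _ nS)//= ler_pM2r ?invr_gt0// lerDr subr_ge0.
have := small _ _ _ _ x1 x2 y1 y2 le1 le2.
rewrite l1 l2 /= -mulrDl -/S expr_div_n => h.
have : val r <= e * S ^+ 2.
  rewrite (le_trans v)// -ler_pdivlMl ?exprn_gt0// (le_trans h)//.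
  have -> : (2 ^+ n) ^+ 2 = 4 ^+ n :> R by rewrite exprAC; congr (_ ^+ n); ring.
  by rewrite [leRHS]mulrC mulrA.
rewrite /val/= /e leNgt; move=> /negP; case.
rewrite mulrAC ltr_pdivrMr ?mulr_gt0// ltr_pM2l//.
by have := sqr_ge0 S; lra.
Qed.

End bisection.

Section interval_integral.
Variable R : realType.
Notation leb := (@lebesgue_measure R).
Implicit Types (f g : R -> R) (a b m k M : R).

Lemma continuous_integrable_itv f a b : continuous f ->
  leb.-integrable `[a, b] (EFin \o f).
Proof.
move=> cf; apply: continuous_compact_integrable; first exact: segment_compact.
exact: continuous_subspaceT.
Qed.

Lemma Rintegral_split f a m b : continuous f -> a <= m -> m <= b ->
  \int[leb]_(x in `[a, b]) f x =
  \int[leb]_(x in `[a, m]) f x + \int[leb]_(x in `[m, b]) f x.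
Proof.
move=> cf am mb; have fi := continuous_integrable_itv a b cf.
rewrite -(Rintegral_itv_obnd_cbnd (r := m)).
  by rewrite -(@Rintegral_itvB _ f (BLeft a) (BRight b) m)// addrC subrK.
apply: integrableS fi => //; apply: subset_itvr.
by rewrite bnd_simp.
Qed.

Lemma Rintegral_itv_cst k a b : a <= b -> \int[leb]_(x in `[a, b]) k = k * (b - a).
Proof.
move=> ab; rewrite Rintegral_cst//= lebesgue_measure_itv/= lte_fin.
by move: ab; rewrite le_eqVlt => /predU1P[->|->]; rewrite ?ltxx ?subrr.
Qed.

Lemma Rintegral_itvD f g a b : continuous f -> continuous g ->
  \int[leb]_(x in `[a, b]) (f x + g x) =
  \int[leb]_(x in `[a, b]) f x + \int[leb]_(x in `[a, b]) g x.
Proof. by move=> cf cg; apply: RintegralD => //; exact: continuous_integrable_itv. Qed.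

Lemma Rintegral_dist_le f k M a b : continuous f -> a <= b ->
  (forall x, a <= x -> x <= b -> `|f x - k| <= M) ->
  `|\int[leb]_(x in `[a, b]) f x - k * (b - a)| <= M * (b - a).
Proof.
move=> cf ab fM.
have ck c : continuous (fun _ : R => c : R) by move=> x; exact: cvg_cst.
have cfk : continuous (fun x => f x - k).
  by move=> x; apply: continuousB; [exact: cf|exact: ck].
rewrite -Rintegral_itv_cst// -RintegralB//; [|exact: continuous_integrable_itv|
  exact: continuous_integrable_itv].
rewrite (le_trans (le_normr_Rintegral _ _))//.
  exact: (continuous_integrable_itv _ _ cfk).
rewrite -Rintegral_itv_cst//; apply: le_Rintegral => //.
- apply: (continuous_integrable_itv (f := fun x => `|f x - k|)).
  by move=> x; apply: (continuous_comp (cfk x)); exact: norm_continuous.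
- exact: continuous_integrable_itv.
- by move=> x; rewrite /= in_itv/= => /andP[ax xb]; exact: fM.
Qed.

End interval_integral.

Section goursat.
Variable R : realType.
Notation leb := (@lebesgue_measure R).
Variables P Q : R -> R -> R.

(* The 1-form P dx + Q dy is closed in the pointwise sense: it is differentiable
   everywhere and the derivative of P in y equals that of Q in x. *)
Definition closed_form := forall x0 y0, exists abc : R * R * R,
  forall e, 0 < e -> exists2 d, 0 < d & forall x y,
    `|x - x0| < d -> `|y - y0| < d ->
    `|P x y - P x0 y0 - (abc.1.1 * (x - x0) + abc.1.2 * (y - y0))|
      <= e * (`|x - x0| + `|y - y0|) /\
    `|Q x y - Q x0 y0 - (abc.1.2 * (x - x0) + abc.2 * (y - y0))|
      <= e * (`|x - x0| + `|y - y0|).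

Hypothesis PQ : closed_form.

Let slice_continuous (f : R -> R) (x0 : R) : (exists c : R, exists2 d, 0 < d &
    forall x, `|x - x0| < d -> `|f x - f x0| <= c * `|x - x0|) ->
  {for x0, continuous f}.
Proof.
move=> [c [d d0 H]]; apply/cvgrPdist_lt => e e0.
have c1 : 0 < `|c| + 1 by rewrite ltr_wpDl.
near=> x; rewrite distrC.
have xd : `|x - x0| < d.
  by near: x; apply/nbhs_ballP; exists d => //= x; rewrite /ball/= distrC.
rewrite (le_lt_trans (H _ xd))// (@le_lt_trans _ _ ((`|c| + 1) * `|x - x0|))//.
  by rewrite ler_wpM2r// (le_trans (ler_norm c))// lerDl.
rewrite mulrC -ltr_pdivlMr//; near: x; apply/nbhs_ballP.
by exists (e / (`|c| + 1)); [rewrite /= divr_gt0|move=> x; rewrite /ball/= distrC].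
Unshelve. all: by end_near. Qed.

Lemma closed_form_continuous :
  (forall y, continuous (P^~ y)) /\ (forall x, continuous (Q x)).
Proof.
split=> [y0 x0|x0 y0]; apply: slice_continuous; have [[[a b] c] /= H] := PQ x0 y0;
  have [d d0 {}H] := H 1 ltr01.
- exists (`|a| + 1), d => // x xd; have [] := H x y0 xd.
    by rewrite subrr normr0.
  rewrite subrr mulr0 addr0 normr0 addr0 mul1r => h _.
  rewrite mulrDl mul1r -normrM.
  by have := ler_normD (P x y0 - P x0 y0 - a * (x - x0)) (a * (x - x0)); rewrite subrK; lra.
- exists (`|c| + 1), d => // y yd; have [] := H x0 y _ yd.
    by rewrite subrr normr0.
  rewrite subrr !mulr0 !add0r normr0 add0r mul1r => _ h.
  rewrite mulrDl mul1r -normrM.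
  by have := ler_normD (Q x0 y - Q x0 y0 - c * (y - y0)) (c * (y - y0)); rewrite subrK; lra.
Qed.

Let cP y : continuous (P^~ y). Proof. exact: closed_form_continuous.1. Qed.
Let cQ x : continuous (Q x). Proof. exact: closed_form_continuous.2. Qed.

Let cPB c d : continuous (fun x => P x c - P x d).
Proof. by move=> x; apply: continuousB; exact: cP. Qed.

Let cQB a b : continuous (fun y => Q b y - Q a y).
Proof. by move=> y; apply: continuousB; exact: cQ. Qed.

(** The integral of [P dx + Q dy] along the boundary taken counterclockwise: bottom minus top, right
    minus left. *)
Definition rect_integral a b c d :=
  \int[leb]_(x in `[a, b]) (P x c - P x d) + \int[leb]_(y in `[c, d]) (Q b y - Q a y).

(** The affine parts of [P] and [Q] contribute [q (c - d)(b - a)] and [q (b - a)(d - c)]. These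
    cancel because the two mixed derivatives are the same [q], and only the remainder of
    differentiability is left to estimate. *)
Lemma rect_integral_eq0 a b c d : a <= b -> c <= d -> rect_integral a b c d = 0.
Proof.
apply: bisection_eq0 => {a b c d}.
- move=> a m b c d am mb cd; rewrite /rect_integral.
  rewrite (Rintegral_split _ am mb); last exact: cPB.
  have -> : \int[leb]_(y in `[c, d]) (Q b y - Q a y) =
      \int[leb]_(y in `[c, d]) (Q m y - Q a y) +
      \int[leb]_(y in `[c, d]) (Q b y - Q m y).
    rewrite -Rintegral_itvD; [|exact: cQB|exact: cQB].
    by apply: eq_Rintegral => y _; ring.
  by ring.
- move=> a b c m d ab cm md; rewrite /rect_integral.
  rewrite (Rintegral_split _ cm md); last exact: cQB.
  have -> : \int[leb]_(x in `[a, b]) (P x c - P x d) =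
      \int[leb]_(x in `[a, b]) (P x c - P x m) +
      \int[leb]_(x in `[a, b]) (P x m - P x d).
    rewrite -Rintegral_itvD; [|exact: cPB|exact: cPB].
    by apply: eq_Rintegral => y _; ring.
  by ring.
move=> x0 y0 e e0; have [[[p q] r] /= H] := PQ x0 y0.
(* Each integrand is a difference of two values of [P] or of [Q], so each value may use half of
   [e]. *)
have e20 : 0 < e / 2 by rewrite divr_gt0.
have [del del0 {}H] := H _ e20; exists del => // a b c d ax xb cy yd abd cdd.
have ab : a <= b by exact: le_trans xb.
have cd : c <= d by exact: le_trans yd.
set S := b - a + (d - c).
have nx x : a <= x -> x <= b -> `|x - x0| <= b - a.
  by move=> ? ?; rewrite ler_norml; apply/andP; split; lra.
have ny y : c <= y -> y <= d -> `|y - y0| <= d - c.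
  by move=> ? ?; rewrite ler_norml; apply/andP; split; lra.
have Hxy x y : a <= x -> x <= b -> c <= y -> y <= d ->
   `|P x y - P x0 y0 - (p * (x - x0) + q * (y - y0))| <= e / 2 * S /\
   `|Q x y - Q x0 y0 - (q * (x - x0) + r * (y - y0))| <= e / 2 * S.
  move=> ax' xb' cy' yd'; have nxx := nx x ax' xb'; have nyy := ny y cy' yd'.
  have [] := H x y (le_lt_trans nxx abd) (le_lt_trans nyy cdd).
  have : e / 2 * (`|x - x0| + `|y - y0|) <= e / 2 * S.
    by rewrite ler_wpM2l ?lerD// ltW.
  by move=> h h1 h2; split; exact: le_trans h.
have h1 : `|\int[leb]_(x in `[a, b]) (P x c - P x d) - q * (c - d) * (b - a)|
    <= e * S * (b - a).
  apply: Rintegral_dist_le => // x ax' xb'.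
  have [h _] := Hxy x c ax' xb' (lexx c) cd.
  have [h' _] := Hxy x d ax' xb' cd (lexx d).
  rewrite (_ : P x c - P x d - q * (c - d) =
    (P x c - P x0 y0 - (p * (x - x0) + q * (c - y0))) -
    (P x d - P x0 y0 - (p * (x - x0) + q * (d - y0)))); last by ring.
  by rewrite (le_trans (ler_normB _ _))//; lra.
have h2 : `|\int[leb]_(y in `[c, d]) (Q b y - Q a y) - q * (b - a) * (d - c)|
    <= e * S * (d - c).
  apply: Rintegral_dist_le => // y cy' yd'.
  have [_ h] := Hxy b y ab (lexx b) cy' yd'.
  have [_ h'] := Hxy a y (lexx a) ab cy' yd'.
  rewrite (_ : Q b y - Q a y - q * (b - a) =
    (Q b y - Q x0 y0 - (q * (b - x0) + r * (y - y0))) -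
    (Q a y - Q x0 y0 - (q * (a - x0) + r * (y - y0)))); last by ring.
  by rewrite (le_trans (ler_normB _ _))//; lra.
rewrite /rect_integral.
rewrite (_ : _ + _ =
  (\int[leb]_(x in `[a, b]) (P x c - P x d) - q * (c - d) * (b - a)) +
  (\int[leb]_(y in `[c, d]) (Q b y - Q a y) - q * (b - a) * (d - c))); last by ring.
rewrite (le_trans (ler_normD _ _))// (le_trans (lerD h1 h2))//.
by rewrite -mulrDr -/S expr2 mulrA.
Qed.

End goursat.

(** * The mean value property on the unit circle *)

Section circle_mean.
Variable R : realType.
Notation leb := (@lebesgue_measure R).

(** On the rectangle [[s, 0] x [0, p]] the horizontal sides cancel by periodicity, so the vertical
    integral does not depend on [s]. It is then evaluated at an [s] where [Q] is uniformly close to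
    [q0]. *)
Lemma periodic_form_mean (P Q : R -> R -> R) (p q0 : R) : 0 <= p ->
  closed_form P Q -> (forall x, P x 0 = P x p) ->
  (forall e, 0 < e -> exists2 s, s <= 0 & forall t, `|Q s t - q0| <= e) ->
  \int[leb]_(t in `[0, p]) Q 0 t = q0 * p.
Proof.
move=> p0 PQ per lim; have [cP cQ] := closed_form_continuous PQ.
have const s : s <= 0 ->
    \int[leb]_(t in `[0, p]) Q 0 t = \int[leb]_(t in `[0, p]) Q s t.
  move=> s0; have := rect_integral_eq0 PQ s0 p0; rewrite /rect_integral.
  rewrite (@eq_Rintegral _ _ _ _ _ (fun=> 0)); last first.
    by move=> x _; rewrite per subrr.
  rewrite Rintegral_itv_cst// mul0r add0r RintegralB//.
  - by move/eqP; rewrite subr_eq0 => /eqP.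
  - exact: continuous_integrable_itv.
  - exact: continuous_integrable_itv.
apply/eqP; rewrite -subr_eq0 -normr_le0; apply/ler_addgt0Pr => e e0.
have e10 : 0 < e / (p + 1) by rewrite divr_gt0// ltr_wpDl.
have [s s0 small] := lim _ e10; rewrite add0r (const s s0).
have := @Rintegral_dist_le R (Q s) q0 (e / (p + 1)) 0 p (cQ s) p0.
rewrite subr0 => /(_ (fun t _ _ => small t)) h; rewrite (le_trans h)//.
by rewrite mulrAC ler_pdivrMr ?ltr_wpDl// ler_pM2l// lerDl.
Qed.

(** These are the real and imaginary parts of [h dz]. The Cauchy-Riemann equations, read off from
    the derivative [l1 + i l2], make the mixed derivatives agree. *)
Lemma cdiff_closed_form (h : R[i] -> R[i]) : cdiff h ->
  closed_form (fun x y => complex.Re (h (x +i* y))) (fun x y => - complex.Im (h (x +i* y))) /\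
  closed_form (fun x y => complex.Im (h (x +i* y))) (fun x y => complex.Re (h (x +i* y))).
Proof.
move=> dh.
have key x0 y0 : exists l : R[i], forall e, 0 < e -> exists2 d, 0 < d & forall x y,
    `|x - x0| < d -> `|y - y0| < d ->
    normc (h (x +i* y) - h (x0 +i* y0) - l * ((x - x0) +i* (y - y0)))
      <= e * (`|x - x0| + `|y - y0|).
  have [phi cphi hE] := dh (x0 +i* y0); exists (phi (x0 +i* y0)) => e e0.
  have [d d0 small] := cphi e e0; exists (d / 2); first by rewrite divr_gt0.
  move=> x y xd yd; set w := x +i* y; set z := x0 +i* y0.
  have wz : w - z = (x - x0) +i* (y - y0) by [].
  have nwz : normc (w - z) <= `|x - x0| + `|y - y0| by exact: normc_le_ReIm.
  rewrite -wz (hE w) -/z (_ : _ - _ = (phi w - phi z) * (w - z)); last by ring.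
  rewrite normcM ler_pM ?normc_ge0//; apply/ltW/small.
  by rewrite (le_lt_trans nwz)//; lra.
split=> x0 y0; have [[l1 l2] {}key] := key x0 y0.
- exists ((l1, - l2), - l1) => e e0; have [d d0 {}key] := key e e0.
  exists d => // x y xd yd; have := key x y xd yd.
  set E := (X in normc X) => En; split => /=.
  + rewrite (le_trans _ En)// [X in `|X|](_ : _ = complex.Re E) ?le_Re_normc//.
    by rewrite /E !ReImE; ring.
  + rewrite (le_trans _ En)// -normrN [X in `|X|](_ : _ = complex.Im E) ?le_Im_normc//.
    by rewrite /E !ReImE; ring.
- exists ((l2, l1), - l2) => e e0; have [d d0 {}key] := key e e0.
  exists d => // x y xd yd; have := key x y xd yd.
  set E := (X in normc X) => En; split => /=.
  + rewrite (le_trans _ En)// [X in `|X|](_ : _ = complex.Im E) ?le_Im_normc//.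
    by rewrite /E !ReImE; ring.
  + rewrite (le_trans _ En)// [X in `|X|](_ : _ = complex.Re E) ?le_Re_normc//.
    by rewrite /E !ReImE; ring.
Qed.

(** In the variable [log], that is for [g \o cexp], the circle is a vertical segment of length
    [2 pi] over which the function is periodic. Far to the left [cexp] tends to 0, which produces
    [g 0]. *)
Lemma circle_mean_Re (g : R[i] -> R[i]) : cdiff g ->
  \int[leb]_t (\1_(`[0, pi *+ 2]) t * complex.Re (g (cexp (0 +i* t)))) =
  pi *+ 2 * complex.Re (g 0).
Proof.
move=> dg; have dh : cdiff (g \o @cexp R) by apply: cdiff_comp => //; exact: cdiff_cexp.
have [_ f2] := cdiff_closed_form dh.
have p0 : 0 <= pi *+ 2 :> R by rewrite mulrn_wge0// pi_ge0.
have per x : cexp (x +i* 0) = cexp (x +i* (pi *+ 2)) :> R[i].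
  by rewrite /cexp !ReImE cos0 sin0 cos2pi sin2pi.
have lim e : 0 < e -> exists2 s : R, s <= 0 &
    forall t, `|complex.Re (g (cexp (s +i* t))) - complex.Re (g 0)| <= e.
  move=> e0; have [d d0 small] := cdiff_continuous 0 dg e0.
  (* [expR (- d^-1) < d], since [expR d^-1 >= 1 + d^-1 > d^-1]. *)
  exists (- d^-1) => [|t]; first by rewrite oppr_le0 invr_ge0 ltW.
  rewrite -cReN -cReD (le_trans (le_Re_normc _))//; apply/ltW/small.
  rewrite subr0 normc_cexp Re_mk expRN invf_plt ?posrE ?expR_gt0//.
  by rewrite (lt_le_trans _ (expR_ge1Dx _))// ltrDr.
rewrite mulrC -(periodic_form_mean p0 f2 (fun x =>
  congr1 (fun w => complex.Im (g w)) (per x)) lim).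
rewrite [RHS]Rintegral_mkcond; apply: eq_Rintegral => t _.
by rewrite patchE indicE; case: ifP => _; rewrite ?mul1r ?mul0r.
Qed.

Lemma circle_mean (g : R[i] -> R[i]) : cdiff g ->
  cintegral leb (fun t : R => (\1_(`[0, pi *+ 2]) t)%:C * g (cexp (0 +i* t))) =
  (pi *+ 2)%:C * g 0.
Proof.
move=> dg; apply: complex_ext; rewrite !ReImE /= mul0r ?subr0 ?addr0.
- rewrite -circle_mean_Re//; apply: eq_Rintegral => t _.
  by rewrite cReM /= mul0r subr0.
- have dg' : cdiff (fun w => 0 + (- 'i%C) * g w).
    by apply: (@cdiff_comp _ g (fun w => 0 + (- 'i%C) * w)) => //; exact: cdiff_affine.
  have ReIm w : complex.Re (0 + (- 'i%C) * w) = complex.Im w :> R.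
    by case: w => u v; rewrite !ReImE/=; ring.
  have := circle_mean_Re dg'; rewrite ReIm => <-; apply: eq_Rintegral => t _.
  by rewrite ReIm cImM /= mul0r addr0.
Qed.

End circle_mean.

(** * The space L^2 *)

Section square_integrable.
Context d (T : measurableType d) (R : realType).
Variable mu : {measure set T -> \bar R}.
Implicit Types f g h : T -> R[i].

Definition l2sq f : \bar R := (\int[mu]_x (normc (f x) ^+ 2)%:E)%E.

Definition L2 f := cmeasurable f /\ (l2sq f < +oo)%E.

(** This is the square of the norm. As [fine] sends infinity to 0, it carries information only
    together with [L2]. *)
Definition l2n f : R := fine (l2sq f).

Definition cdot f g : R[i] := cintegral mu (fun x => f x * conjc (g x)).

Lemma measurable_sqr_normc f : cmeasurable f ->
  measurable_fun setT (fun x => (normc (f x) ^+ 2)%:E).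
Proof.
by move=> mf; apply/measurable_EFinP; apply: measurable_funX; exact: measurable_normc.
Qed.

Lemma l2sq_ge0 f : (0 <= l2sq f)%E.
Proof. by apply: integral_ge0 => x _; rewrite lee_fin sqr_ge0. Qed.

Lemma l2nE f : L2 f -> (l2n f)%:E = l2sq f.
Proof. by move=> [_ fi]; rewrite fineK// ge0_fin_numE// l2sq_ge0. Qed.

Lemma l2n_ge0 f : 0 <= l2n f.
Proof. by rewrite fine_ge0// l2sq_ge0. Qed.

Lemma le_l2sq f g : cmeasurable f -> cmeasurable g ->
  (forall x, normc (f x) <= normc (g x)) -> (l2sq f <= l2sq g)%E.
Proof.
move=> mf mg fg; apply: ge0_le_integral => //.
- by move=> x _; rewrite lee_fin sqr_ge0.
- exact: measurable_sqr_normc.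
- exact: measurable_sqr_normc.
- by move=> x _; rewrite lee_fin ler_pXn2r// nnegrE normc_ge0.
Qed.

Lemma eq_l2sq f g : (forall x, normc (f x) = normc (g x)) -> l2sq f = l2sq g.
Proof. by move=> fg; apply: eq_integral => x _; rewrite fg. Qed.

Lemma eq_l2n f g : (forall x, normc (f x) = normc (g x)) -> l2n f = l2n g.
Proof. by move=> fg; rewrite /l2n (eq_l2sq fg). Qed.

Lemma le_L2 f g : cmeasurable f -> L2 g ->
  (forall x, normc (f x) <= normc (g x)) -> L2 f.
Proof. by move=> mf [mg gi] fg; split=> //; exact: le_lt_trans (le_l2sq mf mg fg) gi. Qed.

Lemma le_l2n f g : cmeasurable f -> L2 g ->
  (forall x, normc (f x) <= normc (g x)) -> l2n f <= l2n g.
Proof.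
move=> mf g2 fg; have f2 := le_L2 mf g2 fg.
by rewrite -lee_fin !l2nE//; case: g2 => mg _; exact: le_l2sq.
Qed.

Lemma integrable_sqr_normc f : L2 f ->
  mu.-integrable setT (EFin \o (fun x => normc (f x) ^+ 2)).
Proof.
move=> [mf fi]; apply/integrableP; split; first exact: measurable_sqr_normc.
by under eq_integral do rewrite gee0_abs ?lee_fin ?sqr_ge0//.
Qed.

Lemma L2Z (c : R[i]) f : L2 f -> L2 (fun x => c * f x).
Proof.
move=> [mf fi]; split; first exact/cmeasurableM/mf/cmeasurable_cst.
rewrite /l2sq; under eq_integral do rewrite normcM exprMn EFinM.
rewrite ge0_integralZl//; last by rewrite lee_fin sqr_ge0.
- by rewrite -/(l2sq f) -l2nE// -EFinM ltry.
- exact: measurable_sqr_normc.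
- by move=> x _; rewrite lee_fin sqr_ge0.
Qed.

Lemma l2nZ (c : R[i]) f : L2 f -> l2n (fun x => c * f x) = normc c ^+ 2 * l2n f.
Proof.
move=> f2; apply: EFin_inj; rewrite EFinM !l2nE//; last exact: L2Z.
rewrite /l2sq; under eq_integral do rewrite normcM exprMn EFinM.
rewrite ge0_integralZl//; last by rewrite lee_fin sqr_ge0.
- by case: f2 => mf _; exact: measurable_sqr_normc.
- by move=> x _; rewrite lee_fin sqr_ge0.
Qed.

Lemma l2sqD_le f g : cmeasurable f -> cmeasurable g ->
  (l2sq (fun x => f x + g x)%R <= 2%:E * l2sq f + 2%:E * l2sq g)%E.
Proof.
move=> mf mg.
rewrite -!ge0_integralZl//; try exact: measurable_sqr_normc;
  try by move=> x _; rewrite lee_fin sqr_ge0.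
rewrite -ge0_integralD//; try by [move=> x _; rewrite -EFinM lee_fin mulr_ge0// sqr_ge0 |
  apply: measurable_funeM; exact: measurable_sqr_normc].
apply: ge0_le_integral => //.
- by move=> x _; rewrite lee_fin sqr_ge0.
- by apply: measurable_sqr_normc; exact: cmeasurableD.
- by apply: emeasurable_funD; apply: measurable_funeM; exact: measurable_sqr_normc.
- by move=> x _; rewrite -!EFinM -EFinD lee_fin sqr_normcD_le.
Qed.

Lemma L2D f g : L2 f -> L2 g -> L2 (fun x => f x + g x).
Proof.
move=> f2 g2; have [mf _] := f2; have [mg _] := g2; split; first exact: cmeasurableD.
apply: le_lt_trans (l2sqD_le mf mg) _.
by rewrite -!l2nE// -!EFinM -EFinD ltry.
Qed.

Lemma L2N f : L2 f -> L2 (fun x => - f x).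
Proof. by under eq_fun do rewrite -mulN1r; exact: L2Z. Qed.

Lemma L2B f g : L2 f -> L2 g -> L2 (fun x => f x - g x).
Proof. by move=> f2 g2; apply: L2D => //; exact: L2N. Qed.

Lemma L2J f : L2 f -> L2 (fun x => conjc (f x)).
Proof.
move=> f2; apply: (le_L2 _ f2); last by move=> x; rewrite normc_conj.
by case: f2 => mf _; exact: cmeasurableJ.
Qed.

Lemma L2_0 : L2 (fun=> 0).
Proof.
split; first exact: cmeasurable_cst.
by rewrite /l2sq; under eq_integral do rewrite normc0 expr0n; rewrite integral0.
Qed.

Lemma L2_sum (I : Type) (s : seq I) (F : I -> T -> R[i]) :
  (forall i, L2 (F i)) -> L2 (fun x => \sum_(i <- s) F i x).
Proof.
move=> F2; elim: s => [|i s IH].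
  by under eq_fun do rewrite big_nil; exact: L2_0.
by under eq_fun do rewrite big_cons; exact: L2D.
Qed.

Lemma L2_bounded_mul f (m : T -> R[i]) (M : R) : cmeasurable m ->
  (forall x, normc (m x) <= M) -> L2 f -> L2 (fun x => m x * f x).
Proof.
move=> mm mM f2; apply: (@le_L2 _ (fun x => `|M|%:C * f x)); last first.
- move=> x; rewrite !normcM ler_wpM2r ?normc_ge0// normcr normr_id.
  by rewrite (le_trans (mM x))// ler_norm.
- exact: L2Z.
- by case: f2 => mf _; exact: cmeasurableM.
Qed.

Lemma l2nD_le f g : L2 f -> L2 g ->
  l2n (fun x => f x + g x) <= 2 * l2n f + 2 * l2n g.
Proof.
move=> f2 g2; rewrite -lee_fin EFinD !EFinM !l2nE//; last exact: L2D.
by apply: l2sqD_le; [case: f2|case: g2].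
Qed.

Lemma L2_cintegrable f g : L2 f -> L2 g -> cintegrable mu (fun x => f x * g x).
Proof.
move=> f2 g2; have [mf _] := f2; have [mg _] := g2.
apply: (@cintegrable_le _ _ _ _ _ (fun x => normc (f x) ^+ 2 + normc (g x) ^+ 2)).
- exact: cmeasurableM.
- exact: (integrableD measurableT (integrable_sqr_normc f2) (integrable_sqr_normc g2)).
- move=> x; rewrite normcM; have := sqr_ge0 (normc (f x) - normc (g x)).
  have := normc_ge0 (f x); have := normc_ge0 (g x); nra.
Qed.

Lemma cdot_cintegrable f g : L2 f -> L2 g ->
  cintegrable mu (fun x => f x * conjc (g x)).
Proof. by move=> f2 g2; apply: L2_cintegrable => //; exact: L2J. Qed.

Lemma cdot_normal f : cdot f f = (l2n f)%:C.
Proof.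
rewrite /cdot (eq_cintegral _ (g := fun x => (normc (f x) ^+ 2)%:C)).
  by rewrite cintegral_real.
by move=> x; rewrite mulcJ.
Qed.

Lemma cdotDl f g h : L2 f -> L2 g -> L2 h ->
  cdot (fun x => f x + g x) h = cdot f h + cdot g h.
Proof.
move=> f2 g2 h2; rewrite -cintegralD; [|exact: cdot_cintegrable|exact: cdot_cintegrable].
by apply: eq_cintegral => x; rewrite mulrDl.
Qed.

Lemma cdotZl c f g : L2 f -> L2 g -> cdot (fun x => c * f x) g = c * cdot f g.
Proof.
move=> f2 g2; rewrite -cintegralZ; last exact: cdot_cintegrable.
by apply: eq_cintegral => x; rewrite mulrA.
Qed.

Lemma cdotC f g : L2 f -> L2 g -> cdot g f = conjc (cdot f g).
Proof.
move=> f2 g2; rewrite -cintegralJ; last exact: cdot_cintegrable.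
by apply: eq_cintegral => x; rewrite conjcM conjcK mulrC.
Qed.

Lemma cdotBl f g h : L2 f -> L2 g -> L2 h ->
  cdot (fun x => f x - g x) h = cdot f h - cdot g h.
Proof.
move=> f2 g2 h2; rewrite -cintegralB; [|exact: cdot_cintegrable|exact: cdot_cintegrable].
by apply: eq_cintegral => x; rewrite mulrBl.
Qed.

Lemma l2nD f g : L2 f -> L2 g ->
  l2n (fun x => f x + g x) = l2n f + l2n g + 2 * complex.Re (cdot f g).
Proof.
move=> f2 g2; have fg2 : L2 (fun x => f x + g x) by exact: L2D.
suff : (l2n (fun x => f x + g x))%:C =
    (l2n f)%:C + (l2n g)%:C + (cdot f g + conjc (cdot f g)) :> R[i].
  move/(congr1 (@complex.Re R)); rewrite !ReImE => ->; ring.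
rewrite -(cdotC f2 g2) -!cdot_normal.
have gf := cdot_cintegrable g2 f2; have fg := cdot_cintegrable f2 g2.
rewrite -(cintegralD (cdot_cintegrable f2 f2) (cdot_cintegrable g2 g2)).
rewrite -(cintegralD fg gf) -cintegralD; last 2 first.
- by apply: cintegrableD; exact: cdot_cintegrable.
- by apply: cintegrableD; exact: cdot_cintegrable.
by apply: eq_cintegral => x; rewrite conjcD; ring.
Qed.

Lemma cauchy_schwarz f g : L2 f -> L2 g ->
  normc (cdot f g) ^+ 2 <= l2n f * l2n g.
Proof.
move=> f2 g2; set c := cdot f g.
(* This is [|f - s c g|^2]. The best choice is [s = 1 / |g|^2]. If [|g|^2 = 0] the expression is
   affine in [s], and the [s] used below would make it equal to [-1]. *)
have H (s : R) : 0 <= s ^+ 2 * (normc c ^+ 2 * l2n g) - 2 * s * normc c ^+ 2 + l2n f.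
  have := l2n_ge0 (fun x => f x + (- s)%:C * c * g x).
  rewrite l2nD//; last exact: L2Z.
  rewrite l2nZ// normcM normcr normrN exprMn real_normK ?num_real//.
  rewrite (cdotC (L2Z _ g2) f2) cdotZl// (cdotC f2 g2) -/c.
  rewrite -mulrA mulcJ !ReImE/= => h; apply: (le_trans h).
  by rewrite le_eqVlt; apply/orP; left; apply/eqP; ring.
have [g0|g0] := eqVneq (l2n g) 0.
  rewrite g0 mulr0 leNgt; apply/negP => c0.
  have := H ((l2n f + 1) / (2 * normc c ^+ 2)).
  rewrite g0 mulr0 mulr0 add0r.
  have -> : 2 * ((l2n f + 1) / (2 * normc c ^+ 2)) * normc c ^+ 2 = l2n f + 1.
    have nc0 : normc c != 0 by apply: contraTneq c0 => ->; rewrite expr0n ltxx.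
    by field.
  lra.
have gp : 0 < l2n g by rewrite lt_neqAle eq_sym g0 l2n_ge0.
have := H (l2n g)^-1; rewrite -(ler_pM2r gp) mul0r.
have -> : ((l2n g)^-1 ^+ 2 * (normc c ^+ 2 * l2n g) - 2 * (l2n g)^-1 * normc c ^+ 2 + l2n f) * l2n g
  = l2n f * l2n g - normc c ^+ 2 by field.
by rewrite subr_ge0.
Qed.

Lemma cdot_cvg (f_ : nat -> T -> R[i]) f g : (forall k, L2 (f_ k)) -> L2 f -> L2 g ->
  l2n (fun x => f_ k x - f x) @[k --> \oo] --> (0 : R) ->
  normc (cdot (f_ k) g - cdot f g) @[k --> \oo] --> (0 : R).
Proof.
move=> f_2 f2 g2 cvgf.
have sq : normc (cdot (f_ k) g - cdot f g) ^+ 2 @[k --> \oo] --> (0 : R).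
  apply: (squeeze_cvgr (h := fun k => l2n (fun x => f_ k x - f x) * l2n g)
    (f := fun=> 0)).
  - apply: nearW => k /=; rewrite sqr_ge0 -cdotBl//.
    by apply: cauchy_schwarz => //; exact: L2B.
  - exact: cvg_cst.
  - by rewrite -[X in _ --> X](mul0r (l2n g)); apply: cvgMr_tmp.
apply/cvgrPdist_lt => e e0.
have /cvgrPdist_lt/(_ _ (exprn_gt0 2 e0)) := sq.
apply: filterS => k; rewrite !sub0r !normrN !ger0_norm ?normc_ge0 ?sqr_ge0//.
by rewrite ltr_pXn2r// nnegrE ?normc_ge0// ltW.
Qed.

Lemma l2sq_fatou (f_ : nat -> T -> R[i]) f (M : R) :
  (forall k, cmeasurable (f_ k)) ->
  (forall x, normc (f_ k x - f x) @[k --> \oo] --> (0 : R)) ->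
  (\forall k \near \oo, (l2sq (f_ k) <= M%:E)%E) -> (l2sq f <= M%:E)%E.
Proof.
move=> mf cvgf leM.
have cvgn x : (normc (f_ k x) ^+ 2)%:E @[k --> \oo] --> (normc (f x) ^+ 2)%:E.
  apply: cvg_EFin; first exact: nearW.
  have cvgx : normc (f_ k x) @[k --> \oo] --> normc (f x).
    apply/cvgrPdist_le => e e0; have /cvgrPdist_le/(_ _ e0) := cvgf x.
    apply: filterS => k; rewrite sub0r normrN ger0_norm ?normc_ge0//; apply: le_trans.
    rewrite ler_norml; apply/andP; split.
      by have := le_normcD (f_ k x - f x) (f x); rewrite subrK; lra.
    by have := le_normcD (f x - f_ k x) (f_ k x); rewrite subrK normc_distC; lra.
  exact: (cvgM cvgx cvgx).
have -> : l2sq f = (\int[mu]_x limn_einf (fun k => (normc (f_ k x) ^+ 2)%:E))%E.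
  by apply: eq_integral => x _; rewrite (cvg_limn_einf_sup (cvgn x)).1.
apply: (@le_trans _ _ (limn_einf (fun k => l2sq (f_ k)))).
  apply: fatou => // [k|k x _]; first exact: measurable_sqr_normc.
  by rewrite lee_fin sqr_ge0.
have [N _ HN] := leM.
rewrite limn_einf_lim; apply: lime_le; first exact: is_cvg_einfs.
apply: nearW => k; apply: (@le_trans _ _ (l2sq (f_ (maxn k N)))).
  by apply: ereal_inf_lbound; exists (maxn k N) => //=; exact: leq_maxl.
by apply: HN => /=; exact: leq_maxr.
Qed.

Lemma abs_series_cvg (u : nat -> R) (M : R) :
  (forall n, \sum_(0 <= k < n) `|u k.+1 - u k| <= M) -> cvgn u.
Proof.
move=> uM.
have cs0 : cvgn (fun n => \sum_(0 <= k < n) `|u k.+1 - u k|).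
  apply: nondecreasing_is_cvgn.
    by apply/nondecreasing_seqP => n; rewrite big_nat_recr//= lerDl.
  by exists M => _ [n _ <-]; exact: uM.
have /normed_cvg cs : cvgn [normed series (fun k => u k.+1 - u k)] := cs0.
rewrite (_ : u = fun n => u 0%N + series (fun k => u k.+1 - u k) n).
  by apply: is_cvgD => //; exact: is_cvg_cst.
apply/funext => n; rewrite /series/=; elim: n => [|n IH].
  by rewrite big_geq// addr0.
by rewrite big_nat_recr//= addrA -IH addrC subrK.
Qed.

Lemma sum_half_le n : \sum_(0 <= k < n) (2^-1 : R) ^+ k <= 2.
Proof.
suff -> : \sum_(0 <= k < n) (2^-1 : R) ^+ k = 2 - 2 * 2^-1 ^+ n.
  by rewrite gerBl mulr_ge0// exprn_ge0// invr_ge0.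
elim: n => [|n IH]; first by rewrite big_geq// expr0 mulr1 subrr.
by rewrite big_nat_recr//= IH exprS; field.
Qed.

(* Only a subsequence whose increments decay geometrically converges pointwise,
   and only off the null set where the weighted sum of the squared increments is
   infinite. *)
Lemma riesz_fischer_fast (u : nat -> T -> R[i]) : (forall k, L2 (u k)) ->
  (forall k, l2n (fun x => u k.+1 x - u k x) <= 4^-1 ^+ k) ->
  exists f (v : nat -> T -> R[i]), [/\ cmeasurable f,
    forall k, L2 (v k) /\ l2n (fun x => u k x - v k x) = 0,
    forall k l x, normc (v k x - v l x) <= normc (u k x - u l x) &
    forall x, normc (v k x - f x) @[k --> \oo] --> (0 : R)].
Proof.
(* With the weight [2^k] the integrals are still summable, as [2^k 4^-k = 2^-k], and
   [q <= (2^-k + 2^k q^2) / 2] turns a finite sum of the [a k x] into absolute summability of the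
   increments. *)
move=> u2 fast; pose a k x := (2 ^+ k * normc (u k.+1 x - u k x) ^+ 2).
have mu_ k : cmeasurable (u k) by case: (u2 k).
have ma k : measurable_fun setT (fun x => (a k x)%:E).
  apply/measurable_EFinP; apply: measurable_funM => //; apply: measurable_funX.
  by apply: measurable_normc; exact: cmeasurableB.
have a0 k x : 0 <= a k x by apply: mulr_ge0; [exact: exprn_ge0|exact: sqr_ge0].
pose h x := (\sum_(0 <= k <oo) (a k x)%:E)%E.
have mh : measurable_fun setT h.
  by apply: ge0_emeasurable_sum => // k x _ _; rewrite lee_fin.
have h0 x : (0 <= h x)%E by apply: nneseries_ge0 => k _ _; rewrite lee_fin.
have ih : (\int[mu]_x h x <= 2%:E)%E.
  rewrite integral_nneseries//; last by move=> k x _; rewrite lee_fin.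
  have le2 k : (\int[mu]_x (a k x)%:E <= (2^-1 ^+ k)%:E)%E.
    under eq_integral do rewrite EFinM.
    rewrite ge0_integralZl//; last 2 first.
    - by apply: measurable_sqr_normc; exact: cmeasurableB.
    - by move=> x _; rewrite lee_fin sqr_ge0.
    rewrite -/(l2sq _) -l2nE; last exact: L2B.
    rewrite -EFinM lee_fin (_ : 2^-1 ^+ k = 2 ^+ k * 4^-1 ^+ k); last first.
      by rewrite -exprMn; congr (_ ^+ _); field.
    by rewrite ler_wpM2l// exprn_ge0.
  apply: lime_le.
    apply: is_cvg_nneseries => k _ _; apply: integral_ge0 => x _.
    by rewrite lee_fin.
  apply: nearW => n; apply: le_trans (_ : (\sum_(0 <= k < n) (2^-1 ^+ k)%:E <= _)%E).
    by apply: lee_sum => k _; exact: le2.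
  by rewrite sumEFin lee_fin sum_half_le.
pose A := h @^-1` [set y | (y < +oo)%E].
have mA : measurable A.
  by rewrite -[A]setTI; exact: emeasurable_fun_infty_o.
have A0 : mu (~` A) = 0%E.
  have hi : mu.-integrable setT h.
    apply/integrableP; split=> //; under eq_integral do rewrite gee0_abs//.
    by rewrite (le_lt_trans ih)// ltry.
  have [B [mB B0 sB]] := integrable_ae measurableT hi.
  apply: (subset_measure0 (B := B)) => //; first exact: measurableC.
  move=> x /= Ax; apply: sB => /= /(_ Logic.I); rewrite ge0_fin_numE//.
(* Cutting off outside [A] gives convergence at every point and changes [u k] on a null set only. *)
pose v k x := u k x * (\1_A x)%:C.
have mv k : cmeasurable (v k) by exact: cmeasurable_restrict.
have cvg_Re_Im (w : nat -> R[i]) : cvgn (fun k => complex.Re (w k)) ->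
    cvgn (fun k => complex.Im (w k)) ->
    exists l : R[i], normc (w k - l) @[k --> \oo] --> (0 : R).
  move=> /cvg_ex[/= l1 c1] /cvg_ex[/= l2 c2]; exists (l1 +i* l2).
  apply: (squeeze_cvgr (f := fun=> 0)
    (h := fun k => `|complex.Re (w k) - l1| + `|complex.Im (w k) - l2|)).
  - apply: nearW => k; rewrite normc_ge0/= (le_trans (normc_le_ReIm _))//.
    by rewrite !ReImE.
  - exact: cvg_cst.
  - rewrite -[X in _ --> X](addr0 (0 : R)); apply: cvgD.
    + rewrite -(normr0 R) -(subrr l1); apply: cvg_norm; apply: cvgB => //; exact: cvg_cst.
    + rewrite -(normr0 R) -(subrr l2); apply: cvg_norm; apply: cvgB => //; exact: cvg_cst.
have vc x : exists l : R[i], normc (v k x - l) @[k --> \oo] --> (0 : R).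
  have [Ax|Ax] := pselect (A x); last first.
    exists 0; rewrite (_ : (fun k => _) = fun=> 0); first exact: cvg_cst.
    by apply/funext => k; rewrite /v indicE memNset// mulr0 subr0 normc0.
  have vE k : v k x = u k x by rewrite /v indicE mem_set// mulr1.
  suff [l ul] : exists l : R[i], normc (u k x - l) @[k --> \oo] --> (0 : R).
    exists l; rewrite (_ : (fun k => _) = (fun k => normc (u k x - l)))//.
    by apply/funext => k; rewrite vE.
  have hfin : h x \is a fin_num by rewrite ge0_fin_numE.
  have bnd (w : nat -> R) : (forall k, `|w k.+1 - w k| <= normc (u k.+1 x - u k x)) ->
      cvgn w.
    move=> wu; apply: (@abs_series_cvg w (1 + 2^-1 * fine (h x))) => n.
    apply: le_trans (_ : \sum_(0 <= k < n) (2^-1 * 2^-1 ^+ k + 2^-1 * a k x) <= _).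
      apply: ler_sum => k _; rewrite (le_trans (wu k))// /a exprVn.
      have p0 : 0 < (2 : R) ^+ k by rewrite exprn_gt0.
      move: (2 ^+ k) (normc _) p0 => p q p0.
      rewrite -subr_ge0 (_ : _ - _ = (1 - p * q) ^+ 2 / (2 * p)); last first.
        by field; rewrite gt_eqF.
      by rewrite divr_ge0 ?sqr_ge0// mulr_ge0// ltW.
    rewrite big_split/= -!mulr_sumr lerD//.
      by have := sum_half_le n; lra.
    rewrite ler_wpM2l ?invr_ge0// -lee_fin fineK// -sumEFin.
    by apply: nneseries_lim_ge => k _ _; rewrite lee_fin.
  apply: cvg_Re_Im; apply: bnd => k.
  - by rewrite -cReN -cReD le_Re_normc.
  - by rewrite -cImN -cImD le_Im_normc.
pose f x := projT1 (cid (vc x)).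
have fE x : normc (v k x - f x) @[k --> \oo] --> (0 : R) by exact: projT2 (cid (vc x)).
have cvg_part (Q : R[i] -> R) : (forall z w, `|Q z - Q w| <= normc (z - w)) ->
    forall x, Q (v k x) @[k --> \oo] --> Q (f x).
  move=> Ql x; apply/cvgrPdist_le => e e0; have /cvgrPdist_le/(_ _ e0) := fE x.
  apply: filterS => k; rewrite sub0r normrN ger0_norm ?normc_ge0//; apply: le_trans.
  by rewrite distrC.
exists f, v; split => //.
- split.
  + apply: (measurable_fun_cvg (h := fun k x => complex.Re (v k x))) => [k|x _].
      by case: (mv k).
    by apply: (cvg_part (@complex.Re R)) => z w; rewrite -cReN -cReD le_Re_normc.
  + apply: (measurable_fun_cvg (h := fun k x => complex.Im (v k x))) => [k|x _].
      by case: (mv k).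
    by apply: (cvg_part (@complex.Im R)) => z w; rewrite -cImN -cImD le_Im_normc.
- move=> k; split.
    apply: (le_L2 (mv k) (u2 k)) => x; rewrite normcM normcr ler_piMr ?normc_ge0//.
    by rewrite indicE; case: (x \in A); rewrite ?normr1 ?normr0.
  rewrite /l2n /l2sq (ae_eq_integral (cst 0%E))//.
  + by rewrite integral_cst// mul0e.
  + by apply: measurable_sqr_normc; exact: cmeasurableB.
  + exists (~` A); split => //; first exact: measurableC.
    move=> x /=; apply: contra_not => Ax _; rewrite /= /v indicE mem_set//.
    by rewrite mulr1 subrr normc0 expr0n.
- move=> k l x; rewrite /v -mulrBl normcM normcr ler_piMr ?normc_ge0//.
  by rewrite indicE; case: (x \in A); rewrite ?normr1 ?normr0.
Qed.

(** The limit of a fast subsequence is at squared distance at most [4^-k] from its [k]-th term, by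
    Fatou's lemma. The Cauchy condition carries the convergence back to the whole sequence. *)
Lemma riesz_fischer (u : nat -> T -> R[i]) : (forall k, L2 (u k)) ->
  (forall e, 0 < e -> exists N, forall k l, (N <= k)%N -> (N <= l)%N ->
    l2n (fun x => u k x - u l x) <= e) ->
  exists2 f, L2 f & l2n (fun x => u k x - f x) @[k --> \oo] --> (0 : R).
Proof.
move=> u2 cu.
have cu4 k : exists N, forall i j, (N <= i)%N -> (N <= j)%N ->
    l2n (fun x => u i x - u j x) <= 4^-1 ^+ k.
  by apply: cu; rewrite exprn_gt0// invr_gt0.
pose N k := projT1 (cid (cu4 k)).
have NP k : forall i j, (N k <= i)%N -> (N k <= j)%N ->
    l2n (fun x => u i x - u j x) <= 4^-1 ^+ k by exact: projT2 (cid (cu4 k)).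
(* The sum dominates [N i] for every [i <= k], and the extra [k] makes [phi k] exceed any prescribed
   index. *)
pose phi k := (k + \sum_(i < k.+1) N i)%N.
have Nphi k l : (k <= l)%N -> (N k <= phi l)%N.
  move=> kl; rewrite /phi (bigD1 (Ordinal (kl : (k < l.+1)%N)))//=.
  by rewrite addnCA leq_addr.
have [f [v [mf uv vu vf]]] := @riesz_fischer_fast (fun k => u (phi k))
  (fun k => u2 (phi k)) (fun k => NP k _ _ (Nphi _ _ (leqnSn k)) (Nphi _ _ (leqnn k))).
have v2 k : L2 (v k) by case: (uv k).
have mvf k : cmeasurable (fun x => v k x - f x).
  by apply: cmeasurableB => //; case: (v2 k).
have vf4 k : (l2sq (fun x => (v k x - f x)%R) <= (4^-1 ^+ k)%:E)%E.
  apply: (@l2sq_fatou (fun l x => v k x - v l x)) => //.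
  - by move=> l; apply: cmeasurableB; [case: (v2 k)|case: (v2 l)].
  - move=> x; rewrite (_ : (fun l => _) = (fun l => normc (v l x - f x)))//.
    by apply/funext => l; rewrite [RHS]normc_distC; congr normc; ring.
  - near=> l.
    have kl : (k <= l)%N by near: l; exact: nbhs_infty_ge.
    have L := L2B (v2 k) (v2 l).
    rewrite -l2nE// lee_fin; apply: le_trans (NP k _ _ (Nphi _ _ (leqnn k)) (Nphi _ _ kl)).
    by apply: le_l2n => //; [case: L|exact: L2B].
have vf2 k : L2 (fun x => v k x - f x).
  by split => //; rewrite (le_lt_trans (vf4 k))// ltry.
have f2 : L2 f.
  rewrite (_ : f = fun x => v 0%N x - (v 0%N x - f x)); first exact: L2B.
  by apply/funext => x; rewrite opprB addrC subrK.
exists f => //; apply/cvgrPdist_le => e e0.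
(* Two uses of [|f + g|^2 <= 2 |f|^2 + 2 |g|^2] yield [2 e/8 + 4 e/8]. *)
have e8 : 0 < e / 8 by rewrite divr_gt0.
have [M HM] := cu _ e8.
have /cvgrPdist_le/(_ _ e8)[K _ HK] : (4^-1 : R) ^+ k @[k --> \oo] --> (0 : R).
  by apply: cvg_expr; rewrite ger0_norm ?invr_ge0// invf_lt1// ltr1n.
near=> i; have Mi : (M <= i)%N by near: i; exact: nbhs_infty_ge.
pose k := maxn M K.
have pk : (M <= phi k)%N by rewrite (leq_trans (leq_maxl M K))// leq_addr.
rewrite sub0r normrN ger0_norm ?l2n_ge0//.
have -> : (fun x => u i x - f x) = fun x => (u i x - u (phi k) x) +
    ((u (phi k) x - v k x) + (v k x - f x)).
  by apply/funext => x; ring.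
have uv2 : L2 (fun x => u (phi k) x - v k x) by exact: L2B.
rewrite (le_trans (l2nD_le (L2B (u2 _) (u2 _)) (L2D uv2 (vf2 k))))//.
have := l2nD_le uv2 (vf2 k); have [_ ->] := uv k.
have := HM _ _ Mi pk; have := HK k (leq_maxr _ _).
rewrite sub0r normrN ger0_norm ?exprn_ge0 ?invr_ge0//.
have : l2n (fun x => v k x - f x) <= 4^-1 ^+ k by rewrite -lee_fin l2nE.
lra.
Unshelve. all: by end_near. Qed.

End square_integrable.

Lemma cintegrable_real d (T : measurableType d) (R : realType)
    (mu : {measure set T -> \bar R}) (h : T -> R) :
  mu.-integrable setT (EFin \o h) -> cintegrable mu (fun x => (h x)%:C).
Proof. by move=> hi; split => //; exact: integrable0. Qed.

Section tensor.
Context d1 d2 (T1 : measurableType d1) (T2 : measurableType d2) (R : realType).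
Variables (m1 : {sigma_finite_measure set T1 -> \bar R})
  (m2 : {sigma_finite_measure set T2 -> \bar R}).

Lemma cintegral_tensor (f : T1 -> R[i]) (g : T2 -> R[i]) :
  cintegrable m1 f -> cintegrable m2 g ->
  cintegrable (m1 \x m2)%E (fun p => f p.1 * g p.2) /\
  cintegral (m1 \x m2)%E (fun p => f p.1 * g p.2) = cintegral m1 f * cintegral m2 g.
Proof.
move=> fi gi; have mf := cintegrable_cmeasurable fi.
have mg := cintegrable_cmeasurable gi.
have mfg : cmeasurable (fun p : T1 * T2 => f p.1 * g p.2).
  apply: cmeasurableM; first exact: (cmeasurable_comp measurable_fst mf).
  exact: (cmeasurable_comp measurable_snd mg).
have [_ fy] := (cintegrableP _ _).1 fi; have [_ gy] := (cintegrableP _ _).1 gi.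
have f0 : (0 <= \int[m1]_x (normc (f x))%:E)%E.
  by apply: integral_ge0 => x _; rewrite lee_fin normc_ge0.
have g0 : (0 <= \int[m2]_x (normc (g x))%:E)%E.
  by apply: integral_ge0 => x _; rewrite lee_fin normc_ge0.
have fgi : cintegrable (m1 \x m2)%E (fun p => f p.1 * g p.2).
  apply: cintegrable_prod => //.
  rewrite (eq_integral (fun x => (normc (f x))%:E *
      \int[m2]_y (normc (g y))%:E)%E); last first.
    move=> x _; rewrite -ge0_integralZl//=.
    - by apply: eq_integral => y _; rewrite normcM EFinM.
    - by apply/measurable_EFinP; exact: measurable_normc.
    - by move=> y _; rewrite lee_fin normc_ge0.
    - by rewrite lee_fin normc_ge0.
  rewrite ge0_integralZr//.
  - by rewrite lte_mul_pinfty// ge0_fin_numE.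
  - by apply/measurable_EFinP; exact: measurable_normc.
  - by move=> y _; rewrite lee_fin normc_ge0.
split => //; rewrite -(cfubini1 fgi)/=.
rewrite (eq_cintegral _ (g := fun x => cintegral m2 g * f x)).
  by rewrite cintegralZ// mulrC.
by move=> x; rewrite cintegralZ// mulrC.
Qed.

End tensor.

Section sigma_finite_product.
Context d1 d2 (T1 : measurableType d1) (T2 : measurableType d2) (R : realType).
Variables (m1 : {sigma_finite_measure set T1 -> \bar R})
  (m2 : {sigma_finite_measure set T2 -> \bar R}).

(* The library's canonical sigma-finite structure on [m1 \x m2] requires
   subprobabilities; this alias carries the general one. *)
Definition sfprod : set (T1 * T2) -> \bar R := (m1 \x m2)%E.

HB.instance Definition _ := Measure.copy sfprod (m1 \x m2)%E.

Let sfprod_sigma_finite : sigma_finite setT sfprod.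
Proof.
have := @isSigmaFinite.sigma_finiteT _ _ _ _ (lebesgue_integral_fubini.measure_function_Measure_isSigmaFinite__to__measure_function_isSigmaFinite m1 m2).
exact.
Qed.

HB.instance Definition _ := @Measure_isSigmaFinite.Build _ _ _ sfprod sfprod_sigma_finite.

End sigma_finite_product.

(** * Gaussian integrals *)

Section gaussian.
Variable R : realType.
Notation leb := (@lebesgue_measure R).
Notation Rn n := (n.-tuple (measurableTypeR R)).
Notation leb2 n := (lebesgue_n R n \x lebesgue_n R n)%E.
Notation Cn n := 'rV[R[i]]_n.

Definition rdot n (x y : Rn n) : R := \sum_(i < n) tnth x i * tnth y i.

Lemma rdotC n (x y : Rn n) : rdot x y = rdot y x.
Proof. by apply: eq_bigr => i _; rewrite mulrC. Qed.

Lemma rdot_taffl n s (h x y : Rn n) : rdot (taff s h x) y = rdot h y + s * rdot x y.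
Proof.
rewrite /rdot mulr_sumr -big_split/=; apply: eq_bigr => i _.
by rewrite tnth_mktuple; ring.
Qed.

Lemma rdot_taffr n s (h x y : Rn n) : rdot y (taff s h x) = rdot y h + s * rdot y x.
Proof. by rewrite !(rdotC y) rdot_taffl. Qed.

Lemma rdot_ge0 n (x : Rn n) : 0 <= rdot x x.
Proof. by apply: sumr_ge0 => i _; rewrite -expr2 sqr_ge0. Qed.

Lemma rdot_tcons n (x0 y0 : R) (x y : Rn n) :
  rdot (tcons (x0 : measurableTypeR R, x)) (tcons (y0 : measurableTypeR R, y))
  = x0 * y0 + rdot x y.
Proof.
rewrite /rdot big_ord_recl; congr (_ + _); apply: eq_bigr => i _.
by rewrite !tnth_tconsS.
Qed.

Lemma rdot0 (x y : Rn 0) : rdot x y = 0.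
Proof. by rewrite /rdot big_ord0. Qed.

Lemma measurable_rdot d (T : measurableType d) n (f g : T -> Rn n) :
  measurable_fun setT f -> measurable_fun setT g ->
  measurable_fun setT (fun t => rdot (f t) (g t)).
Proof.
move=> mf mg; apply: measurable_sum => i; apply: measurable_funM.
- exact: (measurableT_comp (measurable_tnth i) mf).
- exact: (measurableT_comp (measurable_tnth i) mg).
Qed.

Lemma Re_dotc n (p q : Rn n * Rn n) :
  complex.Re (dotc (complex_vec p) (complex_vec q)) = rdot p.1 q.1 - rdot p.2 q.2.
Proof.
rewrite /dotc Re_sum /rdot -sumrB; apply: eq_bigr => i _.
by rewrite !mxE !ReImE.
Qed.

Lemma Im_dotc n (p q : Rn n * Rn n) :
  complex.Im (dotc (complex_vec p) (complex_vec q)) = rdot p.1 q.2 + rdot p.2 q.1.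
Proof.
rewrite /dotc Im_sum /rdot -big_split/=; apply: eq_bigr => i _.
by rewrite !mxE !ReImE.
Qed.

Definition topp n (x : Rn n) : Rn n := [tuple (- tnth x i : R) | i < n].
Definition tzero n : Rn n := [tuple (0 : R) | i < n].

Lemma rdot_toppl n (x y : Rn n) : rdot (topp x) y = - rdot x y.
Proof.
by rewrite /rdot -sumrN; apply: eq_bigr => i _; rewrite tnth_mktuple mulNr.
Qed.

Lemma rdot_toppr n (x y : Rn n) : rdot x (topp y) = - rdot x y.
Proof. by rewrite rdotC rdot_toppl rdotC. Qed.

Lemma rdot_tzerol n (x : Rn n) : rdot (tzero n) x = 0.
Proof. by rewrite /rdot big1// => i _; rewrite tnth_mktuple mul0r. Qed.

Lemma rdot_tzeror n (x : Rn n) : rdot x (tzero n) = 0.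
Proof. by rewrite rdotC rdot_tzerol. Qed.

Definition rdotE := (rdot_taffl, rdot_taffr, rdot_toppl, rdot_toppr,
  rdot_tzerol, rdot_tzeror).

Lemma real_vecE n (x : Rn n) : real_vec x = complex_vec (x, tzero n).
Proof. by apply/rowP => j; rewrite !mxE /= tnth_mktuple. Qed.

Definition vec_pair n (z : Cn n) : Rn n * Rn n :=
  ([tuple (complex.Re (z 0 i) : R) | i < n], [tuple (complex.Im (z 0 i) : R) | i < n]).

Lemma vec_pairK n (z : Cn n) : complex_vec (vec_pair z) = z.
Proof. by apply/rowP => j; rewrite !mxE /= !tnth_mktuple; case: (z 0 j). Qed.

Lemma complex_vecD n (a x : Rn n * Rn n) :
  complex_vec a + complex_vec x = complex_vec (taff 1 a.1 x.1, taff 1 a.2 x.2).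
Proof.
by apply/rowP => j; rewrite !mxE /= !tnth_mktuple; apply: complex_ext;
  rewrite !ReImE mul1r.
Qed.

Lemma sum_sqr_normc n (p : Rn n * Rn n) :
  \sum_(j < n) normc (complex_vec p 0 j) ^+ 2 = rdot p.1 p.1 + rdot p.2 p.2.
Proof.
rewrite /rdot -big_split/=; apply: eq_bigr => i _.
by rewrite sqr_normc_ReIm !mxE/= !expr2.
Qed.

Lemma gauss_densityE n (p : Rn n * Rn n) :
  gauss_density (complex_vec p) = pi ^- n * expR (- (rdot p.1 p.1 + rdot p.2 p.2)).
Proof. by rewrite /gauss_density sum_sqr_normc. Qed.

Lemma measurable_gaussian n (a : R) :
  measurable_fun setT (fun x : Rn n => expR (- (a * rdot x x))).
Proof.
apply: measurableT_comp => //; apply: measurableT_comp => //.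
by apply: measurable_funM => //; exact: measurable_rdot.
Qed.

Lemma integral_gaussian1 (a : R) : 0 < a ->
  (\int[leb]_x (expR (- (a * (x * x))))%:E = (Num.sqrt (pi / a))%:E)%E.
Proof.
move=> a0; have s0 : 0 < Num.sqrt a by rewrite sqrtr_gt0.
have [_ /(_ (EFin \o @gauss_fun R))] := transports_affine 0 s0.
rewrite integralT_gauss => H.
transitivity (\int[leb]_x (gauss_fun (0 + Num.sqrt a * x))%:E)%E.
  apply: eq_integral => x _; rewrite /gauss_fun add0r exprMn sqr_sqrtr ?ltW//.
rewrite H.
- rewrite -EFinM sqrtrM ?pi_ge0// mulrC sqrtrV ?ltW//.
- by apply/measurable_EFinP; exact: measurable_gauss_fun.
- by move=> x; rewrite lee_fin gauss_fun_ge0.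
Qed.

Lemma integral_gaussian n (a : R) : 0 < a ->
  (\int[lebesgue_n R n]_x (expR (- (a * rdot x x)))%:E
   = (Num.sqrt (pi / a) ^+ n)%:E)%E.
Proof.
move=> a0; elim: n => [|n IH].
  rewrite [LHS]integral_dirac//; last first.
    by apply/measurable_EFinP; exact: measurable_gaussian.
  by rewrite diracE mem_set//= mul1e rdot0 mulr0 oppr0 expR0 expr0.
have mg : measurable_fun setT (fun x : Rn n => (expR (- (a * rdot x x)))%:E).
  by apply/measurable_EFinP; exact: measurable_gaussian.
have mg1 : measurable_fun setT (fun x : R => (expR (- (a * (x * x))))%:E).
  apply/measurable_EFinP; apply: measurableT_comp => //.
  by apply: measurableT_comp => //; do 2 apply: measurable_funM => //.
rewrite ge0_integral_lebesgue_nS; last 2 first.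
- by apply/measurable_EFinP; exact: measurable_gaussian.
- by move=> x; rewrite lee_fin expR_ge0.
transitivity (\int[leb]_x0 ((expR (- (a * (x0 * x0))))%:E *
    (Num.sqrt (pi / a) ^+ n)%:E))%E.
  apply: eq_integral => x0 _; rewrite -IH -ge0_integralZl//=.
  by apply: eq_integral => x _; rewrite rdot_tcons mulrDr opprD expRD EFinM.
rewrite ge0_integralZr//.
by rewrite integral_gaussian1// -EFinM exprS.
Qed.

Lemma integrable_gaussian n (a : R) : 0 < a ->
  (lebesgue_n R n).-integrable setT (EFin \o (fun x => expR (- (a * rdot x x)))).
Proof.
move=> a0; apply/integrableP; split.
  by apply/measurable_EFinP; exact: measurable_gaussian.
under eq_integral do rewrite gee0_abs ?lee_fin ?expR_ge0//.
by rewrite integral_gaussian// ltry.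
Qed.

Lemma integral_gaussian2 n (a : R) : 0 < a ->
  (\int[leb2 n]_p (expR (- (a * (rdot p.1 p.1 + rdot p.2 p.2))))%:E
   = ((pi / a) ^+ n)%:E)%E.
Proof.
move=> a0.
have mg : measurable_fun setT (fun x : Rn n => (expR (- (a * rdot x x)))%:E).
  by apply/measurable_EFinP; exact: measurable_gaussian.
rewrite fubini_tonelli1; last 2 first.
- apply/measurable_EFinP; apply: measurableT_comp => //; apply: measurableT_comp => //.
  by apply: measurable_funM => //; apply: measurable_funD; apply: measurable_rdot.
- by move=> p; rewrite lee_fin expR_ge0.
transitivity (\int[lebesgue_n R n]_x ((expR (- (a * rdot x x)))%:E *
    (Num.sqrt (pi / a) ^+ n)%:E))%E.
  apply: eq_integral => x _; rewrite -integral_gaussian// -ge0_integralZl//=.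
  by apply: eq_integral => y _; rewrite mulrDr opprD expRD EFinM.
rewrite ge0_integralZr// integral_gaussian// -EFinM -exprMn -expr2 sqr_sqrtr//.
by rewrite divr_ge0 ?pi_ge0// ltW.
Qed.

Lemma integrable_gaussian2 n (a : R) : 0 < a ->
  (leb2 n).-integrable setT
    (EFin \o (fun p => expR (- (a * (rdot p.1 p.1 + rdot p.2 p.2))))).
Proof.
move=> a0; apply/integrableP; split.
  apply/measurable_EFinP; apply: measurableT_comp => //; apply: measurableT_comp => //.
  by apply: measurable_funM => //; apply: measurable_funD; apply: measurable_rdot.
under eq_integral do rewrite gee0_abs ?lee_fin ?expR_ge0//.
by rewrite integral_gaussian2// ltry.
Qed.

Lemma complex_vec_rot2 n (t : R) (p : Rn n * Rn n) :
  complex_vec (rot2 (cos t) (sin t) p) = cexp (0 +i* t) *: complex_vec p.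
Proof.
apply/rowP => j; rewrite !mxE /= !tnth_mktuple /cexp !ReImE expR0.
by apply: complex_ext; rewrite !ReImE/=; ring.
Qed.

Lemma rdot_rot2 n (t : R) (p : Rn n * Rn n) :
  rdot (rot2 (cos t) (sin t) p).1 (rot2 (cos t) (sin t) p).1 +
  rdot (rot2 (cos t) (sin t) p).2 (rot2 (cos t) (sin t) p).2 =
  rdot p.1 p.1 + rdot p.2 p.2.
Proof.
rewrite -!sum_sqr_normc complex_vec_rot2; apply: eq_bigr => j _.
by rewrite mxE normcM normc_cexp Re_mk expR0 mul1r.
Qed.

(* Average over the rotations v |-> e^(it) v, which preserve the measure and the
   weight, and use the mean value property of zeta |-> G (zeta v) on the circle. *)
Lemma gaussian_mean_value n (a : R) (G : Cn n -> R[i]) : 0 < a ->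
  (forall v, cdiff (fun w => G (w *: v))) ->
  let f := fun p => G (complex_vec p) *
    (expR (- (a * (rdot p.1 p.1 + rdot p.2 p.2))))%:C in
  cintegrable (leb2 n) f ->
  cintegral (leb2 n) f = ((pi / a) ^+ n)%:C * G 0.
Proof.
move=> a0 dG f fi.
pose rt (q : R * (Rn n * Rn n)) := rot2 (cos q.1) (sin q.1) q.2.
have mrt : measurable_fun setT rt.
  have -> : rt = (fun q => rot2 q.1.1 q.1.2 q.2) \o (fun q => ((cos q.1, sin q.1), q.2)).
    by [].
  apply: measurableT_comp; first exact: measurable_rot2.
  apply: measurable_fun_pair => //; apply: measurable_fun_pair.
  - by apply: measurableT_comp => //; apply: continuous_measurable_fun; exact: continuous_cos.
  - by apply: measurableT_comp => //; apply: continuous_measurable_fun; exact: continuous_sin.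
pose F (q : R * (Rn n * Rn n)) := (\1_(`[0, pi *+ 2]) q.1)%:C * f (rt q).
have mf : cmeasurable f by exact: cintegrable_cmeasurable fi.
have mind : measurable_fun setT (\1_(`[0, pi *+ 2]) : R -> R) by exact: measurable_indic.
have mF : cmeasurable F.
  apply: cmeasurableM; last exact: (cmeasurable_comp mrt mf).
  by apply: cmeasurable_real; exact: (measurableT_comp mind measurable_fst).
have p1 : 0 < pi *+ 2 :> R by rewrite mulrn_wgt0// pi_gt0.
have tr (t : R) := transports_rot2 n (cos2Dsin2 t).
have p0 : 0 <= pi *+ 2 :> R by rewrite mulrn_wge0// pi_ge0.
have ind_int0 : (\int[leb]_t ((\1_(`[0, pi *+ 2]) t : R)%:E) = (pi *+ 2)%:E)%E.
  by rewrite integral_indic//= setIT lebesgue_measure_itv/= lte_fin p1 -EFinB subr0.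
have inner t : cintegral (leb2 n) (fun p => F (t, p)) =
    cintegral (leb2 n) f * (\1_(`[0, pi *+ 2]) t)%:C.
  rewrite /F/= cintegralZ; last exact: (transports_cintegrable (tr t) fi).
  by rewrite (transports_cintegral (tr t) fi) mul1r mulrC.
have Fi : cintegrable (leb \x sfprod (lebesgue_n R n) (lebesgue_n R n))%E F.
  apply: cintegrable_prod => //.
  have nfi : (0 <= \int[leb2 n]_p (normc (f p))%:E)%E.
    by apply: integral_ge0 => p _; rewrite lee_fin normc_ge0.
  have [_ nfy] := (cintegrableP _ _).1 fi.
  have E (t : R) : (\int[sfprod (lebesgue_n R n) (lebesgue_n R n)]_p
      (normc (F (t, p)))%:E = (\1_(`[0, pi *+ 2]) t)%:E *
      \int[leb2 n]_p (normc (f p))%:E)%E.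
    rewrite /F/=.
    have [_ /(_ (fun p => (normc (f p))%:E))] := tr t.
    rewrite mul1e => <-; last 2 first.
    - by apply/measurable_EFinP; exact: measurable_normc.
    - by move=> p; rewrite lee_fin normc_ge0.
    rewrite -ge0_integralZl//=.
    - apply: eq_integral => p _; rewrite normcM EFinM normcr ger0_norm//.
    - apply/measurable_EFinP; apply: measurable_normc.
      exact: (cmeasurable_comp (tr t).1 mf).
    - by move=> p _; rewrite lee_fin normc_ge0.
  under eq_integral do rewrite E.
  have /fineK <- : (\int[leb2 n]_p (normc (f p))%:E)%E \is a fin_num.
    by rewrite ge0_fin_numE.
  rewrite ge0_integralZr//.
  - by rewrite [X in (X * _)%E](_ : _ = (pi *+ 2)%:E) -?EFinM ?ltry//.
  - by apply/measurable_EFinP; exact: mind.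
  - by rewrite lee_fin fine_ge0.
have ind_int : \int[leb]_t (\1_(`[0, pi *+ 2]) t : R) = pi *+ 2.
  by rewrite /Rintegral ind_int0.
have H1 : cintegral leb (fun t => cintegral (sfprod (lebesgue_n R n) (lebesgue_n R n))
    (fun p => F (t, p))) = cintegral (leb2 n) f * (pi *+ 2)%:C.
  transitivity (cintegral leb (fun t : R =>
      cintegral (leb2 n) f * (\1_(`[0, pi *+ 2]) t)%:C)).
    by apply: eq_cintegral => t; exact: inner.
  rewrite cintegralZ; first by rewrite cintegral_real ind_int.
  apply: cintegrable_real; apply/integrableP; split; first exact/measurable_EFinP.
  under eq_integral do rewrite gee0_abs ?lee_fin//.
  by rewrite ind_int0 ltry.
have H2 : cintegral (sfprod (lebesgue_n R n) (lebesgue_n R n))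
    (fun p => cintegral leb (fun t => F (t, p))) =
    (pi *+ 2)%:C * (((pi / a) ^+ n)%:C * G 0).
  rewrite (eq_cintegral _ (g := fun p => (pi *+ 2)%:C * G 0 *
      (expR (- (a * (rdot p.1 p.1 + rdot p.2 p.2))))%:C)).
    have gi := cintegrable_real (@integrable_gaussian2 n a a0).
    rewrite cintegralZ// cintegral_real /Rintegral integral_gaussian2//=.
    by ring.
  move=> p; set c := (expR _)%:C.
  have dg : cdiff (fun w => G (w *: complex_vec p) * c).
    have dc : cdiff (fun w : R[i] => c + 0 * w) by exact: cdiff_affine.
    rewrite (_ : (fun w => _) = fun w => G (w *: complex_vec p) * (c + 0 * w)).
      exact: cdiffM.
    by apply/funext => w; rewrite mul0r addr0.
  have := circle_mean dg; rewrite scale0r mulrA => <-.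
  by apply: eq_cintegral => t; rewrite /F /f /rt/= complex_vec_rot2 rdot_rot2.
have := cfubini Fi; rewrite H1 H2 mulrC => /mulfI; apply.
by rewrite fmorph_eq0 gt_eqF.
Qed.

Definition fourier_kernel n (x : Rn n) (z : Cn n) : R[i] :=
  cexp ((- (2 * rdot x x))%:C + 2 * 'i%C * dotc (real_vec x) z).

Lemma cintegral_transports1 d (T : measurableType d) (mu : {measure set T -> \bar R})
    (h : T -> T) f : transports mu mu 1 h -> cintegrable mu f ->
  cintegral mu (fun x => f (h x)) = cintegral mu f.
Proof.
by move=> th fi; have := transports_cintegral th fi; rewrite mul1r.
Qed.

Lemma transports_shift n (h : Rn n) :
  transports (lebesgue_n R n) (lebesgue_n R n) 1 (taff 1 h).
Proof. by have := transports_taff h (@ltr01 R); rewrite invr1 expr1n. Qed.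

Lemma transports_shift2 n (h : Rn n * Rn n) :
  transports (leb2 n) (leb2 n) 1 (fun p => (taff 1 h.1 p.1, taff 1 h.2 p.2)).
Proof.
by have := transports_prod ler01 ler01 (transports_shift h.1) (transports_shift h.2);
  rewrite mulr1.
Qed.

Lemma cmeasurable_complex_dotc n d (T : measurableType d) (f g : T -> Rn n * Rn n) :
  measurable_fun setT f -> measurable_fun setT g ->
  cmeasurable (fun t => dotc (complex_vec (f t)) (complex_vec (g t))).
Proof.
move=> mf mg.
have f1 := measurableT_comp measurable_fst mf.
have f2 := measurableT_comp measurable_snd mf.
have g1 := measurableT_comp measurable_fst mg.
have g2 := measurableT_comp measurable_snd mg.
split.
- under eq_fun do rewrite Re_dotc.
  by apply: measurable_funB; apply: measurable_rdot.
- under eq_fun do rewrite Im_dotc.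
  by apply: measurable_funD; apply: measurable_rdot.
Qed.

(* Real shifts give the integral of exp (-2 x.x - 2 x.eta); the oscillating
   factor comes from the mean value property of v |-> exp (b.v), whose Gaussian
   integral factors into a real exponential and an oscillating integral. *)
Lemma gaussian_oscillation n (b : Rn n) :
  cintegrable (lebesgue_n R n) (fun y => cexp ((- (2 * rdot y y)) +i* rdot b y)) /\
  cintegral (lebesgue_n R n) (fun y => cexp ((- (2 * rdot y y)) +i* rdot b y)) =
  (Num.sqrt (pi / 2) ^+ n * expR (- (rdot b b / 8)))%:C.
Proof.
have mg : cmeasurable (fun y : Rn n => cexp ((- (2 * rdot y y)) +i* rdot b y)).
  apply: cmeasurable_cexp; split => /=.
  - by apply: measurableT_comp => //; apply: measurable_funM => //; exact: measurable_rdot.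
  - exact: measurable_rdot.
have gi0 : cintegrable (lebesgue_n R n) (fun y => cexp ((- (2 * rdot y y)) +i* rdot b y)).
  apply: (cintegrable_le mg (@integrable_gaussian n 2 (ltr0Sn R 1))) => y.
  by rewrite normc_cexp.
split => //.
have s20 : 0 < (2 : R) by [].
pose e (x : Rn n) : R[i] := (expR (- (2 * rdot x x) + rdot b x))%:C.
(* Completing the square: [- 2 x.x + b.x = - 2 |x - b/4|^2 + b.b / 8]. *)
pose h := taff (- 4^-1) (tzero n) b.
have eE : e = fun x => (expR (rdot b b / 8))%:C *
    (expR (- (2 * rdot (taff 1 h x) (taff 1 h x))))%:C.
  apply/funext => x; rewrite /e -rmorphM/= -expRD; congr ((expR _)%:C).
  by rewrite /h !rdotE (rdotC x b); field.
have gi := cintegrable_real (@integrable_gaussian n 2 s20).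
have gih := transports_cintegrable (transports_shift h) gi.
have ei : cintegrable (lebesgue_n R n) e by rewrite eE; exact: cintegrableZ.
have eI : cintegral (lebesgue_n R n) e =
    (Num.sqrt (pi / 2) ^+ n * expR (rdot b b / 8))%:C.
  rewrite eE cintegralZ// (cintegral_transports1 (transports_shift h) gi).
  by rewrite cintegral_real /Rintegral integral_gaussian// -rmorphM mulrC.
have [fi fI] := cintegral_tensor ei (g := fun y => cexp ((- (2 * rdot y y)) +i* rdot b y)) gi0.
pose G (v : Cn n) := cexp (dotc (complex_vec (b, tzero n)) v).
have dG v : cdiff (fun w => G (w *: v)).
  have := cdiff_comp (cdiff_affine 0 (dotc (complex_vec (b, tzero n)) v)) (@cdiff_cexp R).
  rewrite (_ : _ \o _ = fun w => G (w *: v))//; apply/funext => w /=.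
  rewrite /G add0r /dotc mulr_suml; congr cexp; apply: eq_bigr => j _.
  by rewrite [(w *: v) _ _]mxE mulrA mulrAC.
have fE p : e p.1 * cexp ((- (2 * rdot p.2 p.2)) +i* rdot b p.2) =
    G (complex_vec p) * (expR (- (2 * (rdot p.1 p.1 + rdot p.2 p.2))))%:C.
  rewrite /e /G -!cexpr -!cexpD; congr cexp; apply: complex_ext.
    by rewrite !ReImE Re_dotc/= rdotE; ring.
  by rewrite !ReImE Im_dotc/= rdotE; ring.
rewrite (funext fE) in fi fI.
have := gaussian_mean_value s20 dG fi; rewrite fI eI.
rewrite [G 0](_ : _ = 1) ?mulr1; last first.
  by rewrite /G /dotc big1 ?cexp0// => j _; rewrite [X in _ * X]mxE mulr0.
have -> : (pi / 2) ^+ n = Num.sqrt (pi / 2) ^+ n * expR (rdot b b / 8) *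
    (Num.sqrt (pi / 2) ^+ n * expR (- (rdot b b / 8))) :> R.
  rewrite mulrACA -exprMn -expr2 sqr_sqrtr ?divr_ge0 ?pi_ge0//.
  by rewrite -expRD subrr expR0 mulr1.
rewrite [in RHS]rmorphM/= => /mulfI; apply.
by rewrite fmorph_eq0 gt_eqF// mulr_gt0 ?expR_gt0// exprn_gt0// sqrtr_gt0 divr_gt0 ?pi_gt0.
Qed.

(** For [z = xi + i eta] the real translation by [eta / 2] absorbs the imaginary part of [z]. The
    real part remains as an oscillation of frequency [2 xi]. *)
Lemma cexp_gaussian_integral n (z : Cn n) :
  cintegrable (lebesgue_n R n) (fun x => fourier_kernel x z) /\
  cintegral (lebesgue_n R n) (fun x => fourier_kernel x z) =
  (Num.sqrt (pi / 2) ^+ n)%:C * cexp (- (dotc z z / 2)).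
Proof.
rewrite -(vec_pairK z); case: (vec_pair z) => xi eta {z}.
pose h := taff 2^-1 (tzero n) eta.
pose b := taff 2 (tzero n) xi.
have [oi oI] := gaussian_oscillation b.
have kE : (fun x => fourier_kernel x (complex_vec (xi, eta))) = fun x =>
    cexp ((rdot eta eta / 2) +i* (- rdot xi eta)) *
    cexp ((- (2 * rdot (taff 1 h x) (taff 1 h x))) +i* rdot b (taff 1 h x)).
  apply/funext => x; rewrite /fourier_kernel -cexpD; congr cexp.
  rewrite real_vecE; apply: complex_ext.
  - by rewrite !ReImE Re_dotc Im_dotc/= /h /b !rdotE (rdotC x eta); field.
  - by rewrite !ReImE Re_dotc Im_dotc/= /h /b !rdotE (rdotC x xi); field.
have ohi := transports_cintegrable (transports_shift h) oi.
rewrite kE; split; first exact: cintegrableZ.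
rewrite cintegralZ// (cintegral_transports1 (transports_shift h) oi) oI.
rewrite rmorphM/= mulrCA; congr (_ * _); rewrite -cexpr -cexpD; congr cexp.
apply: complex_ext.
- by rewrite !ReImE Re_dotc Im_dotc/= /b !rdotE; field.
- by rewrite !ReImE Re_dotc Im_dotc/= (rdotC eta xi); field.
Qed.

(** Expanding [|z + v|^2], the antiholomorphic term [z.(conj v)] cancels against the exponential.
    What is left besides the Gaussian is holomorphic in [v]. *)
Lemma gauss_density_shift n (z v : Cn n) :
  cexp (dotc z (conj_vec (z + v))) * (gauss_density (z + v))%:C =
  cexp (- dotc v (conj_vec z)) * (gauss_density v)%:C.
Proof.
rewrite /gauss_density !rmorphM/= [LHS]mulrCA [RHS]mulrCA; congr (_ * _).
rewrite -!cexpr -!cexpD; congr cexp.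
have sqE (w : Cn n) : (- \sum_(j < n) normc (w 0 j) ^+ 2)%:C = - dotc w (conj_vec w).
  rewrite rmorphN rmorph_sum; congr (- _); apply: eq_bigr => j _.
  by rewrite mxE mulcJ.
rewrite !sqE /dotc -!sumrN -!big_split/=; apply: eq_bigr => j _.
rewrite !mxE conjcD; ring.
Qed.

(** Recentred at [z], the integrand is a function holomorphic along complex lines through 0 times a
    centred Gaussian. The Gaussian mean value formula returns its value at 0, which is [F z]. *)
Lemma reproducing n (F : Cn n -> R[i]) (z : Cn n) :
  (forall v, cdiff (fun w => F (z + w *: v))) ->
  gauss_integrable (fun w => F w * cexp (dotc z (conj_vec w))) ->
  gauss_integral (fun w => F w * cexp (dotc z (conj_vec w))) = F z.
Proof.
move=> dF; rewrite /gauss_integrable /gauss_integral /lebesgue_C.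
set f := (fun p => _) => fi.
pose G v := F (z + v) * cexp (- dotc v (conj_vec z)) * (pi ^- n)%:C.
have dG v : cdiff (fun w => G (w *: v)).
  apply: cdiffM; first apply: cdiffM => //.
    have := cdiff_comp (cdiff_affine 0 (- dotc v (conj_vec z))) (@cdiff_cexp R).
    rewrite (_ : _ \o _ = fun w => cexp (- dotc (w *: v) (conj_vec z)))//.
    apply/funext => w /=; rewrite add0r mulNr /dotc mulr_suml.
    congr (cexp (- _)); apply: eq_bigr => j _.
    by rewrite [(w *: v) _ _]mxE mulrC mulrA.
  rewrite (_ : (fun=> _) = fun w : R[i] => (pi ^- n)%:C + 0 * w).
    exact: cdiff_affine.
  by apply/funext => w; rewrite mul0r addr0.
pose sh p := (taff 1 (vec_pair z).1 p.1, taff 1 (vec_pair z).2 p.2).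
have tsh : transports (leb2 n) (leb2 n) 1 sh by exact: transports_shift2.
have fE p : f (sh p) = G (complex_vec p) *
    (expR (- (1 * (rdot p.1 p.1 + rdot p.2 p.2))))%:C.
  have e : complex_vec (sh p) = z + complex_vec p by rewrite -complex_vecD vec_pairK.
  rewrite /f e /G -mulrA gauss_density_shift -!mulrA.
  by rewrite gauss_densityE rmorphM/= mul1r.
have Gi := transports_cintegrable tsh fi.
rewrite (funext fE : f \o sh = _) in Gi.
rewrite -(cintegral_transports1 tsh fi) (funext fE).
rewrite (gaussian_mean_value ltr01 dG Gi) /G addr0 divr1.
rewrite [dotc 0 _](_ : _ = 0) ?oppr0 ?cexp0 ?mulr1; last first.
  by rewrite /dotc big1// => j _; rewrite [X in X * _]mxE mul0r.
by rewrite mulrCA -rmorphM/= divff ?mulr1// gt_eqF// exprn_gt0// pi_gt0.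
Qed.

End gaussian.

(** * Continuity of translations in L^1 *)

Section dominated_ae.
Context d (T : measurableType d) (R : realType).
Variable mu : {measure set T -> \bar R}.

Lemma integral_dominated0_ae (h_ : nat -> T -> \bar R) (g : T -> \bar R) :
  (forall n, measurable_fun setT (h_ n)) ->
  (forall n x, 0 <= h_ n x)%E ->
  {ae mu, forall x, h_ n x @[n --> \oo] --> 0%E} ->
  mu.-integrable setT g -> (forall n x, h_ n x <= g x)%E ->
  (\int[mu]_x h_ n x @[n --> \oo] --> 0)%E.
Proof.
move=> mh h0 hcvg ig hg.
have := @dominated_convergence _ _ _ mu setT measurableT h_ (cst 0%E) g.
case.
- by [].
- exact: measurable_cst.
- by apply: filterS hcvg => x + _.
- exact: ig.
- by apply: aeW => x n _; rewrite gee0_abs.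
- by move=> _ _; rewrite integral0.
Qed.

End dominated_ae.

Section ereal_cvg0.
Variable R : realType.
Implicit Type u : nat -> \bar R.

Lemma ge0_cvge0P u : (forall k, 0 <= u k)%E ->
  u @ \oo --> 0%E <-> forall e : R, 0 < e -> \forall k \near \oo, (u k <= e%:E)%E.
Proof.
move=> u0; split => [/fine_cvgP[uf uc] e e0|H].
  near=> k; have ukf : u k \is a fin_num by near: k.
  rewrite -(fineK ukf) lee_fin; near: k.
  exact: (cvgr_le _ uc e e0).
apply/fine_cvgP; split.
  near=> k; rewrite ge0_fin_numE//; apply: (@le_lt_trans _ _ 1%:E); last exact: ltry.
  by near: k; exact: H.
apply/cvgr0Pnorm_le => e e0; near=> k.
have uke : (u k <= e%:E)%E by near: k; exact: H.
have ukf : u k \is a fin_num by rewrite ge0_fin_numE// (le_lt_trans uke)// ltry.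
by rewrite ger0_norm ?fine_ge0//= -lee_fin fineK.
Unshelve. all: by end_near. Qed.

End ereal_cvg0.

Section shift_continuity.
Variable R : realType.
Notation leb := (@lebesgue_measure R).
Notation Rn n := (n.-tuple (measurableTypeR R)).

Lemma transports_shift1 (a : R) :
  transports leb leb 1 (fun x : measurableTypeR R => (a + 1 * x : R)).
Proof. by have := transports_affine a (@ltr01 R); rewrite invr1. Qed.

Lemma ge0_integral_shift1 (a : R) (f : R -> R) : measurable_fun setT f ->
  (forall x, 0 <= f x) ->
  (\int[leb]_x (f (a + 1 * x))%:E = \int[leb]_x (f x)%:E)%E.
Proof.
move=> mf f0; have [_ /(_ (EFin \o f))] := transports_shift1 a.
by rewrite mul1e => <- //; exact/measurable_EFinP.
Qed.

Lemma measurable_shift1 (a : R) (f : R -> R) : measurable_fun setT f ->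
  measurable_fun setT (fun x : R => f (a + 1 * x)).
Proof.
move=> mf; apply: (measurableT_comp mf).
by apply: measurable_funD => //; apply: measurable_funM.
Qed.

(** The [L^1] distance from [f] to its translate by [a]. The factor [1 *] matches the coordinates of
    [taff 1]. *)
Definition osc1 (f : R -> R) (a : R) : \bar R :=
  (\int[leb]_x (`|f (a + 1 * x) - f x|)%:E)%E.

(** Since translation preserves the integral, [f - g] and its translate cost the same amount, hence
    the factor 2. *)
Lemma osc1_le (f g : R -> R) a : measurable_fun setT f -> measurable_fun setT g ->
  (osc1 f a <= osc1 g a + 2%:E * \int[leb]_x (`|f x - g x|)%:E)%E.
Proof.
move=> mf mg; rewrite /osc1.
have md : measurable_fun setT (fun x : R => `|f x - g x|).
  by apply: measurableT_comp => //; exact: measurable_funB.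
have -> : (2%:E * \int[leb]_x (`|f x - g x|)%:E = \int[leb]_x (`|f (a + 1 * x) - g (a + 1 * x)|)%:E +
    \int[leb]_x (`|f x - g x|)%:E)%E.
  rewrite (@ge0_integral_shift1 a (fun x => `|f x - g x|))//.
  by rewrite -[X in X%:E](_ : 1 + 1 = 2)// EFinD ge0_muleDl ?lee_fin// mul1e.
have m1 : measurable_fun setT (fun x : R => (`|f (a + 1 * x) - g (a + 1 * x)|)%:E).
  by apply/measurable_EFinP; have := measurable_shift1 a md.
have m2 : measurable_fun setT (fun x : R => (`|f x - g x|)%:E) by exact/measurable_EFinP.
rewrite -[X in (_ + X)%E](ge0_integralD leb measurableT _ m1 _ m2)//.
have mga : measurable_fun setT (fun x : R => `|g (a + 1 * x) - g x|).
  by apply: measurableT_comp => //; apply: measurable_funB => //; exact: measurable_shift1.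
have mda : measurable_fun setT (fun x : R => (`|f (a + 1 * x) - g (a + 1 * x)|%:E + `|f x - g x|%:E)%E).
  by have := emeasurable_funD m1 m2.
have /measurable_EFinP mga' := mga.
rewrite -(ge0_integralD leb measurableT _ mga' _ mda); last 2 first.
- by move=> x _; rewrite lee_fin.
- by move=> x _; rewrite adde_ge0// lee_fin.
apply: ge0_le_integral => //.
- apply/measurable_EFinP; apply: measurableT_comp => //; apply: measurable_funB => //.
  exact: measurable_shift1.
- by have := emeasurable_funD mga' mda.
- move=> x _; rewrite -!EFinD lee_fin.
  rewrite (_ : f _ - f x = (g (a + 1 * x) - g x) + ((f (a + 1 * x) - g (a + 1 * x)) - (f x - g x))).
    rewrite (le_trans (ler_normD _ _))// lerD2l (le_trans (ler_normB _ _))//.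
  by ring.
Qed.

(** Dominated convergence: the cut-off function is bounded and continuous except at [M] and [- M],
    and all the differences vanish outside [[- M - |v|, M + |v|]]. *)
Lemma osc1_continuous_cvg (g : R -> R) (M v : R) : continuous g ->
  osc1 (fun x => g x * \1_(`[- M, M]) x) (k.+1%:R^-1 * v) @[k --> \oo] --> 0%E.
Proof.
move=> cg; have mg : measurable_fun setT g by exact: continuous_measurable_fun.
have mI : measurable_fun setT (\1_(`[- M, M]) : R -> R) by exact: measurable_indic.
have mG : measurable_fun setT (fun x => g x * \1_(`[- M, M]) x).
  by apply: measurable_funM.
have h0 : (k.+1%:R^-1 * v : R) @[k --> \oo] --> (0 : R).
  rewrite -(mul0r v); apply: cvgMr_tmp; exact: cvg_harmonic.
pose G x := g x * \1_(`[- M, M]) x.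
have [C C0 gC] : exists2 C, 0 <= C & forall x, `|G x| <= C.
  have cg' : {within `[- M, M], continuous g} by exact: continuous_subspaceT.
  have /compact_bounded[N [_ HN]] := continuous_compact cg' (@segment_compact R (- M) M).
  have HN1 := HN (`|N| + 1).
  exists (`|N| + 1) => [|x]; first by rewrite addr_ge0.
  rewrite /G indicE; case: (boolP (x \in _)) => [xM|_]; last first.
    by rewrite mulr0 normr0 addr_ge0.
  rewrite mulr1; apply: HN1; first by rewrite ltr_pwDr// ler_norm.
  by exists x => //; rewrite inE in xM.
have Gcont x : x != M -> x != - M -> {for x, continuous G}.
  move=> xM xNM.
  have H (b : R) : (\forall y \near x, \1_(`[- M, M]) y = b) -> {for x, continuous G}.
    move=> nb; have nb0 : \1_(`[- M, M]) x = b by exact: nbhs_singleton nb.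
    apply: (@cvg_trans _ ((fun y => g y * b) @ x)).
      by apply: near_eq_cvg; apply: filterS nb => y yb; rewrite /G yb.
    rewrite (_ : G x = g x * b); last by rewrite /G nb0.
    exact: (@cvgM _ _ (nbhs x) _ g (cst b) _ _ (cg x) (cvg_cst b)).
  have [xltM|xgeM] := ltP x M; last first.
    have xgtM : M < x by rewrite lt_neqAle eq_sym xM.
    apply: (H 0); near=> y; rewrite indicE memNset//= in_itv/=; apply/negP.
    rewrite negb_and -!ltNge; apply/orP; right; near: y; exact: lt_nbhsr.
  have [xltNM|xgeNM] := ltP x (- M).
    apply: (H 0); near=> y; rewrite indicE memNset//= in_itv/=; apply/negP.
    rewrite negb_and -!ltNge; apply/orP; left; near: y; exact: lt_nbhsl.
  have xgtNM : - M < x by rewrite lt_neqAle eq_sym xNM.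
  apply: (H 1); near=> y; rewrite indicE mem_set//= in_itv/=; apply/andP; split; apply: ltW.
    by near: y; exact: lt_nbhsr.
  by near: y; exact: lt_nbhsl.
pose A := `[- M - `|v|, M + `|v|]%classic.
have Gsupp (k : nat) x : (`|G (k.+1%:R^-1 * v + 1 * x) - G x| <= 2 * C * \1_A x).
  have [xA|xA] := boolP (x \in A).
    rewrite indicE xA mulr1 (le_trans (ler_normB _ _))// mulr2n mulrDl !mul1r.
    by rewrite lerD.
  have xM y : `|y - x| <= `|v| -> G y = 0.
    move=> yx; rewrite /G indicE memNset ?mulr0//= in_itv/= => /andP[y1 y2].
    move: xA; rewrite notin_setE => /=; apply; rewrite /A/= in_itv/=.
    by move: yx; rewrite ler_norml => /andP[h1 h2]; apply/andP; split; lra.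
  rewrite [G x]xM ?subrr ?normr0// [G _]xM ?subrr ?normr0.
    by rewrite indicE (negbTE xA) mulr0.
  rewrite mul1r addrK normrM ler_piMl// ger0_norm ?invr_ge0// invf_le1//.
  by rewrite ler1n.
apply: (@integral_dominated0_ae _ _ _ leb (fun k x => (`|G (k.+1%:R^-1 * v + 1 * x) - G x|)%:E)
  (fun x => (2 * C * \1_A x)%:E)).
- move=> k; apply/measurable_EFinP; apply: measurableT_comp => //.
  by apply: measurable_funB => //; exact: measurable_shift1.
- by [].
- exists [set M; - M]; split => //.
    - by apply: measurableU; exact: measurable_set1.
    - by apply: countable_lebesgue_measure0; apply: finite_set_countable; exact: finite_set2.
  move=> x /= nc; apply: contrapT => /not_orP[xM xNM]; apply: nc.
  have Gc := Gcont x (introN eqP xM) (introN eqP xNM).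
  apply: cvg_EFin; first exact: nearW.
  rewrite -(normr0 R) -(subrr (G x)); apply: cvg_norm; apply: cvgB; last exact: cvg_cst.
  apply: (@cvg_comp _ _ _ (fun k : nat => k.+1%:R^-1 * v + 1 * x) G _ (nbhs x) _ _ Gc).
  have := cvgD h0 (cvg_cst (1 * x : R)); rewrite add0r => c0.
  by move: c0 => /(_ _ _); rewrite {2}mul1r; exact.
- under eq_fun do rewrite EFinM.
  apply: integrableZl => //; apply/integrableP; split.
    have mA : measurable_fun setT (\1_(`[- M - `|v|, M + `|v|]) : R -> R) by exact: measurable_indic.
    by have /measurable_EFinP := mA.
  under eq_integral do rewrite gee0_abs ?lee_fin//.
  rewrite /A integral_indic//= setIT lebesgue_measure_itv/=.
  by case: ifP => _; rewrite ?ltry// -EFinB ltry.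
- by move=> k x; rewrite lee_fin.
Unshelve. all: by end_near. Qed.

(** Cutting [f] off to [[- M, M]] and then replacing it by a continuous function costs [e / 8] each.
    The comparison of oscillations doubles this to [e / 2], and the continuous case supplies the
    other half. *)
Lemma osc1_cvg (f : R -> R) (v : R) : leb.-integrable setT (EFin \o f) ->
  osc1 f (k.+1%:R^-1 * v) @[k --> \oo] --> 0%E.
Proof.
move=> fi; have mf : measurable_fun setT f by by move: fi => /measurable_int/measurable_EFinP.
have mI (M : R) : measurable_fun setT (\1_(`[- M, M]) : R -> R) by exact: measurable_indic.
apply/ge0_cvge0P => [k|e e0]; first exact: integral_ge0.
have [M HM] : exists M : R, (\int[leb]_x (`|f x - f x * \1_(`[- M, M]) x|)%:E <= (e / 8)%:E)%E.
  have : (\int[leb]_x (`|f x - f x * \1_(`[- k%:R, k%:R]) x|)%:E @[k --> \oo] --> 0)%E.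
    apply: (@integral_dominated0_ae _ _ _ leb _ (EFin \o (fun x => `|f x|))).
    - move=> k; apply/measurable_EFinP; apply: measurableT_comp => //.
      by apply: measurable_funB => //; exact: measurable_funM.
    - by [].
    - apply: aeW => x; apply: cvg_near_cst; near=> k.
      rewrite indicE mem_set ?mulr1 ?subrr ?normr0//= in_itv/= -ler_norml.
      by near: k; exact: nbhs_infty_ger.
    - by have := integrable_abse fi.
    - move=> k x; rewrite lee_fin -{1}(mulr1 (f x)) -mulrBr normrM ler_piMr//.
      by rewrite indicE; case: (_ \in _); rewrite ?subrr ?subr0 ?normr0 ?normr1.
  move/ge0_cvge0P => /(_ (fun=> integral_ge0 _ _)) H.
  have /H[] : 0 < e / 8 by rewrite divr_gt0.
    by move=> *; rewrite lee_fin.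
  by move=> N _ /(_ N (leqnn N)) HN; exists N%:R.
have [g cg Hg] : exists2 g : R -> R, continuous g &
   (\int[leb]_x (`|f x * \1_(`[- M, M]) x - g x * \1_(`[- M, M]) x|)%:E <= (e / 8)%:E)%E.
  have [//|||g_ [cg_ _]] := @approximation_continuous_integrable R `[- M, M] f.
  - have /= := @lebesgue_measure_itv R `[- M, M]; rewrite /leb => ->.
    by case: ifP => _; rewrite ?ltry// -EFinB ltry.
  - exact: integrableS fi.
  move/ge0_cvge0P => /(_ (fun=> integral_ge0 _ _)) H.
  have /H[] : 0 < e / 8 by rewrite divr_gt0.
    by move=> *; rewrite abse_ge0.
  move=> N _ /(_ N (leqnn N)) HN; exists (g_ N) => //.
  apply: le_trans HN; rewrite [leRHS]integral_mkcond le_eqVlt; apply/orP; left; apply/eqP.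
  apply: eq_integral => x _; rewrite patchE indicE.
  by case: (x \in _); rewrite ?mulr1 ?mulr0 ?subrr ?normr0.
pose G x := g x * \1_(`[- M, M]) x.
have mg : measurable_fun setT g by exact: continuous_measurable_fun.
have mG : measurable_fun setT G by exact: measurable_funM.
have fG : (\int[leb]_x (`|f x - G x|)%:E <= (e / 8)%:E + (e / 8)%:E)%E.
  apply: le_trans (leeD HM Hg); rewrite -ge0_integralD//.
  - apply: ge0_le_integral => //.
    + by apply/measurable_EFinP; apply: measurableT_comp => //; exact: measurable_funB.
    + apply: emeasurable_funD; apply/measurable_EFinP; apply: measurableT_comp => //;
      by apply: measurable_funB => //; exact: measurable_funM.
    + move=> x _; rewrite -EFinD lee_fin (le_trans _ (ler_normD _ _))//.
      by rewrite addrA subrK.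
  - by apply/measurable_EFinP; apply: measurableT_comp => //; apply: measurable_funB => //; exact: measurable_funM.
  - by apply/measurable_EFinP; apply: measurableT_comp => //; apply: measurable_funB => //; exact: measurable_funM.
have /ge0_cvge0P := @osc1_continuous_cvg g M v cg.
move=> /(_ (fun=> integral_ge0 _ _)) H.
have : 0 < e / 2 by rewrite divr_gt0.
move/H; rewrite -/G => {}H; have {}H : \forall k \near \oo, (osc1 G (k.+1%:R^-1 * v) <= (e / 2)%:E)%E.
  by apply: H => *; rewrite lee_fin.
near=> k; apply: le_trans (osc1_le _ mf mG) _.
have -> : e%:E = ((e / 2)%:E + 2%:E * ((e / 8)%:E + (e / 8)%:E))%E.
  rewrite -(EFinD (e/8)) -(EFinM 2) -(EFinD (e/2)); congr EFin; field; by [].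
apply: leeD; first by near: k.
exact: lee_wpmul2l.
Unshelve. all: by end_near. Qed.

End shift_continuity.

Section L1_continuity.
Variable R : realType.

(** Measure-preserving maps whose composition operators tend strongly to the identity of [L^1]. *)
Definition L1_continuous d (T : measurableType d) (mu : {measure set T -> \bar R})
    (tau : nat -> T -> T) :=
  (forall k, transports mu mu 1 (tau k)) /\
  forall g : T -> R, mu.-integrable setT (EFin \o g) ->
    (\int[mu]_x (`|g (tau k x) - g x|)%:E)%E @[k --> \oo] --> 0%E.

Lemma transports1_norm d d' (T : measurableType d) (T' : measurableType d')
    (mu : {measure set T -> \bar R}) (nu : {measure set T' -> \bar R}) (h : T -> T')
    (g : T' -> R) : transports mu nu 1 h -> measurable_fun setT g ->
  (\int[mu]_x (`|g (h x)|)%:E = \int[nu]_x (`|g x|)%:E)%E.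
Proof.
move=> [mh th] mg; rewrite (th (fun x => (`|g x|)%:E)) ?mul1e//.
by apply/measurable_EFinP; exact: measurableT_comp.
Qed.

Lemma transports_L1_le d (T : measurableType d) (mu : {measure set T -> \bar R})
    (h : T -> T) (g : T -> R) : transports mu mu 1 h -> measurable_fun setT g ->
  (\int[mu]_x (`|g (h x) - g x|)%:E <= 2%:E * \int[mu]_x (`|g x|)%:E)%E.
Proof.
move=> trh mg; have [mh _] := trh.
have mag : measurable_fun setT (fun x => (`|g x|)%:E).
  by apply/measurable_EFinP; exact: measurableT_comp.
have magh : measurable_fun setT (fun x => (`|g (h x)|)%:E).
  by apply/measurable_EFinP; do 2 apply: measurableT_comp => //.
rewrite -[2%R]/(1 + 1)%R EFinD ge0_muleDl ?lee_fin// mul1e.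
rewrite -{1}(transports1_norm trh mg).
rewrite -ge0_integralD//; apply: ge0_le_integral => //.
- apply/measurable_EFinP; apply: measurableT_comp => //; apply: measurable_funB => //.
  exact: measurableT_comp.
- exact: emeasurable_funD.
- by move=> x _; rewrite -EFinD lee_fin ler_normB.
Qed.

Section product.
Context d1 d2 (T1 : measurableType d1) (T2 : measurableType d2).
Variables (m1 : {sigma_finite_measure set T1 -> \bar R})
  (m2 : {sigma_finite_measure set T2 -> \bar R}).

(** Almost every slice of an integrable function is integrable, so its difference with the moved
    slice tends to 0 in [L^1]. Twice the norm of the slice dominates these differences in the other
    variable. *)
Lemma L1_continuous_left (tau : nat -> T1 -> T1) :
  L1_continuous m1 tau -> L1_continuous (m1 \x m2)%E (fun k p => (tau k p.1, p.2)).
Proof.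
move=> [trt ctau].
have trp k : transports (m1 \x m2)%E (m1 \x m2)%E 1 (fun p => (tau k p.1, p.2)).
  rewrite -(mulr1 1%R); apply: (transports_prod (g := tau k) (h := id)) => //.
  exact: transports_id.
split=> // g gi; have mg : measurable_fun setT g.
  by move: gi => /measurable_int/measurable_EFinP.
have md k : measurable_fun setT (fun p => (`|g (tau k p.1, p.2) - g p|)%:E).
  apply/measurable_EFinP; apply: measurableT_comp => //; apply: measurable_funB => //.
  by apply: measurableT_comp => //; case: (trp k).
have eqI k : (\int[m1 \x m2]_p (`|g (tau k p.1, p.2) - g p|)%:E =
    \int[m2]_y \int[m1]_x (`|g (tau k x, y) - g (x, y)|)%:E)%E.
  by rewrite fubini_tonelli2// => -[].
under eq_fun do rewrite eqI.
have mag : measurable_fun setT (fun p => (`|g p|)%:E).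
  by apply/measurable_EFinP; exact: measurableT_comp.
apply: (@integral_dominated0_ae _ _ _ m2 _
  (fun y => 2%:E * \int[m1]_x (`|g (x, y)|)%:E)%E).
- by move=> k; exact: (measurable_fun_fubini_tonelli_G _ (md k)).
- by move=> k y; apply: integral_ge0.
- have := ae_integrable2 gi; apply: filterS => y giy; exact: ctau.
- apply: integrableZl => //.
  apply/integrableP; split.
    exact: (measurable_fun_fubini_tonelli_G (fun p => (`|g p|)%:E) mag).
  under eq_integral do rewrite gee0_abs ?integral_ge0//.
  move: gi => /integrableP[_]; by rewrite fubini_tonelli2.
- move=> k y; apply: (transports_L1_le (g := fun x => g (x, y))) => //.
  by apply: measurableT_comp => //; exact: measurable_pair2.
Qed.

End product.

Section product2.
Context d1 d2 (T1 : measurableType d1) (T2 : measurableType d2).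
Variables (m1 : {sigma_finite_measure set T1 -> \bar R})
  (m2 : {sigma_finite_measure set T2 -> \bar R}).

(** Used with the swap of two factors, and with [tcons] to pass from a product to tuples of the next
    length. *)
Lemma L1_continuous_transfer d d' (T : measurableType d) (T' : measurableType d')
    (mu : {measure set T -> \bar R}) (nu : {measure set T' -> \bar R}) (h : T -> T')
    (tau : nat -> T -> T) (sigma : nat -> T' -> T') :
  transports mu nu 1 h -> (forall k, measurable_fun setT (sigma k)) ->
  (forall k x, h (tau k x) = sigma k (h x)) ->
  L1_continuous mu tau -> L1_continuous nu sigma.
Proof.
move=> th msg hs [trt ctau]; have [mh ih] := th.
split=> [k|g gi].
  split=> // f mf f0; have mfs : measurable_fun setT (f \o sigma k).
    exact: measurableT_comp.
  have := ih _ mfs (fun=> f0 _); rewrite mul1e => <-.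
  have := ih _ mf f0; rewrite !mul1e => <-.
  have mfh : measurable_fun setT (f \o h) by exact: measurableT_comp.
  have [_ /(_ _ mfh (fun=> f0 _))] := trt k; rewrite mul1e /= => <-.
  by apply: eq_integral => x _; rewrite /= hs.
have mg : measurable_fun setT g by move: gi => /measurable_int/measurable_EFinP.
have md k : measurable_fun setT (fun p => (`|g (sigma k p) - g p|)%:E).
  apply/measurable_EFinP; apply: measurableT_comp => //; apply: measurable_funB => //.
  exact: measurableT_comp.
have := ctau (g \o h); have eqI k : (\int[mu]_x (`|(g \o h) (tau k x) - (g \o h) x|)%:E =
    \int[nu]_x (`|g (sigma k x) - g x|)%:E)%E.
  rewrite -(transports1_norm (g := fun p => g (sigma k p) - g p) th).
    by apply: eq_integral => x _; rewrite /= hs.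
  by apply: measurable_funB => //; exact: measurableT_comp.
under eq_fun do rewrite eqI; apply; apply/integrableP; split.
  by apply/measurable_EFinP; exact: measurableT_comp.
by move: gi => /integrableP[_]; rewrite -(transports1_norm th mg).
Qed.

(** Triangle inequality through the point moved in its first coordinate only. The difference in the
    second coordinate is then taken at a moved point, but the first motion preserves its
    integral. *)
Lemma L1_continuous_prod (tau : nat -> T1 -> T1) (sigma : nat -> T2 -> T2) :
  L1_continuous m1 tau -> L1_continuous m2 sigma ->
  L1_continuous (m1 \x m2)%E (fun k p => (tau k p.1, sigma k p.2)).
Proof.
move=> ctau csig; have [trt _] := ctau; have [trs _] := csig.
have trp k : transports (m1 \x m2)%E (m1 \x m2)%E 1 (fun p => (tau k p.1, sigma k p.2)).
  by rewrite -(mulr1 1%R); apply: (transports_prod (g := tau k) (h := sigma k)).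
have [tr1 c1] := @L1_continuous_left _ _ _ _ m1 m2 _ ctau.
have [tr2 c2] : L1_continuous (m1 \x m2)%E (fun k p => (p.1, sigma k p.2)).
  apply: (L1_continuous_transfer (transports_swap m2 m1) _ _
    (@L1_continuous_left _ _ _ _ m2 m1 _ csig)) => //.
  move=> k; apply: (measurable_fun_pair (f := fst)); first exact: measurable_fst.
  apply: (measurableT_comp (f := sigma k)); last exact: measurable_snd.
  by case: (trs k).
split=> // g gi; have mg : measurable_fun setT g.
  by move: gi => /measurable_int/measurable_EFinP.
apply/ge0_cvge0P => [k|e e0]; first exact: integral_ge0.
have e20 : 0 < e / 2 by rewrite divr_gt0.
have /ge0_cvge0P H1 := c1 g gi; have /ge0_cvge0P H2 := c2 g gi.
have /H1/(_ _ e20){}H1 k :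
    (0 <= \int[(m1 \x m2)%E]_x (`|g (tau k x.1, x.2) - g x|)%:E)%E.
  exact: integral_ge0.
have /H2/(_ _ e20){}H2 k :
    (0 <= \int[(m1 \x m2)%E]_x (`|g (x.1, sigma k x.2) - g x|)%:E)%E.
  exact: integral_ge0.
near=> k; rewrite [e]splitr EFinD.
have m1k : measurable_fun setT (fun p => (`|g (tau k p.1, p.2) - g p|)%:E).
  apply/measurable_EFinP; apply: measurableT_comp => //; apply: measurable_funB => //.
  by apply: measurableT_comp => //; case: (tr1 k).
have m2k : measurable_fun setT (fun p => (`|g (p.1, sigma k p.2) - g p|)%:E).
  apply/measurable_EFinP; apply: measurableT_comp => //; apply: measurable_funB => //.
  by apply: measurableT_comp => //; case: (tr2 k).
have m2k' : measurable_fun setT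
   (fun p => (`|g (tau k p.1, sigma k p.2) - g (tau k p.1, p.2)|)%:E).
  have [mt _] := tr1 k; exact: (measurableT_comp m2k mt).
apply: (@le_trans _ _ (\int[(m1 \x m2)%E]_p (`|g (tau k p.1, p.2) - g p|)%:E +
   \int[(m1 \x m2)%E]_p (`|g (p.1, sigma k p.2) - g p|)%:E)%E); last first.
  by apply: leeD; near: k; [exact: H1|exact: H2].
rewrite -(transports1_norm (g := fun p => g (p.1, sigma k p.2) - g p) (tr1 k)); last first.
  apply: measurable_funB => //; apply: measurableT_comp => //; by case: (tr2 k).
rewrite -ge0_integralD//; apply: ge0_le_integral => //.
- apply/measurable_EFinP; apply: measurableT_comp => //; apply: measurable_funB => //.
  by apply: measurableT_comp => //; case: (trp k).
- exact: emeasurable_funD.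
- move=> p _; rewrite -EFinD lee_fin [leRHS]addrC (le_trans _ (ler_normD _ _))//.
  by rewrite addrA subrK.
Unshelve. all: by end_near. Qed.

End product2.

Notation Rn n := (n.-tuple (measurableTypeR R)).

Lemma L1_continuous_shift n (v : Rn n) :
  L1_continuous (lebesgue_n R n) (fun k => taff 1 (taff k.+1%:R^-1 (tzero R n) v)).
Proof.
elim: n v => [|n IH] v.
  split=> [k|g gi]; first exact: transports_shift.
  have e k x : taff 1 (taff k.+1%:R^-1 (tzero R 0) v) x = x.
    by rewrite tuple0 [RHS]tuple0.
  under eq_fun => k do under eq_integral do rewrite e subrr normr0.
  under eq_fun => k do rewrite integral0.
  exact: cvg_cst.
rewrite (tcons_surj v); move: (thead v) [tuple of behead v] => v0 v'.
have c1 : L1_continuous (@lebesgue_measure R)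
    (fun k x => (k.+1%:R^-1 * (v0 : R) + 1 * x : R)).
  split=> [k|g gi]; first exact: transports_shift1.
  exact: osc1_cvg.
have c2 := L1_continuous_prod c1 (IH v').
apply: (L1_continuous_transfer (transports_tcons R n) _ _ c2).
- by move=> k; have [] := transports_shift (taff k.+1%:R^-1 (tzero R n.+1) (tcons (v0, v'))).
- move=> k -[x0 x].
  have -> : tzero R n.+1 = tcons ((0 : R) : measurableTypeR R, tzero R n).
    apply: eq_from_tnth => i; case: (unliftP ord0 i) => [j ->|->].
      by rewrite tnth_tconsS !tnth_mktuple.
    by rewrite tnth_tcons0 tnth_mktuple.
  by rewrite !taff_tcons add0r.
Qed.

End L1_continuity.

(** * Plancherel's theorem *)

Section correlation.
Context d (T : measurableType d) (R : realType).
Variable mu : {measure set T -> \bar R}.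
Implicit Types (f g : T -> R[i]).

Definition truncate (M : nat) g x : R[i] :=
  g x * (\1_[set x | normc (g x) <= M%:R] x)%:C.

Lemma cmeasurable_truncate M g : cmeasurable g -> cmeasurable (truncate M g).
Proof.
move=> mg; apply: cmeasurable_restrict => //.
rewrite -[X in measurable X]setTI.
have /(_ measurableT _ (@measurable_itv R `]-oo, M%:R])) := measurable_normc mg.
by congr measurable; apply/seteqP; split=> x [_] /=; rewrite in_itv.
Qed.

Lemma normc_truncate M g x : normc (truncate M g x) <= M%:R.
Proof.
rewrite /truncate indicE; have [/set_mem/= xM|_] := boolP (x \in _).
  by rewrite mulr1.
by rewrite mulr0 normc0.
Qed.

Lemma normc_truncateB_le M g x : normc (g x - truncate M g x) <= normc (g x).
Proof.
rewrite /truncate indicE; case: (x \in _); rewrite ?mulr1 ?mulr0 ?subr0//.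
by rewrite subrr normc0 normc_ge0.
Qed.

Lemma truncate_cvg g : L2 mu g ->
  l2n mu (fun x => g x - truncate M g x) @[M --> \oo] --> (0 : R).
Proof.
move=> g2; have [mg _] := g2.
apply: fine_cvg.
apply: (integral_dominated0 _ _ _ (integrable_sqr_normc g2)).
- move=> M; apply: measurable_funX; apply: measurable_normc.
  by apply: cmeasurableB => //; exact: cmeasurable_truncate.
- by move=> M x; exact: sqr_ge0.
- move=> x; apply: cvg_near_cst; near=> M.
  rewrite /truncate indicE mem_set/= ?mulr1 ?subrr ?normc0 ?expr0n//.
  by near: M; exact: nbhs_infty_ger.
- by move=> M x; rewrite ler_sqr ?nnegrE ?normc_ge0// normc_truncateB_le.
Unshelve. all: by end_near. Qed.

Lemma transports_L2 (h : T -> T) g : transports mu mu 1 h -> L2 mu g ->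
  L2 mu (g \o h) /\ l2n mu (g \o h) = l2n mu g.
Proof.
move=> [mh th] [mg gi]; rewrite /l2n.
have e : l2sq mu (g \o h) = l2sq mu g.
  rewrite /l2sq (th (fun x => (normc (g x) ^+ 2)%:E)) ?mul1e//.
  - exact: measurable_sqr_normc.
  - by move=> x; rewrite lee_fin sqr_ge0.
by rewrite /L2 e; split=> //; split=> //; exact: cmeasurable_comp.
Qed.

Lemma L1_continuous_normc (tau : nat -> T -> T) g : L1_continuous mu tau ->
  cintegrable mu g ->
  \int[mu]_x normc (g (tau k x) - g x) @[k --> \oo] --> (0 : R).
Proof.
move=> [trt ctau] [gR gI]; apply: fine_cvg.
have mg : cmeasurable g by exact: (cintegrable_cmeasurable (conj gR gI)).
have md k : cmeasurable (fun x => g (tau k x) - g x).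
  by apply: cmeasurableB => //; apply: cmeasurable_comp => //; case: (trt k).
have := cvgeD _ (ctau _ gR) (ctau _ gI); rewrite adde0 => /(_ _ isT) H.
apply: (squeeze_cvge _ _ H); last exact: cvg_cst.
near=> k; apply/andP; split; first by apply: integral_ge0 => x _; rewrite lee_fin normc_ge0.
have [m1 m2] := md k.
have a1 : measurable_fun setT
    (fun x => (`|complex.Re (g (tau k x)) - complex.Re (g x)|)%:E).
  apply/measurable_EFinP; apply: measurableT_comp => //; move: m1.
  by congr measurable_fun; apply/funext => x; rewrite !ReImE.
have a2 : measurable_fun setT
    (fun x => (`|complex.Im (g (tau k x)) - complex.Im (g x)|)%:E).
  apply/measurable_EFinP; apply: measurableT_comp => //; move: m2.
  by congr measurable_fun; apply/funext => x; rewrite !ReImE.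
rewrite -ge0_integralD//; apply: ge0_le_integral => //.
- by move=> x _; rewrite lee_fin normc_ge0.
- exact/measurable_EFinP/measurable_normc.
- exact: emeasurable_funD.
- by move=> x _; rewrite -EFinD lee_fin (le_trans (normc_le_ReIm _))// !ReImE.
Unshelve. all: by end_near. Qed.

(** Continuity is available in [L^1] only, so [g] is split: the part bounded by [M] pairs with the
    increment [D] through the [L^1] norm of [D], and the rest is small in [L^2] while
    [|D|^2 <= 4 |g|^2]. *)
Lemma cdot_shift_cvg (tau : nat -> T -> T) g : L1_continuous mu tau ->
  cintegrable mu g -> L2 mu g ->
  normc (cdot mu g (g \o tau k) - cdot mu g g) @[k --> \oo] --> (0 : R).
Proof.
move=> ctau gi g2; have [trt _] := ctau; have [mg _] := g2.
have tL2 k : L2 mu (g \o tau k) by have [] := transports_L2 (trt k) g2.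
apply/cvgr0Pnorm_le => e e0.
have e2 : 0 < e / 2 by rewrite divr_gt0.
have /cvgr0Pnorm_le := truncate_cvg g2.
(* Cauchy-Schwarz multiplies this by at most [4 |g|^2 + 1], leaving [(e / 2)^2]. *)
have d0 : 0 < (e / 2) ^+ 2 / (4 * l2n mu g + 1).
  by rewrite divr_gt0 ?exprn_gt0// ltr_wpDl// mulr_ge0// l2n_ge0.
move=> /(_ _ d0) [M _ /(_ M (leqnn M))]; rewrite ger0_norm ?l2n_ge0// => HM.
have /cvgr0Pnorm_le := L1_continuous_normc ctau gi.
have d1 : 0 < e / 2 / (M%:R + 1) by rewrite divr_gt0// ltr_wpDl.
move=> /(_ _ d1); apply: filterS => k Hk.
rewrite ger0_norm ?normc_ge0//.
set gM := truncate M g.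
have gM2 : L2 mu gM.
  apply: (le_L2 (cmeasurable_truncate M mg) g2) => x.
  rewrite /gM /truncate normcM normcr indicE.
  by case: (x \in _); rewrite ?normr1 ?normr0 ?mulr1// mulr0 normc_ge0.
pose D x := g (tau k x) - g x.
have D2 : L2 mu D by exact: (L2B (tL2 k) g2).
have -> : cdot mu g (g \o tau k) - cdot mu g g =
    cdot mu (fun x => g x - gM x) D + cdot mu gM D.
  have -> : cdot mu (fun x => g x - gM x) D + cdot mu gM D = cdot mu g D.
    by rewrite cdotBl// subrK.
  rewrite -cintegralB; [|exact: cdot_cintegrable|exact: cdot_cintegrable].
  by apply: eq_cintegral => x; rewrite /D conjcB mulrBr.
apply: le_trans (le_normcD _ _) _; rewrite [leRHS]splitr lerD//.
  rewrite -ler_sqr ?nnegrE ?normc_ge0 ?(ltW e2)//.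
  apply: le_trans (cauchy_schwarz (L2B g2 gM2) D2) _.
  have Dle : l2n mu D <= 4 * l2n mu g + 1.
    have := l2nD_le (tL2 k) (L2N g2); have [_ ->] := transports_L2 (trt k) g2.
    rewrite (eq_l2n _ (f := fun x => - g x) (g := g)); last by move=> x; rewrite normcN.
    by rewrite /D /=; lra.
  apply: le_trans (ler_pM _ _ HM Dle) _; rewrite ?l2n_ge0//.
  by rewrite divfK// gt_eqF// ltr_wpDl// mulr_ge0// l2n_ge0.
apply: le_trans (normc_cintegral (cdot_cintegrable gM2 D2)) _.
have Di : mu.-integrable setT (EFin \o (fun x => normc (D x))).
  apply: integrable_normc; apply: cintegrableB => //.
  exact: (transports_cintegrable (trt k) gi).
apply: (@le_trans _ _ (\int[mu]_x (M%:R * normc (D x)))).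
  apply: le_Rintegral => //.
  - exact: (integrable_normc (cdot_cintegrable gM2 D2)).
  - exact: integrableZl Di.
  - by move=> x _; rewrite normcM normc_conj ler_wpM2r ?normc_ge0// normc_truncate.
rewrite RintegralZl//.
have ID0 : 0 <= \int[mu]_x normc (D x) by apply: Rintegral_ge0 => x _; exact: normc_ge0.
move: Hk; rewrite -/D ger0_norm// ler_pdivlMr; last by rewrite ltr_wpDl.
have := ler0n R M; nra.
Qed.

End correlation.

Section plancherel.
Variable R : realType.
Notation Rn n := (n.-tuple (measurableTypeR R)).
Notation leb2 n := (lebesgue_n R n \x lebesgue_n R n)%E.

Definition wave n (x y : Rn n) : R[i] := cexp (0 +i* (2 * rdot x y)).

Lemma normc_wave n (x y : Rn n) : normc (wave x y) = 1.
Proof. by rewrite normc_cexp expR0. Qed.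

Lemma cmeasurable_wave d (T : measurableType d) n (f g : T -> Rn n) :
  measurable_fun setT f -> measurable_fun setT g ->
  cmeasurable (fun t => wave (f t) (g t)).
Proof.
move=> mf mg; apply: cmeasurable_cexp; split; first exact: measurable_cst.
by apply: measurable_funM => //; exact: measurable_rdot.
Qed.

(** With the frequency [2 x.y] of [wave] the constant in Plancherel's formula is [pi ^+ n]. *)
Definition fourier n (g : Rn n -> R[i]) (y : Rn n) : R[i] :=
  cintegral (lebesgue_n R n) (fun x => g x * wave x y).

Variable n : nat.
Notation mu := (lebesgue_n R n).
Implicit Type g : Rn n -> R[i].

Lemma cintegrable_wave g y : cintegrable mu g ->
  cintegrable mu (fun x => g x * wave x y).
Proof.
move=> gi; have mg := cintegrable_cmeasurable gi.
apply: (cintegrable_le _ (integrable_normc gi)) => [|x].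
  by apply: cmeasurableM => //; exact: cmeasurable_wave.
by rewrite normcM normc_wave mulr1.
Qed.

Lemma cmeasurable_fourier g : cmeasurable g -> cmeasurable (fourier g).
Proof.
move=> mg.
apply: (@cmeasurable_cintegral2 _ _ _ _ _ mu (fun p => g p.2 * wave p.2 p.1)).
apply: cmeasurableM; last exact: cmeasurable_wave.
by apply: (cmeasurable_comp (f := g)).
Qed.

Definition correlation_kernel s g (p : Rn n * Rn n) : R[i] :=
  g p.1 * conjc (g (taff s p.1 p.2)).

Lemma transports_taff_snd s : 0 < s ->
  transports (leb2 n) (leb2 n) (s^-1 ^+ n) (fun p => (p.1, taff s p.1 p.2)).
Proof.
move=> s0.
have tr1 : transports (leb2 n) (leb2 n) (s^-1 ^+ n) (fun p => (taff s p.2 p.1, p.2)).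
  apply: (@transports_fiber _ _ _ _ _ _ _ mu mu mu _ (fun y x => taff s y x)).
  - by rewrite exprn_ge0// invr_ge0 ltW.
  - have := @measurable_taff R n s.
    by move/(measurableT_comp (g := fun p => (p.2, p.1))); apply; exact: measurable_swap.
  - by move=> y; exact: transports_taff.
by have := transports_comp (transports_comp (transports_swap mu mu) tr1)
  (transports_swap mu mu); rewrite mul1r mulr1.
Qed.

Lemma cintegrable_correlation s g : 0 < s -> cintegrable mu g ->
  cintegrable (leb2 n) (correlation_kernel s g).
Proof.
move=> s0 gi; have [ti _] := cintegral_tensor gi (cintegrableJ gi).
by have := transports_cintegrable (transports_taff_snd s0) ti.
Qed.

(** The squared modulus is a double integral over [x] and [x']. Substituting [x' = x + s v] has
    Jacobian [s^-n] in this normalization, and the frequency [y / s] turns the phase difference into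
    [- 2 v.y]. *)
Lemma fourier_sqr_correlation s g y : 0 < s -> cintegrable mu g ->
  (s^-1 ^+ n)%:C * (normc (fourier g (taff s^-1 (tzero R n) y)) ^+ 2)%:C =
  cintegral (leb2 n) (fun p => correlation_kernel s g p * conjc (wave p.2 y)).
Proof.
move=> s0 gi; set ys := taff _ _ _.
have gwi := cintegrable_wave ys gi.
have [ti te] := cintegral_tensor gwi (cintegrableJ gwi).
rewrite -mulcJ /fourier -cintegralJ// -te.
have -> : (fun p => correlation_kernel s g p * conjc (wave p.2 y)) =
   (fun p => g p.1 * wave p.1 ys * conjc (g p.2 * wave p.2 ys)) \o
   (fun p => (p.1, taff s p.1 p.2)).
  apply/funext => -[x v]; rewrite /correlation_kernel /comp -[(x, v).1]/x -[(x, v).2]/v.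
  rewrite -[(_, _).1]/x -[(_, _).2]/(taff s x v).
  rewrite conjcM mulrACA; congr (_ * _).
  rewrite /wave !conj_cexp -cexpD; congr cexp; apply: complex_ext; rewrite !ReImE ?addr0//.
  by rewrite !rdotE; field; rewrite gt_eqF.
by rewrite (transports_cintegral (transports_taff_snd s0) ti).
Qed.

Definition correlation s g v : R[i] := cintegral mu (fun x => g x * conjc (g (taff s x v))).

Lemma normc_fourier_le g y : cintegrable mu g ->
  normc (fourier g y) <= \int[mu]_x normc (g x).
Proof.
move=> gi; apply: le_trans (normc_cintegral (cintegrable_wave y gi)) _.
by rewrite le_eqVlt; apply/orP; left; apply/eqP; apply: eq_Rintegral => x _;
  rewrite normcM normc_wave mulr1.
Qed.

Lemma gaussian_wave (v : Rn n) :
  cintegrable mu (fun u => conjc (wave v u) * (expR (- (2 * rdot u u)))%:C) /\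
  cintegral mu (fun u => conjc (wave v u) * (expR (- (2 * rdot u u)))%:C) =
  (Num.sqrt (pi / 2) ^+ n * expR (- (2^-1 * rdot v v)))%:C.
Proof.
have := gaussian_oscillation (taff (- 2) (tzero R n) v).
have -> : rdot (taff (- 2) (tzero R n) v) (taff (- 2) (tzero R n) v) / 8 = 2^-1 * rdot v v.
  by rewrite !rdotE; field.
suff -> : (fun u => conjc (wave v u) * (expR (- (2 * rdot u u)))%:C) =
  (fun y => cexp (- (2 * rdot y y) +i* rdot (taff (- 2) (tzero R n) v) y)) by [].
apply/funext => u.
rewrite -cexpr /wave conj_cexp -cexpD; congr cexp; apply: complex_ext; rewrite !ReImE.
  by rewrite ?add0r.
by rewrite addr0 !rdotE; ring.
Qed.

(** The Fourier transform of an integrable function is bounded, so the Gaussian factor alone gives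
    integrability, before anything is known about the [L^2] norm of [fourier g]. *)
Lemma integrable_regularized s g : 0 < s -> cintegrable mu g ->
  mu.-integrable setT
    (EFin \o (fun y => normc (fourier g y) ^+ 2 * expR (- (2 * s ^+ 2 * rdot y y)))).
Proof.
move=> s0 gi; have mft := cmeasurable_fourier (cintegrable_cmeasurable gi).
have ss0 : 0 < 2 * s ^+ 2 by rewrite mulr_gt0// exprn_gt0.
have mF : measurable_fun setT
    (fun y => normc (fourier g y) ^+ 2 * expR (- (2 * s ^+ 2 * rdot y y))).
  apply: measurable_funM; last exact: measurable_gaussian.
  by apply: measurable_funX; exact: measurable_normc.
have Gi := integrableZl measurableT ((\int[mu]_x normc (g x)) ^+ 2)
  (@integrable_gaussian R n _ ss0).
apply: (le_integrable measurableT _ _ Gi); first exact/measurable_EFinP.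
move=> y _; rewrite !gee0_abs ?lee_fin ?(mulr_ge0 (sqr_ge0 _) (expR_ge0 _))//.
have N0 : 0 <= \int[mu]_x normc (g x) by apply: Rintegral_ge0 => x _; exact: normc_ge0.
by rewrite ler_wpM2r ?expR_ge0// ler_sqr ?nnegrE ?normc_ge0 ?normc_fourier_le.
Qed.

(* Substitute [y / s] for [y] and integrate first in [y]: the Gaussian weight turns into
   an approximate identity. *)
Lemma regularized_plancherel s g : 0 < s -> cintegrable mu g -> L2 mu g ->
  cintegral mu (fun y => (normc (fourier g y) ^+ 2 * expR (- (2 * s ^+ 2 * rdot y y)))%:C) =
  cintegral mu (fun v => (Num.sqrt (pi / 2) ^+ n * expR (- (2^-1 * rdot v v)))%:C *
    correlation s g v).
Proof.
move=> s0 gi g2; have mg := cintegrable_cmeasurable gi.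
pose F y : R[i] := (normc (fourier g y) ^+ 2 * expR (- (2 * s ^+ 2 * rdot y y)))%:C.
have Fi : cintegrable mu F by exact/cintegrable_real/integrable_regularized.
have sV0 : 0 < s^-1 by rewrite invr_gt0.
have := transports_cintegral (transports_taff (tzero R n) sV0) Fi; rewrite invrK.
have sn0 : (s ^+ n)%:C != 0 :> R[i].
  by rewrite -normc_eq0 normcr normr_eq0 expf_eq0 (gt_eqF s0) andbF.
have Fti := transports_cintegrable (transports_taff (tzero R n) sV0) Fi.
move=> H; transitivity (cintegral mu (fun u => (s^-1 ^+ n)%:C * F (taff s^-1 (tzero R n) u))).
  apply/esym; rewrite (cintegralZ (s^-1 ^+ n)%:C Fti) H mulrA.
  suff -> : (s^-1 ^+ n)%:C * (s ^+ n)%:C = 1 :> R[i] by rewrite mul1r.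
  by rewrite -rmorphM -exprMn mulVf ?gt_eqF// expr1n.
move=> {H}.
pose K (q : Rn n * (Rn n * Rn n)) : R[i] := correlation_kernel s g q.2 *
  (conjc (wave q.2.2 q.1) * (expR (- (2 * rdot q.1 q.1)))%:C).
have ci := cintegrable_correlation s0 gi.
have mcorr := cintegrable_cmeasurable ci.
(* The Gaussian in the frequency times the integrable correlation kernel dominates [K], which
   permits integrating in the frequency first. *)
have Ki : cintegrable (mu \x sfprod mu mu)%E K.
  have [ti _] := cintegral_tensor (m1 := mu) (m2 := sfprod mu mu)
    (cintegrable_real (@integrable_gaussian R n 2 (ltr0Sn R 1)))
    ci.
  apply: (cintegrable_le _ (integrable_normc ti)) => [|q].
    apply: cmeasurableM; first by apply: (cmeasurable_comp (f := correlation_kernel s g)).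
    apply: cmeasurableM.
      apply: cmeasurableJ; apply: cmeasurable_wave => //.
      by apply: measurableT_comp => //; exact: measurable_snd.
    by apply: cmeasurable_real; apply: (measurableT_comp (@measurable_gaussian R n 2)).
  rewrite /K; move: (correlation_kernel s g q.2) => c.
  by rewrite !normcM normc_conj normc_wave mul1r mulrC.
have wcb (b : Rn n * Rn n -> R[i]) M : cmeasurable b -> (forall p, normc (b p) <= M) ->
    cintegrable (leb2 n) (fun p => correlation_kernel s g p * b p).
  move=> mb bM; apply: (cintegrable_le (g := fun p => M * normc (correlation_kernel s g p))).
  - exact: cmeasurableM.
  - exact: (integrableZl measurableT M (integrable_normc ci)).
  - by move=> p; rewrite normcM mulrC ler_wpM2r ?normc_ge0.
transitivity (cintegral mu (fun u => cintegral (sfprod mu mu) (fun p => K (u, p)))).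
  apply: eq_cintegral => u.
  have wi : cintegrable (leb2 n) (fun p => correlation_kernel s g p * conjc (wave p.2 u)).
    apply: (wcb _ 1) => [|p]; last by rewrite normc_conj normc_wave.
    by apply: cmeasurableJ; exact: cmeasurable_wave.
  rewrite /F rmorphM mulrA fourier_sqr_correlation// mulrC -cintegralZ//.
  apply: eq_cintegral => p; rewrite /K -[(u, p).1]/u -[(u, p).2]/p mulrC mulrA.
  congr (_ * (expR _)%:C); rewrite !rdotE; field; by rewrite gt_eqF.
rewrite cfubini//; pose ga (v : Rn n) : R := Num.sqrt (pi / 2) ^+ n * expR (- (2^-1 * rdot v v)).
have mga : measurable_fun setT ga by apply: measurable_funM => //; exact: measurable_gaussian.
transitivity (cintegral (leb2 n) (fun p => correlation_kernel s g p * (ga p.2)%:C)).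
  apply: eq_cintegral => p; have [wi <-] := gaussian_wave p.2.
  by rewrite -(cintegralZ _ wi).
have gi2 : cintegrable (leb2 n) (fun p => correlation_kernel s g p * (ga p.2)%:C).
  apply: (wcb _ (Num.sqrt (pi / 2) ^+ n)) => [|p].
    by apply: cmeasurable_real; apply: (measurableT_comp mga).
  rewrite normcr ger0_norm; last by rewrite mulr_ge0 ?expR_ge0 ?exprn_ge0 ?sqrtr_ge0.
  rewrite ler_piMr ?exprn_ge0 ?sqrtr_ge0// -expR0 ler_expR oppr_le0.
  by rewrite mulr_ge0 ?rdot_ge0// invr_ge0.
rewrite -cfubini2//; apply: eq_cintegral => v; rewrite /correlation -cintegralZ.
  by apply: eq_cintegral => x; rewrite mulrC.
have sg2 : L2 mu (g \o (taff 1 (taff s (tzero R n) v))).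
  by have [] := transports_L2 (transports_shift (taff s (tzero R n) v)) g2.
have := cdot_cintegrable g2 sg2; congr cintegrable; apply/funext => x.
rewrite /comp; do 3 f_equal; apply: eq_from_tnth => i; rewrite !tnth_mktuple; ring.
Qed.

Lemma correlationE s g v :
  correlation s g v = cdot mu g (g \o taff 1 (taff s (tzero R n) v)).
Proof.
apply: eq_cintegral => x; rewrite /comp; do 3 f_equal.
by apply: eq_from_tnth => i; rewrite !tnth_mktuple; ring.
Qed.

Lemma correlation_cvg g v : cintegrable mu g -> L2 mu g ->
  normc (correlation k.+1%:R^-1 g v - (l2n mu g)%:C) @[k --> \oo] --> (0 : R).
Proof.
move=> gi g2; rewrite -cdot_normal; under eq_fun do rewrite correlationE.
exact: (cdot_shift_cvg (L1_continuous_shift v) gi g2).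
Qed.

Lemma normc_correlation_le s g v : L2 mu g -> normc (correlation s g v) <= l2n mu g.
Proof.
move=> g2; have [sg2 sge] := transports_L2 (transports_shift (taff s (tzero R n) v)) g2.
rewrite correlationE -ler_sqr ?nnegrE ?normc_ge0 ?l2n_ge0// [leRHS]expr2 -[X in _ * X]sge.
exact: cauchy_schwarz.
Qed.

(** As [s] tends to 0 the correlation at each [v] tends to [|g|^2] by continuity of translations. It
    is bounded by the same [|g|^2], and the Gaussian against which it is integrated has mass
    [pi ^+ n]. *)
Lemma regularized_plancherel_cvg g : cintegrable mu g -> L2 mu g ->
  \int[mu]_y (normc (fourier g y) ^+ 2 * expR (- (2 * k.+1%:R^-1 ^+ 2 * rdot y y)))
    @[k --> \oo] --> pi ^+ n * l2n mu g.
Proof.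
move=> gi g2.
pose ga (v : Rn n) : R := Num.sqrt (pi / 2) ^+ n * expR (- (2^-1 * rdot v v)).
have h0 : 0 < (2^-1 : R) by [].
have gai : mu.-integrable setT (EFin \o ga).
  exact: (integrableZl measurableT (Num.sqrt (pi / 2) ^+ n) (@integrable_gaussian R n _ h0)).
have ga0 v : 0 <= ga v by rewrite mulr_ge0 ?expR_ge0 ?exprn_ge0 ?sqrtr_ge0.
have gaI : \int[mu]_v ga v = pi ^+ n.
  rewrite /ga RintegralZl//; last exact: integrable_gaussian.
  rewrite /Rintegral (integral_gaussian n h0)/= -exprMn -sqrtrM ?divr_ge0 ?pi_ge0//.
  rewrite (_ : pi / 2 * (pi / 2^-1) = pi ^+ 2); last by field.
  by rewrite sqrtr_sqr ger0_norm ?pi_ge0.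
have mga : measurable_fun setT ga by apply: measurable_funM => //; exact: measurable_gaussian.
have mcorr k : cmeasurable (correlation k.+1%:R^-1 g).
  have sk : 0 < (k.+1%:R^-1 : R) by rewrite invr_gt0.
  have := cmeasurable_cintegral2 mu (f := fun p => correlation_kernel k.+1%:R^-1 g (p.2, p.1)).
  apply; apply: (cmeasurable_comp (h := fun p : Rn n * Rn n => (p.2, p.1))).
    exact: measurable_swap.
  exact: cintegrable_cmeasurable (cintegrable_correlation sk gi).
have [] := @cintegral_dominated _ _ _ mu
  (fun k v => (ga v)%:C * correlation k.+1%:R^-1 g v) (fun v => (ga v)%:C * (l2n mu g)%:C)
  (fun v => l2n mu g * ga v).
- by move=> k; apply: cmeasurableM => //; exact: cmeasurable_real.
- by apply: cmeasurableM; [exact: cmeasurable_real|exact: cmeasurable_cst].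
- move=> v; under eq_fun do rewrite -mulrBr normcM normcr ger0_norm//.
  have := @cvgM _ _ \oo _ (fun=> ga v) _ _ _ (cvg_cst _) (correlation_cvg v gi g2).
  by rewrite mulr0 => /(_ _ _); exact.
- exact: (integrableZl measurableT (l2n mu g) gai).
- move=> k v; rewrite normcM normcr ger0_norm// mulrC ler_wpM2r//.
  exact: normc_correlation_le.
move=> _ H; apply/subr_cvg0; apply/norm_cvg0P; move: H.
suff E k : normc (cintegral mu (fun v => (ga v)%:C * correlation k.+1%:R^-1 g v) -
    cintegral mu (fun v => (ga v)%:C * (l2n mu g)%:C)) =
    `|\int[mu]_y (normc (fourier g y) ^+ 2 * expR (- (2 * k.+1%:R^-1 ^+ 2 * rdot y y))) -
      pi ^+ n * l2n mu g|.
  by under eq_fun do rewrite E.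
rewrite -regularized_plancherel ?invr_gt0// cintegral_real.
have -> : cintegral mu (fun v => (ga v)%:C * (l2n mu g)%:C) =
    cintegral mu (fun v => (l2n mu g * ga v)%:C).
  by apply: eq_cintegral => v; rewrite -rmorphM mulrC.
by rewrite cintegral_real -rmorphB normcr RintegralZl// gaI [l2n _ _ * _]mulrC.
Qed.

(** The Gaussian factors increase to 1, so by monotone convergence the regularized integrals also
    tend to [l2sq mu (fourier g)]. Stated in extended reals, the equality contains the square
    integrability of [fourier g]. *)
Lemma plancherel g : cintegrable mu g -> L2 mu g ->
  l2sq mu (fourier g) = (pi ^+ n * l2n mu g)%:E.
Proof.
move=> gi g2; have mft := cmeasurable_fourier (cintegrable_cmeasurable gi).
pose h k (y : Rn n) : R :=
  normc (fourier g y) ^+ 2 * expR (- (2 * k.+1%:R^-1 ^+ 2 * rdot y y)).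
have s0 k : 0 < (k.+1%:R^-1 : R) by rewrite invr_gt0.
have hi k : mu.-integrable setT (EFin \o h k) by exact: integrable_regularized.
have h0 k y : 0 <= h k y by rewrite mulr_ge0 ?expR_ge0 ?sqr_ge0.
have lim1 : (\int[mu]_y (h k y)%:E)%E @[k --> \oo] --> (pi ^+ n * l2n mu g)%:E.
  apply: cvg_EFin; last exact: regularized_plancherel_cvg.
  by apply: nearW => k; exact: (integrable_fin_num measurableT (hi k)).
have lim2 : (\int[mu]_y (h k y)%:E)%E @[k --> \oo] --> l2sq mu (fourier g).
  have -> : l2sq mu (fourier g) = (\int[mu]_y (limn (fun k => (h k y)%:E)))%E.
    apply: eq_integral => y _; apply/esym/cvg_lim => //; apply: cvg_EFin.
      exact: nearW.
    rewrite -[X in _ --> X]mulr1 -expR0; apply: cvgM; first exact: cvg_cst.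
    apply: (@cvg_comp _ _ _ (fun k : nat => - (2 * k.+1%:R^-1 ^+ 2 * rdot y y)) (@expR R) _ (nbhs 0)); last first.
      exact: continuous_expR.
    rewrite -oppr0 -(mul0r (rdot y y)) -(mulr0 2); apply: cvgN; apply: cvgM; last exact: cvg_cst.
    apply: cvgM; first exact: cvg_cst.
    by rewrite -[X in _ --> X](mulr0 0); apply: cvgM; exact: cvg_harmonic.
  apply: cvg_monotone_convergence => //.
  - by move=> k; case/integrableP: (hi k).
  - by move=> k y _; rewrite lee_fin.
  - move=> y _ k l kl; rewrite lee_fin ler_wpM2l ?sqr_ge0// ler_expR lerN2.
    rewrite ler_wpM2r ?rdot_ge0// ler_wpM2l// ler_sqr ?nnegrE ?invr_ge0//.
    by rewrite lef_pV2 ?posrE// ler_nat.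
exact: (cvg_unique _ lim2 lim1).
Qed.

End plancherel.

(** * The Bargmann transform *)

Section bilinear.
Variables (R : realType) (n : nat).
Notation Rn n := (n.-tuple (measurableTypeR R)).
Notation Cn n := 'rV[R[i]]_n.
Implicit Types (a b c : Cn n).

Lemma dotcC a b : dotc a b = dotc b a.
Proof. by apply: eq_bigr => i _; rewrite mulrC. Qed.

Lemma dotcDl a b c : dotc (a + b) c = dotc a c + dotc b c.
Proof. by rewrite -big_split; apply: eq_bigr => i _; rewrite mxE mulrDl. Qed.

Lemma dotcDr a b c : dotc c (a + b) = dotc c a + dotc c b.
Proof. by rewrite dotcC dotcDl !(dotcC c). Qed.

Lemma dotcZl (k : R[i]) a b : dotc (k *: a) b = k * dotc a b.
Proof. by rewrite mulr_sumr; apply: eq_bigr => i _; rewrite mxE mulrA. Qed.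

Lemma dotcZr (k : R[i]) a b : dotc b (k *: a) = k * dotc b a.
Proof. by rewrite dotcC dotcZl dotcC. Qed.

Lemma dotcNl a b : dotc (- a) b = - dotc a b.
Proof. by rewrite -scaleN1r dotcZl mulN1r. Qed.

Lemma dotcNr a b : dotc b (- a) = - dotc b a.
Proof. by rewrite dotcC dotcNl dotcC. Qed.

Definition dotcE := (dotcDl, dotcDr, dotcZl, dotcZr, dotcNl, dotcNr).

Lemma conj_dotc a b : conjc (dotc a b) = dotc (conj_vec a) (conj_vec b).
Proof.
rewrite /dotc; elim/big_rec2: _ => [|i x y _ <-]; first exact: conjcr.
by rewrite conjcD conjcM !mxE.
Qed.

Lemma conj_real_vec (x : Rn n) : conj_vec (real_vec x) = real_vec x.
Proof. by apply/rowP => i; rewrite !mxE conjcr. Qed.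

Lemma conj_vecK : involutive (@conj_vec R n).
Proof. by move=> a; apply/rowP => i; rewrite !mxE conjcK. Qed.

Lemma sqr_i : 'i%C * 'i%C = -1 :> R[i].
Proof. by rewrite -expr2 sqr_i. Qed.

End bilinear.

Section bargmann.
Variable R : realType.
Notation Rn n := (n.-tuple (measurableTypeR R)).
Notation Cn n := 'rV[R[i]]_n.
Notation leb2 n := (lebesgue_n R n \x lebesgue_n R n)%E.

Definition bargmann_const n : R := Num.sqrt (Num.sqrt (2 / pi) ^+ n).

Definition bargmann_kernel n (x : Rn n) (z : Cn n) : R[i] := (bargmann_const n)%:C *
  cexp (2 * 'i%C * dotc (real_vec x) z + dotc z z / 2 - dotc (real_vec x) (real_vec x)).

Definition bargmann n (f : Rn n -> R[i]) (z : Cn n) : R[i] :=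
  cintegral (lebesgue_n R n) (fun x => f x * bargmann_kernel x z).

Definition weight n (p : Rn n * Rn n) : R := Num.sqrt (gauss_density (complex_vec p)).

Definition weighted n (F : Cn n -> R[i]) (p : Rn n * Rn n) : R[i] :=
  F (complex_vec p) * (weight p)%:C.

Variable n : nat.
Notation mu := (lebesgue_n R n).
Implicit Types (f g h : Rn n -> R[i]).

Lemma bargmann_const_gt0 : 0 < bargmann_const n.
Proof. by rewrite sqrtr_gt0 exprn_gt0// sqrtr_gt0 divr_gt0// pi_gt0. Qed.

Lemma sqr_bargmann_const : bargmann_const n ^+ 2 = Num.sqrt (2 / pi) ^+ n.
Proof. by rewrite sqr_sqrtr// exprn_ge0// sqrtr_ge0. Qed.

Lemma sqr_bargmann_const_gaussian :
  bargmann_const n ^+ 2 * Num.sqrt (pi / 2) ^+ n = 1.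
Proof.
rewrite sqr_bargmann_const -exprMn -sqrtrM ?divr_ge0 ?pi_ge0//.
rewrite (_ : 2 / pi * (pi / 2) = 1) ?sqrtr1 ?expr1n//.
have p0 : (pi : R) != 0 by rewrite gt_eqF ?pi_gt0.
by rewrite mulrA divfK// divff.
Qed.

Lemma bargmann_kernelM (x : Rn n) (z w : Cn n) :
  let u := real_vec x - ('i%C / 2) *: (z - conj_vec w) in
  bargmann_kernel x z * conjc (bargmann_kernel x w) =
  (bargmann_const n ^+ 2)%:C * cexp (dotc z (conj_vec w)) * cexp (- 2 * dotc u u).
Proof.
move=> u; rewrite /u {u} /bargmann_kernel conjcM conjcr mulrACA -rmorphM -expr2 -[RHS]mulrA.
congr (_ * _); rewrite conj_cexp.
rewrite -!cexpD; congr cexp.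
have c2 : conjc (2 : R[i]) = 2 by rewrite (_ : 2 = (2 : R)%:C) ?conjcr// rmorph_nat.
have c2V : conjc (2^-1 : R[i]) = 2^-1.
  by rewrite (_ : 2^-1 = (2^-1 : R)%:C) ?conjcr// fmorphV rmorph_nat.
have ci : conjc 'i%C = - 'i%C :> R[i] by apply: complex_ext; rewrite !ReImE ?oppr0.
rewrite !(c2, c2V, ci, conjcD, conjcN, conjcM) !conj_dotc conj_real_vec.
rewrite !dotcE (dotcC (conj_vec w) z) (dotcC z (real_vec x)) (dotcC (conj_vec w) (real_vec x)).
set xx := dotc (real_vec x) (real_vec x); set xz := dotc (real_vec x) z.
set zz := dotc z z; set xw := dotc _ (conj_vec w); set ww := dotc (conj_vec w) _; set zw := dotc z _.
have := @sqr_i R; set I := 'i%C => I2.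
apply/eqP; rewrite -subr_eq0; apply/eqP.
(* The exponents differ by a multiple of [I * I + 1]. With ['i%C] abstracted as [I], the identity
   becomes one that [field] can check. *)
transitivity ((I * I + 1) * 2^-1 * (zz + ww - 2 * zw)); last by rewrite I2 addNr !mul0r.
by field.
Qed.

(** This separates the kernel of [gauss_transform] into a factor independent of [x] and
    [fourier_kernel], whose integral is known. *)
Lemma dotc_shifted (x : Rn n) (v : Cn n) :
  let u := real_vec x - ('i%C / 2) *: v in
  cexp (- 2 * dotc u u) = cexp (dotc v v / 2) * fourier_kernel x v.
Proof.
move=> u; rewrite /u {u} /fourier_kernel -cexpD; congr cexp; rewrite !dotcE (dotcC v (real_vec x)).
have -> : (- (2 * rdot x x))%:C = - 2 * dotc (real_vec x) (real_vec x) :> R[i].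
  apply: complex_ext; rewrite !ReImE real_vecE Re_dotc Im_dotc !rdotE.
    by rewrite /=; ring.
  by rewrite /=; ring.
set xx := dotc (real_vec x) (real_vec x); set xz := dotc (real_vec x) v.
set zz := dotc v v.
have := @sqr_i R; set I := 'i%C => I2.
apply/eqP; rewrite -subr_eq0; apply/eqP.
transitivity (- (I * I + 1) * 2^-1 * zz); last by rewrite I2 addNr oppr0 !mul0r.
by field.
Qed.

Lemma weightE (p : Rn n * Rn n) :
  weight p = Num.sqrt (pi ^- n) * expR (- (2^-1 * (rdot p.1 p.1 + rdot p.2 p.2))).
Proof.
rewrite /weight gauss_densityE sqrtrM ?invr_ge0 ?exprn_ge0 ?pi_ge0//; congr (_ * _).
rewrite (_ : expR _ = expR (- (2^-1 * (rdot p.1 p.1 + rdot p.2 p.2))) ^+ 2).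
  by rewrite sqrtr_sqr ger0_norm ?expR_ge0.
by rewrite expr2 -expRD; congr expR; field.
Qed.

Lemma weight_gt0 (p : Rn n * Rn n) : 0 < weight p.
Proof. by rewrite weightE mulr_gt0 ?expR_gt0// sqrtr_gt0 invr_gt0 exprn_gt0 ?pi_gt0. Qed.

Lemma sqr_weight (p : Rn n * Rn n) : weight p ^+ 2 = gauss_density (complex_vec p).
Proof.
by rewrite sqr_sqrtr// gauss_densityE mulr_ge0 ?expR_ge0// invr_ge0 exprn_ge0 ?pi_ge0.
Qed.

Lemma fock_sqnormE (F : Cn n -> R[i]) :
  fock_sqnorm F = l2sq (lebesgue_n R n \x lebesgue_n R n)%E (weighted F).
Proof.
apply: eq_integral => p _; rewrite normcM normcr exprMn real_normK ?num_real//.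
by rewrite sqr_weight.
Qed.

Definition shifted_gaussian (t x : Rn n) : R := expR (- rdot (taff 1 x t) (taff 1 x t)).

(* The unitary form of the transform is a windowed Fourier transform. *)
Lemma bargmann_kernel_weight (x y t : Rn n) :
  bargmann_kernel x (complex_vec (y, t)) * (weight (y, t))%:C =
  (bargmann_const n * Num.sqrt (pi ^- n))%:C * cexp (0 +i* rdot y t) *
  ((shifted_gaussian t x)%:C * wave x y).
Proof.
rewrite /bargmann_kernel weightE !rmorphM /= -!/(real_complex _ _).
rewrite /shifted_gaussian -!cexpr /wave.
set c := (bargmann_const n)%:C; set k := (Num.sqrt _)%:C.
rewrite mulrACA -[RHS]mulrA; congr (_ * _); rewrite -!cexpD; congr cexp.
apply: complex_ext; rewrite !(ReImE, real_vecE, Re_dotc, Im_dotc) !rdotE.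
- rewrite -[(x, tzero R n).1]/x -[(y, t).1]/y -[(y, t).2]/t (rdotC t x) (rdotC t y).
  by field.
- rewrite -[(x, tzero R n).1]/x -[(y, t).1]/y -[(y, t).2]/t (rdotC t y).
  by field.
Qed.

Lemma measurable_shifted_gaussian d (T : measurableType d) (f g : T -> Rn n) :
  measurable_fun setT f -> measurable_fun setT g ->
  measurable_fun setT (fun p => shifted_gaussian (f p) (g p)).
Proof.
move=> mf mg; apply: measurableT_comp; first exact: measurable_expR.
apply: measurableT_comp => //.
have mt : measurable_fun setT (fun p => taff 1 (g p) (f p)).
  exact: (measurableT_comp (@measurable_taff R n 1) (measurable_fun_pair mg mf)).
exact: measurable_rdot.
Qed.

Lemma shifted_gaussian_ge0 t x : 0 <= shifted_gaussian t x.
Proof. exact: expR_ge0. Qed.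

Lemma shifted_gaussian_le1 t x : shifted_gaussian t x <= 1.
Proof. by rewrite -expR0 ler_expR oppr_le0 rdot_ge0. Qed.

Lemma shifted_gaussianC t x : shifted_gaussian t x = shifted_gaussian x t.
Proof.
by rewrite /shifted_gaussian !rdotE (rdotC t x); congr expR; ring.
Qed.

Lemma integral_sqr_shifted_gaussian x :
  (\int[mu]_t (shifted_gaussian t x ^+ 2)%:E = (Num.sqrt (pi / 2) ^+ n)%:E)%E.
Proof.
have [_ /(_ (fun t => (expR (- (2 * rdot t t)))%:E))] := transports_shift x.
have mG : measurable_fun setT (fun t : Rn n => (expR (- (2 * rdot t t)))%:E).
  by apply/measurable_EFinP; exact: (@measurable_gaussian R n 2).
move=> /(_ mG) H; have {}H := H (fun t => expR_ge0 _).
rewrite (integral_gaussian n (ltr0Sn R 1)) mul1e in H; rewrite -H.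
apply: eq_integral => t _; rewrite expr2 -expRD; congr (expR _)%:E; ring.
Qed.

Lemma L2_shifted_gaussian t : L2 mu (fun x => (shifted_gaussian t x)%:C).
Proof.
split; first exact/cmeasurable_real/measurable_shifted_gaussian.
rewrite /l2sq; under eq_integral do rewrite normcr real_normK ?num_real// shifted_gaussianC.
by rewrite integral_sqr_shifted_gaussian ltry.
Qed.

Lemma L2_bargmann_kernel z : L2 mu (fun x => bargmann_kernel x z).
Proof.
rewrite -(vec_pairK z); move: (vec_pair z) => -[y t].
have w0 := weight_gt0 (y, t).
have -> : (fun x => bargmann_kernel x (complex_vec (y, t))) = (fun x =>
    (weight (y, t))^-1%:C * ((bargmann_const n * Num.sqrt (pi ^- n))%:C * cexp (0 +i* rdot y t)) *
    (wave x y * (shifted_gaussian t x)%:C)).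
  apply/funext => x; rewrite [wave _ _ * _]mulrC -[RHS]mulrA -bargmann_kernel_weight mulrCA.
  by rewrite -rmorphM mulVf ?gt_eqF// mulr1.
apply: L2Z; apply: (L2_bounded_mul (M := 1)); last exact: L2_shifted_gaussian.
- exact: cmeasurable_wave.
- by move=> x; rewrite normc_wave.
Qed.

Lemma cmeasurable_bargmann_kernel :
  cmeasurable (fun q : (Rn n * Rn n) * Rn n => bargmann_kernel q.2 (complex_vec q.1)).
Proof.
have mr : measurable_fun setT (fun q : (Rn n * Rn n) * Rn n => (q.2, tzero R n)).
  exact: measurable_fun_pair.
have mp : measurable_fun setT (fun q : (Rn n * Rn n) * Rn n => q.1) by exact: measurable_fst.
apply: cmeasurableM; first exact: cmeasurable_cst.
under eq_fun do rewrite real_vecE.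
apply: cmeasurable_cexp; apply: cmeasurableB; last exact: cmeasurable_complex_dotc.
apply: cmeasurableD; apply: cmeasurableM; try exact: cmeasurable_cst;
  exact: cmeasurable_complex_dotc.
Qed.

Lemma cmeasurable_weight : cmeasurable (fun p : Rn n * Rn n => (weight p)%:C).
Proof.
apply: (cmeasurable_real (h := @weight n)); rewrite (_ : @weight n = fun p =>
  Num.sqrt (pi ^- n) * expR (- (2^-1 * (rdot p.1 p.1 + rdot p.2 p.2)))); last first.
  by apply/funext => p; rewrite weightE.
apply: measurable_funM => //; apply: measurableT_comp; first exact: measurable_expR.
apply: measurableT_comp => //; apply: measurable_funM => //; apply: measurable_funD;
  exact: measurable_rdot.
Qed.

Lemma cmeasurable_weighted_bargmann f : cmeasurable f -> cmeasurable (weighted (bargmann f)).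
Proof.
move=> mf; apply: cmeasurableM; last exact: cmeasurable_weight.
apply: (@cmeasurable_cintegral2 _ _ _ _ _ mu
  (fun q : (Rn n * Rn n) * Rn n => f q.2 * bargmann_kernel q.2 (complex_vec q.1))).
apply: cmeasurableM; last exact: cmeasurable_bargmann_kernel.
exact: (cmeasurable_comp (h := snd)).
Qed.

Lemma bargmann_cintegrable f z : L2 mu f -> cintegrable mu (fun x => f x * bargmann_kernel x z).
Proof. by move=> f2; apply: L2_cintegrable => //; exact: L2_bargmann_kernel. Qed.

Lemma weighted_bargmannE f y t : L2 mu f ->
  weighted (bargmann f) (y, t) =
  (bargmann_const n * Num.sqrt (pi ^- n))%:C * cexp (0 +i* rdot y t) *
  fourier (fun x => f x * (shifted_gaussian t x)%:C) y.
Proof.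
move=> f2; rewrite /weighted mulrC -cintegralZ; last exact: bargmann_cintegrable.
rewrite -cintegralZ; last first.
  apply: cintegrable_wave; apply: L2_cintegrable => //; exact: L2_shifted_gaussian.
apply: eq_cintegral => x; rewrite [LHS]mulrC -[LHS]mulrA bargmann_kernel_weight.
by rewrite mulrCA -(mulrA (f x)).
Qed.

(** For fixed [t] the windowed function [g t] is integrable as well as square integrable, so
    Plancherel applies in [y]. Tonelli then integrates the squared window over [t]. Its mass is the
    same for every [x] and cancels the constants. *)
Lemma l2sq_weighted_bargmann f : L2 mu f -> l2sq (leb2 n) (weighted (bargmann f)) = l2sq mu f.
Proof.
move=> f2; have [mf _] := f2.
pose g t x := f x * (shifted_gaussian t x)%:C.
have g2 t : L2 mu (g t).
  rewrite /g; under eq_fun do rewrite mulrC.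
  apply: (L2_bounded_mul (M := 1)) => //.
    exact/cmeasurable_real/measurable_shifted_gaussian.
  by move=> x; rewrite normcr ger0_norm ?shifted_gaussian_ge0 ?shifted_gaussian_le1.
have gi t : cintegrable mu (g t) by apply: L2_cintegrable => //; exact: L2_shifted_gaussian.
have mW := cmeasurable_weighted_bargmann mf.
have c1 : (bargmann_const n * Num.sqrt (pi ^- n)) ^+ 2 * pi ^+ n = bargmann_const n ^+ 2.
  rewrite exprMn [Num.sqrt (pi ^- n) ^+ 2]sqr_sqrtr ?invr_ge0 ?exprn_ge0 ?pi_ge0// -mulrA.
  by rewrite mulVf ?mulr1// gt_eqF// exprn_gt0// pi_gt0.
have slice t : (\int[mu]_y (normc (weighted (bargmann f) (y, t)) ^+ 2)%:E =
    (bargmann_const n ^+ 2)%:E * \int[mu]_x (normc (f x) ^+ 2 * shifted_gaussian t x ^+ 2)%:E)%E.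
  under eq_integral => y _.
    rewrite weighted_bargmannE// -/(g t) normcM [normc (_%:C * _)]normcM normc_cexp Re_mk expR0 mulr1 exprMn EFinM.
    over.
  rewrite ge0_integralZl//; first last.
  - by rewrite lee_fin sqr_ge0.
  - by move=> y _; rewrite lee_fin sqr_ge0.
  - by apply: measurable_sqr_normc; apply: cmeasurable_fourier; case: (g2 t).
  rewrite -/(l2sq mu (fourier (g t))) plancherel// normcr real_normK ?num_real//.
  rewrite -EFinM mulrA c1 EFinM l2nE//; congr (_ * _)%E; apply: eq_integral => x _.
  by rewrite normcM exprMn normcr real_normK ?num_real.
rewrite /l2sq fubini_tonelli2; last 2 first.
- exact: measurable_sqr_normc.
- by move=> p; rewrite lee_fin sqr_ge0.
transitivity (\int[mu]_t ((bargmann_const n ^+ 2)%:E *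
    \int[mu]_x (normc (f x) ^+ 2 * shifted_gaussian t x ^+ 2)%:E))%E.
  by apply: eq_integral => t _; rewrite -slice.
pose h (p : Rn n * Rn n) : \bar R := (normc (f p.2) ^+ 2 * shifted_gaussian p.1 p.2 ^+ 2)%:E.
have mh : measurable_fun setT h.
  apply/measurable_EFinP; apply: measurable_funM; last first.
    by apply: measurable_funX; exact: measurable_shifted_gaussian.
  by apply: measurable_funX; apply: measurable_normc; exact: (cmeasurable_comp (h := snd)).
have h0 p : (0 <= h p)%E by rewrite lee_fin mulr_ge0 ?sqr_ge0.
rewrite ge0_integralZl//; first last.
- by rewrite lee_fin sqr_ge0.
- by move=> t _; apply: integral_ge0 => x _; rewrite lee_fin mulr_ge0 ?sqr_ge0.
- exact: (measurable_fun_fubini_tonelli_F h mh h0).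
rewrite (fubini_tonelli h mh h0) -ge0_integralZl//; first last.
- by rewrite lee_fin sqr_ge0.
- by move=> t _; apply: integral_ge0 => x _; rewrite lee_fin mulr_ge0 ?sqr_ge0.
- exact: (measurable_fun_fubini_tonelli_G h mh h0).
have e x : (\int[mu]_t (normc (f x) ^+ 2 * shifted_gaussian t x ^+ 2)%:E =
    (normc (f x) ^+ 2 * Num.sqrt (pi / 2) ^+ n)%:E)%E.
  rewrite EFinM -(integral_sqr_shifted_gaussian x) -ge0_integralZl ?lee_fin ?sqr_ge0//.
  - by apply/measurable_EFinP; apply: measurable_funX; exact: measurable_shifted_gaussian.
  - by move=> t _; rewrite lee_fin sqr_ge0.
apply: eq_integral => x _.
transitivity ((bargmann_const n ^+ 2)%:E * (normc (f x) ^+ 2 * Num.sqrt (pi / 2) ^+ n)%:E)%E.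
  by congr (_ * _)%E; exact: e.
by rewrite -EFinM mulrCA sqr_bargmann_const_gaussian mulr1.
Qed.

Lemma L2_weighted_bargmann f : L2 mu f -> L2 (leb2 n) (weighted (bargmann f)).
Proof.
move=> f2; have [mf fi] := f2; split; first exact: cmeasurable_weighted_bargmann.
by rewrite l2sq_weighted_bargmann.
Qed.

Lemma l2n_weighted_bargmann f : L2 mu f -> l2n (leb2 n) (weighted (bargmann f)) = l2n mu f.
Proof. by move=> f2; rewrite /l2n l2sq_weighted_bargmann. Qed.

Lemma bargmannD f g z : L2 mu f -> L2 mu g ->
  bargmann (fun x => f x + g x) z = bargmann f z + bargmann g z.
Proof.
move=> f2 g2; rewrite -cintegralD; [|exact: bargmann_cintegrable..].
by apply: eq_cintegral => x; rewrite mulrDl.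
Qed.

Lemma bargmannZ c f z : L2 mu f -> bargmann (fun x => c * f x) z = c * bargmann f z.
Proof.
move=> f2; rewrite -cintegralZ; last exact: bargmann_cintegrable.
by apply: eq_cintegral => x; rewrite mulrA.
Qed.

(** Polarization: the norms of [h], [g] and [h + g] determine the real part, and [h = i f] gives the
    imaginary part. *)
Lemma cdot_weighted_bargmann f g : L2 mu f -> L2 mu g ->
  cdot (leb2 n) (weighted (bargmann f)) (weighted (bargmann g)) = cdot mu f g.
Proof.
move=> f2 g2.
have Re_eq h : L2 mu h -> complex.Re (cdot (leb2 n) (weighted (bargmann h)) (weighted (bargmann g)))
    = complex.Re (cdot mu h g).
  move=> h2; have := l2n_weighted_bargmann (L2D h2 g2); rewrite l2nD//.
  have -> : weighted (bargmann (fun x => h x + g x)) =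
      (fun p => weighted (bargmann h) p + weighted (bargmann g) p).
    by apply/funext => p; rewrite /weighted bargmannD// mulrDl.
  rewrite l2nD; [|exact: L2_weighted_bargmann..].
  by rewrite !l2n_weighted_bargmann// => /addrI /mulfI; apply.
apply: complex_ext; first exact: Re_eq.
have := Re_eq _ (L2Z 'i%C f2).
have -> : weighted (bargmann (fun x => 'i%C * f x)) =
    (fun p => 'i%C * weighted (bargmann f) p).
  by apply/funext => p; rewrite /weighted bargmannZ// mulrA.
rewrite !cdotZl//; [|exact: L2_weighted_bargmann..].
by rewrite !ReImE !mul0r !mul1r !sub0r => /oppr_inj.
Qed.

End bargmann.

(** * Complex differentiability in several variables *)

Section linear_form.
Variables (K : numFieldType) (n : nat).

Definition linear_form (c h : 'rV[K]_n.+1) : K^o := \sum_j h 0 j * c 0 j.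

Lemma linear_form_is_linear c : linear (linear_form c).
Proof.
move=> k a b; rewrite /linear_form scaler_sumr -big_split; apply: eq_bigr => j _.
by rewrite !mxE mulrDl /= -mulrA.
Qed.

HB.instance Definition _ c :=
  GRing.isLinear.Build K 'rV[K]_n.+1 K^o *:%R (linear_form c) (linear_form_is_linear c).

Lemma linear_form_continuous c : continuous (linear_form c).
Proof.
rewrite /linear_form; elim: (index_enum _) => [|j t IH] h.
  rewrite (_ : (fun h0 : 'rV[K]_n.+1 => _) = fun=> 0); first exact: cst_continuous.
  by apply/funext => h0; rewrite big_nil.
rewrite (_ : (fun h0 : 'rV[K]_n.+1 => _) =
    fun h0 => h0 0 j * c 0 j + \sum_(i <- t) h0 0 i * c 0 i); last first.
  by apply/funext => h0; rewrite big_cons.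
have cj := @cvgM K _ (nbhs h) _ _ _ _ _ (@coord_continuous K 1 n.+1 0 j h) (cvg_cst (c 0 j)).
pose a (h0 : 'rV[K]_n.+1) : K^o := h0 0 j * c 0 j.
pose b (h0 : 'rV[K]_n.+1) : K^o := \sum_(i <- t) h0 0 i * c 0 i.
have ca : a @ h --> a h by exact: cj.
have cb : b @ h --> b h by exact: IH.
exact: (cvgD ca cb).
Qed.

Lemma le_entry_norm (h : 'rV[K]_n.+1) j : `|h 0 j| <= `|h|.
Proof.
rewrite [leRHS]/Num.norm /= mx_normE -[leLHS]nngE num_le.
exact: (le_bigmax _ _ (0, j)).
Qed.

(** The expansion identifies the candidate linear form as the differential by uniqueness, which
    turns an explicit epsilon-delta estimate into [differentiable]. *)
Lemma differentiable_linear_form (F : 'rV[K]_n.+1 -> K^o) (z c : 'rV[K]_n.+1) :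
  (forall e, 0 < e -> exists2 d, 0 < d & forall h, `|h| < d ->
    `|F (h + z) - F z - linear_form c h| <= e * `|h|) -> differentiable F z.
Proof.
move=> H; have lin : F \o shift z = cst (F z) + linear_form c +o_ (0 : 'rV[K]_n.+1) id.
  apply/eqaddoP => e /H[d d0 hd]; apply/(@nbhs_norm0P K 'rV[K]_n.+1); exists d => // h /hd.
  by rewrite -addrA -opprD.
apply/diff_locallyP; rewrite (diff_unique (@linear_form_continuous c) lin).
by split; [exact: linear_form_continuous|].
Qed.

Lemma differentiable_approx (F : 'rV[K]_n.+1 -> K^o) (z : 'rV[K]_n.+1) :
  differentiable F z -> exists df : {linear 'rV[K]_n.+1 -> K^o},
    forall e, 0 < e -> exists2 d, 0 < d & forall h, `|h| < d ->
      `|F (h + z) - F z - df h| <= e * `|h|.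
Proof.
move=> /diff_locallyP[_ /eqaddoP H]; exists ('d F z) => e /H/nbhs_norm0P[d d0 hd].
by exists d => // h /hd; rewrite -addrA -opprD.
Qed.

End linear_form.

Section complex_differentiability.
Variables (R : realType) (n : nat).
Notation Cn := 'rV[R[i]]_n.+1.

(** The norm of a complex row vector takes its values in [R[i]]. Being nonnegative it is real, so
    its real part loses nothing. *)
Definition vnorm (z : Cn) : R := complex.Re `|z|.

Lemma normr_vnorm (z : Cn) : `|z| = (vnorm z)%:C.
Proof.
have := normr_ge0 z; rewrite lecE => /andP[/eqP + _].
by rewrite cIm0 => h; apply: complex_ext; rewrite ?ReImE.
Qed.

Lemma vnorm_ge0 (z : Cn) : 0 <= vnorm z.
Proof. by have := normr_ge0 z; rewrite lecE => /andP[_]. Qed.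

Lemma normc_entry_le (z : Cn) j : normc (z 0 j) <= vnorm z.
Proof.
by rewrite -lecR -normr_normc -normr_vnorm; exact: le_entry_norm.
Qed.

Lemma vnormZ (c : R[i]) (z : Cn) : vnorm (c *: z) = normc c * vnorm z.
Proof.
have /(congr1 (@complex.Re R)) : `|c *: z| = (normc c * vnorm z)%:C.
  by rewrite normrZ normr_normc normr_vnorm rmorphM.
by [].
Qed.

(** The order of [R[i]] compares only numbers with equal imaginary parts. Every positive epsilon or
    delta of a complex differentiability statement is therefore real. *)
Lemma vnorm_gt0 (e : R[i]) : 0 < e -> exists2 r : R, 0 < r & e = r%:C.
Proof.
rewrite ltcE => /andP[/eqP + e0]; rewrite cIm0 => ei.
by exists (complex.Re e) => //; apply: complex_ext; rewrite ?ReImE.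
Qed.

Lemma entire_quadratic (F : Cn -> R[i]^o) :
  (forall z, exists (c : Cn) (M : R), forall h, vnorm h <= 1 ->
    normc (F (h + z) - F z - dotc h c) <= M * vnorm h ^+ 2) -> entire F.
Proof.
move=> H z; have [c [M FM]] := H z; apply: (@differentiable_linear_form _ _ F z c).
(* For [vnorm h < d] one has [M * vnorm h ^+ 2 <= e * vnorm h]; the [+ 1] allows [M = 0]. *)
move=> _ /vnorm_gt0[e e0 ->]; pose d := Num.min 1 (e / (`|M| + 1)).
have M1 : 0 < `|M| + 1 by rewrite ltr_wpDl.
have d0 : 0 < d by rewrite lt_min ltr01 divr_gt0.
exists d%:C; first by rewrite ltcR.
move=> h; rewrite !normr_vnorm ltcR lt_min => /andP[h1 hM].
rewrite normr_normc -rmorphM lecR.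
apply: le_trans (FM h (ltW h1)) _.
rewrite expr2 mulrA ler_wpM2r ?vnorm_ge0//.
move: hM; rewrite ltr_pdivlMr// => hM; apply: le_trans (ltW hM).
by rewrite mulrC ler_wpM2l ?vnorm_ge0// (le_trans (ler_norm _))// lerDl ler01.
Qed.

(** The difference quotient along [v], completed by [df v] at the base point, is the continuous
    slope of Caratheodory's form. This connects [entire] with the one-variable results. *)
Lemma entire_cdiff_line (F : Cn -> R[i]^o) (z v : Cn) :
  entire F -> cdiff (fun w => F (z + w *: v)).
Proof.
move=> dF w0; set z0 := z + w0 *: v; have [df ho] := differentiable_approx (dF z0).
exists (fun w => if w == w0 then df v else (F (z + w *: v) - F z0) / (w - w0)); last first.
  move=> w; case: eqP => [->|/eqP ww]; first by rewrite subrr mulr0 addr0.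
  by rewrite divfK ?subr_eq0// [RHS]addrC subrK.
move=> e e0; have v1 : 0 < vnorm v + 1 by rewrite ltr_wpDl// vnorm_ge0.
have e1 : 0 < (e / 2 / (vnorm v + 1))%:C :> R[i] by rewrite ltcR !divr_gt0.
have [_ /vnorm_gt0[d d0 ->] hd] := ho _ e1.
exists (d / (vnorm v + 1)); first by rewrite divr_gt0.
move=> w wd; rewrite eqxx; case: eqP => [_|/eqP ww]; first by rewrite subrr normc0.
set h := (w - w0) *: v.
have hE : z + w *: v = h + z0 by rewrite /h /z0 scalerBl addrCA subrK.
have wn : 0 < normc (w - w0) by rewrite normc_gt0 subr_eq0.
have /hd : `|h| < d%:C.
  rewrite normr_vnorm ltcR vnormZ; move: wd; rewrite ltr_pdivlMr// => wd.
  by apply: le_lt_trans wd; rewrite ler_wpM2l ?normc_ge0// lerDl.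
rewrite normr_normc !normr_vnorm -rmorphM lecR vnormZ => H.
have -> : (F (z + w *: v) - F z0) / (w - w0) - df v = (F (h + z0) - F z0 - df h) / (w - w0).
  rewrite hE linearZ [RHS]mulrBl; congr (_ - _).
  by rewrite /GRing.scale /= mulrC mulKf ?subr_eq0.
rewrite normcM normcV// ltr_pdivrMr//; apply: (le_lt_trans H).
rewrite mulrCA [ltRHS]mulrC ltr_pM2l//.
apply: (@le_lt_trans _ _ (e / 2 / (vnorm v + 1) * (vnorm v + 1))).
  by rewrite ler_wpM2l ?lerDl// !divr_ge0// ltW.
by rewrite divfK ?gt_eqF// ltr_pdivrMr// ltr_pMr// ltr1n.
Qed.

End complex_differentiability.

(** * Holomorphy of the Bargmann transform *)

Section bargmann_entire.
Variables (R : realType) (n : nat).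
Notation Rn := (n.+1.-tuple (measurableTypeR R)).
Notation Cn := 'rV[R[i]]_n.+1.
Notation mu := (lebesgue_n R n.+1).
Implicit Types (f : Rn -> R[i]) (z h : Cn) (x : Rn).

Definition l1norm x : R := \sum_(j < n.+1) `|tnth x j : R|.

Lemma l1norm_ge0 x : 0 <= l1norm x.
Proof. by apply: sumr_ge0. Qed.

Lemma measurable_l1norm : measurable_fun setT l1norm.
Proof.
apply: measurable_sum => j; apply: measurableT_comp => //; exact: measurable_tnth.
Qed.

(** Coordinatewise [C |a| <= a^2 / 4 + C^2], from [(|a| / 2 - C)^2 >= 0]. An exponential of [l1norm]
    thus costs only a quarter of the Gaussian exponent. *)
Lemma l1norm_le (C : R) x : C * l1norm x <= 4^-1 * rdot x x + n.+1%:R * C ^+ 2.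
Proof.
rewrite /l1norm /rdot !mulr_sumr -[n.+1%:R]/(n.+1%:R) mulrC -mulr_natl mulrC.
have -> : n.+1%:R * C ^+ 2 = \sum_(j < n.+1) C ^+ 2.
  by rewrite sumr_const card_ord mulr_natl.
rewrite -big_split; apply: ler_sum => j _ /=.
set a := tnth x j : R; have : a * a = `|a| * `|a| by rewrite -!expr2 real_normK ?num_real.
move=> ->; have := sqr_ge0 (`|a| / 2 - C); lra.
Qed.

Lemma L2_bargmann_kernel_exp z C :
  L2 mu (fun x => bargmann_kernel x z * (expR (C * l1norm x))%:C).
Proof.
rewrite -(vec_pairK z); move: (vec_pair z) => -[y t].
have w0 := weight_gt0 (y, t).
have mk : cmeasurable (fun x => bargmann_kernel x (complex_vec (y, t)) * (expR (C * l1norm x))%:C).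
  apply: cmeasurableM; first by have [] := L2_bargmann_kernel (complex_vec (y, t)).
  apply: cmeasurable_real; apply: measurableT_comp; first exact: measurable_expR.
  by apply: measurable_funM => //; exact: measurable_l1norm.
pose K := (weight (y, t))^-1 * (bargmann_const R n.+1 * Num.sqrt (pi ^- n.+1)) *
  (expR (rdot t t) * expR (n.+1%:R * C ^+ 2)).
have K0 : 0 <= K.
  rewrite !mulr_ge0 ?expR_ge0 ?sqrtr_ge0 ?invr_ge0 ?ltW//; exact: bargmann_const_gt0.
have gL2 : L2 mu (fun x => K%:C * (expR (- (4^-1 * rdot x x)))%:C).
  apply: L2Z; split; first by apply: cmeasurable_real; exact: (@measurable_gaussian R n.+1 4^-1).
  rewrite /l2sq; under eq_integral => x _.
    rewrite normcr real_normK ?num_real// expr2 -expRD.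
    rewrite (_ : _ + _ = - (2^-1 * rdot x x)); last by field.
    over.
  by rewrite integral_gaussian ?ltry.
apply: (le_L2 mk gL2) => x.
have -> : bargmann_kernel x (complex_vec (y, t)) = (weight (y, t))^-1%:C *
    (bargmann_kernel x (complex_vec (y, t)) * (weight (y, t))%:C).
  by rewrite mulrCA -rmorphM mulVf ?gt_eqF// mulr1.
rewrite bargmann_kernel_weight normcM [normc (_ * (_ * _ * _))]normcM.
rewrite [normc (_ * (_ * _))]normcM [normc (_ * cexp _)]normcM normc_cexp Re_mk expR0 mulr1.
rewrite [normc (_ * wave _ _)]normcM normc_wave mulr1 [leRHS]normcM !normcr.
rewrite !ger0_norm ?expR_ge0 ?shifted_gaussian_ge0 ?invr_ge0 ?(ltW w0)//; last first.
  by rewrite mulr_ge0 ?sqrtr_ge0// ltW// bargmann_const_gt0.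
rewrite /K -!mulrA; do 3 (rewrite ler_wpM2l ?sqrtr_ge0 ?invr_ge0 ?(ltW w0) ?(ltW (bargmann_const_gt0 _ _))//).
rewrite -!expRD ler_expR.
(* [|x + 2 t|^2 >= 0] absorbs the cross term of [|x + t|^2] and leaves [e^(- x.x / 4)]. *)
have := l1norm_le C x; have := rdot_ge0 (taff 2 x t).
rewrite !rdotE (rdotC t x); lra.
Qed.

Lemma normc_half : normc (2^-1 : R[i]) = 2^-1.
Proof.
by rewrite (_ : 2^-1 = (2^-1 : R)%:C) ?normcr ?ger0_norm ?invr_ge0// fmorphV rmorph_nat.
Qed.

Lemma normc_i : normc ('i%C : R[i]) = 1.
Proof. by rewrite /normc expr0n expr1n add0r sqrtr1. Qed.

Lemma normc_2i (a : R) : normc (2 * 'i%C * a%:C) = 2 * `|a|.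
Proof.
rewrite 2!normcM normc_i mulr1 normcr; congr (_ * _).
by rewrite (_ : 2 = 2%:C) ?normcr ?rmorph_nat// normr_nat.
Qed.

Lemma cintegrable_sum d (T : measurableType d) (nu : {measure set T -> \bar R})
    (I : Type) (s : seq I) (F : I -> T -> R[i]) :
  (forall i, cintegrable nu (F i)) -> cintegrable nu (fun t => \sum_(i <- s) F i t).
Proof.
move=> Fi; elim: s => [|i s IH].
  under eq_fun do rewrite big_nil.
  by split; exact: integrable0.
by under eq_fun do rewrite big_cons; exact: cintegrableD.
Qed.

Lemma normc_dotc_le h z : normc (dotc h z) <= vnorm h * \sum_j normc (z 0 j).
Proof.
apply: le_trans (normc_sum _ _ _) _; rewrite mulr_sumr; apply: ler_sum => j _.
by rewrite normcM ler_wpM2r ?normc_ge0// normc_entry_le.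
Qed.

(** Moving [z] by [h] multiplies the kernel by [e^u] with [u = l + h.h / 2], [l] being linear in
    [h]. With [a = 2 s + Z + N], [s] the [l1norm] of [x], one has [|u| <= r a] and
    [a^2 e^a <= e^(3 a)]. The [2 s] inside [3 a] is the source of [6 * l1norm x]. *)
Lemma bargmann_kernel_remainder z h x : vnorm h <= 1 ->
  normc (bargmann_kernel x (h + z) - bargmann_kernel x z -
    bargmann_kernel x z * dotc h ((2 * 'i%C) *: real_vec x + z)) <=
  (4 + n.+1%:R) * expR (3 * (\sum_j normc (z 0 j) + n.+1%:R)) * vnorm h ^+ 2 *
  normc (bargmann_kernel x z * (expR (6 * l1norm x))%:C).
Proof.
move=> h1; set N : R := n.+1%:R; set Z := \sum_j _; set r := vnorm h.
set l := dotc h _; pose u := l + dotc h h / 2.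
have r0 : 0 <= r := vnorm_ge0 h.
have N0 : 0 <= N by rewrite ler0n.
have Z0 : 0 <= Z by apply: sumr_ge0 => j _; exact: normc_ge0.
have s0 := l1norm_ge0 x; set s := l1norm x in s0 *.
have -> : bargmann_kernel x (h + z) = bargmann_kernel x z * cexp u.
  rewrite /bargmann_kernel -[RHS]mulrA -cexpD /u /l; congr (_ * cexp _).
  by rewrite !dotcE (dotcC h (real_vec x)) (dotcC z h); field.
have -> : bargmann_kernel x z * cexp u - bargmann_kernel x z - bargmann_kernel x z * l =
    bargmann_kernel x z * (cexp u - 1 - u + dotc h h / 2) by rewrite /u; ring.
move: (bargmann_kernel x z) => k.
rewrite normcM [normc (k * _%:C)]normcM [leRHS]mulrCA ler_wpM2l ?normc_ge0//.
have lle : normc l <= r * (2 * s + Z).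
  apply: le_trans (normc_dotc_le _ _) _; rewrite ler_wpM2l//.
  rewrite /s /l1norm /Z mulr_sumr -big_split; apply: ler_sum => j _; rewrite !mxE.
  by apply: le_trans (le_normcD _ _) _; rewrite lerD2r normc_2i.
have hhle : normc (dotc h h) <= r ^+ 2 * N.
  apply: le_trans (normc_dotc_le _ _) _; rewrite expr2 -mulrA ler_wpM2l//.
  rewrite (_ : r * N = \sum_(j < n.+1) r); last by rewrite sumr_const card_ord mulr_natr.
  by apply: ler_sum => j _; exact: normc_entry_le.
pose a := 2 * s + Z + N.
have a0 : 0 <= a by rewrite !addr_ge0// mulr_ge0.
have half : normc (dotc h h / 2) <= normc (dotc h h).
  by rewrite normcM normc_half ler_piMr ?normc_ge0// invf_le1// ler1n.
have ule : normc u <= r * a.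
  apply: le_trans (le_normcD _ _) _.
  rewrite /a mulrDr; apply: lerD => //; apply: (le_trans half); apply: (le_trans hhle).
  by rewrite expr2 -mulrA ler_piMl// mulr_ge0.
have ule1 : normc u <= a by apply: (le_trans ule); rewrite ler_piMl.
apply: le_trans (le_normcD _ _) _.
have E1 : 1 <= expR (3 * a) by rewrite -expR0 ler_expR mulr_ge0.
have E2 : a ^+ 2 * expR a <= expR (3 * a).
  rewrite (_ : 3 * a = a + a + a); last by ring.
  rewrite (expRD (a + a)) (expRD a a) expr2 ler_wpM2r ?expR_ge0//.
  by have := expR_ge1Dx a => aE; rewrite ler_pM// (le_trans _ aE)// lerDr.
have b1 : normc (cexp u - 1 - u) <= 4 * r ^+ 2 * expR (3 * a).
  apply: le_trans (normc_cexpB1B u) _.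
  apply: (@le_trans _ _ (4 * (r * a) ^+ 2 * expR a)).
    apply: ler_pM => //.
    - by rewrite mulr_ge0// sqr_ge0.
    - by rewrite ler_wpM2l// ler_sqr ?nnegrE ?normc_ge0// mulr_ge0.
    - by rewrite ler_expR.
  by rewrite exprMn mulrA -mulrA ler_wpM2l// mulr_ge0// sqr_ge0.
have b2 : normc (dotc h h / 2) <= N * r ^+ 2 * expR (3 * a).
  apply: (le_trans half); apply: (le_trans hhle); rewrite mulrC ler_peMr//.
  by rewrite mulr_ge0// sqr_ge0.
apply: (le_trans (lerD b1 b2)).
rewrite normcr ger0_norm ?expR_ge0//.
rewrite (_ : 3 * a = 3 * (Z + N) + 6 * s) ?expRD; last by rewrite /a; ring.
by rewrite le_eqVlt; apply/orP; left; apply/eqP; ring.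
Qed.

(** Differentiation under the integral: the remainder of the kernel is at most [vnorm h ^+ 2] times
    a function that does not depend on [h] and is integrable against [f]. *)
Lemma entire_bargmann f : L2 mu f -> entire (bargmann f).
Proof.
move=> f2; apply: entire_quadratic => z.
have fi : cintegrable mu
    (fun x => f x * (bargmann_kernel x z * (expR (6 * l1norm x))%:C)).
  by apply: L2_cintegrable => //; exact: L2_bargmann_kernel_exp.
have mk := (L2_bargmann_kernel z).1; have [mf _] := f2.
pose v x : Cn := (2 * 'i%C) *: real_vec x + z.
have mvj j : cmeasurable (fun x => v x 0 j).
  rewrite (_ : (fun x => _) = fun x => 2 * 'i%C * (tnth x j : R)%:C + z 0 j).
    apply: cmeasurableD; last exact: cmeasurable_cst.
    apply: cmeasurableM; first exact: cmeasurable_cst.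
    by apply: cmeasurable_real; exact: measurable_tnth.
  by apply/funext => x; rewrite !mxE.
pose Z := \sum_j normc (z 0 j).
have vji j : cintegrable mu (fun x => f x * bargmann_kernel x z * v x 0 j).
  apply: (cintegrable_le (g := fun x => expR Z *
    normc (f x * (bargmann_kernel x z * (expR (6 * l1norm x))%:C)))).
  - by apply: cmeasurableM => //; exact: cmeasurableM.
  - exact: (integrableZl measurableT (expR Z) (integrable_normc fi)).
  - move=> x; rewrite mulrA [leRHS]mulrC !(normcM (f x * bargmann_kernel x z)).
    rewrite -mulrA ler_wpM2l ?normc_ge0// normcr ger0_norm ?expR_ge0// -expRD.
    rewrite !mxE; apply: le_trans (le_normcD _ _) _.
    rewrite normc_2i.
    have xj : `|tnth x j : R| <= l1norm x by rewrite /l1norm (bigD1 j)//= lerDl sumr_ge0.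
    have zj : normc (z 0 j) <= Z.
      by rewrite /Z (bigD1 j)//= lerDl; apply: sumr_ge0 => i _; exact: normc_ge0.
    have := expR_ge1Dx (6 * l1norm x + Z); have := l1norm_ge0 x.
    have := normr_ge0 (tnth x j : R); lra.
pose c : Cn := \row_j cintegral mu (fun x => f x * bargmann_kernel x z * v x 0 j).
have cE h : dotc h c = cintegral mu (fun x => f x * (bargmann_kernel x z * dotc h (v x))).
  transitivity (cintegral mu
      (fun x => \sum_(j < n.+1) h 0 j * (f x * bargmann_kernel x z * v x 0 j))).
    rewrite cintegral_sum; last by move=> j; exact: cintegrableZ.
    by apply: eq_bigr => j _; rewrite cintegralZ// mxE.
  apply: eq_cintegral => x; rewrite mulrA mulr_sumr; apply: eq_bigr => j _.
  by rewrite mulrCA.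
pose M := (4 + n.+1%:R) * expR (3 * (Z + n.+1%:R)).
exists c, (M * \int[mu]_x normc (f x * (bargmann_kernel x z * (expR (6 * l1norm x))%:C))).
move=> h h1; rewrite cE.
have i1 : cintegrable mu (fun x => f x * (bargmann_kernel x z * dotc h (v x))).
  under eq_fun do rewrite mulrA mulr_sumr.
  have := cintegrable_sum (index_enum 'I_n.+1) (fun j => cintegrableZ (h 0 j) (vji j)).
  by congr cintegrable; apply/funext => x; apply: eq_bigr => j _; rewrite mulrCA.
have i2 := bargmann_cintegrable z f2; have i3 := bargmann_cintegrable (h + z) f2.
rewrite /bargmann -cintegralB// -cintegralB//; last exact: cintegrableB.
have i4 : cintegrable mu (fun x => f x * bargmann_kernel x (h + z) -
    f x * bargmann_kernel x z - f x * (bargmann_kernel x z * dotc h (v x))).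
  by do 2 apply: cintegrableB => //.
apply: le_trans (normc_cintegral i4) _.
have ni := integrable_normc fi.
rewrite -mulrA [X in _ * X]mulrC mulrA -RintegralZl//.
apply: le_Rintegral => //; first exact: (integrable_normc i4).
  exact: (integrableZl measurableT _ ni).
move=> x _; rewrite -2!mulrBr normcM [leRHS]mulrC (normcM (f x)) -[leRHS]mulrA.
rewrite ler_wpM2l ?normc_ge0// [leRHS]mulrC.
exact: bargmann_kernel_remainder.
Qed.

End bargmann_entire.

Lemma normc_cvg_unique (R : realType) (u : nat -> R[i]) a b :
  normc (u k - a) @[k --> \oo] --> (0 : R) -> normc (u k - b) @[k --> \oo] --> (0 : R) ->
  a = b.
Proof.
move=> ua ub; have uab : normc (u k - a) + normc (u k - b) @[k --> \oo] --> (0 : R).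
  by rewrite -(addr0 0); exact: cvgD.
have c : cst (normc (a - b)) @ \oo --> (0 : R).
  apply: (squeeze_cvgr _ _ uab); last exact: cvg_cst.
  apply: nearW => k; rewrite /= normc_ge0/=.
  rewrite (_ : a - b = (u k - b) + - (u k - a)); last by ring.
  by rewrite (le_trans (le_normcD _ _))// normcN addrC.
have H : 0 = normc (a - b) := cvg_unique (@Rhausdorff R) c (cvg_cst _).
by apply/eqP; rewrite -subr_eq0 -normc_eq0 -H.
Qed.

(** * Surjectivity onto the Fock space *)

Section exhaustion.
Context d (T : measurableType d) (R : realType).
Variable mu : {sigma_finite_measure set T -> \bar R}.
Implicit Types f g : T -> R[i].

Lemma exhaustion : exists B : nat -> set T,
  [/\ forall k, measurable (B k), forall k, (mu (B k) < +oo)%E &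
      forall x, \forall k \near \oo, B k x].
Proof.
have /sigma_finiteP[B [BT ndB mB]] := sigma_finiteT mu.
exists B; split=> [k|k|x]; [by have [] := mB k|by have [] := mB k|].
have [k _ Bk] : (\bigcup_i B i) x by rewrite -BT.
by exists k => // l /= kl; have /subsetPset := ndB _ _ kl; exact.
Qed.

Variable A : set T.
Hypothesis mA : measurable A.

Definition restrictC f x : R[i] := f x * (\1_A x)%:C.

Lemma restrictC_le f x : normc (restrictC f x) <= normc (f x).
Proof.
rewrite /restrictC indicE; case: (x \in A); rewrite ?mulr1 ?mulr0//.
by rewrite normc0 normc_ge0.
Qed.

Lemma L2_restrictC f : L2 mu f -> L2 mu (restrictC f).
Proof.
move=> f2; have [mf _] := f2; apply: (le_L2 _ f2); last exact: restrictC_le.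
exact: cmeasurable_restrict.
Qed.

Hypothesis Afin : (mu A < +oo)%E.

Lemma L2_indic : L2 mu (fun x => (\1_A x)%:C).
Proof.
have mI : measurable_fun setT (\1_A : T -> R) by exact: measurable_indic.
split; first exact: cmeasurable_real.
rewrite /l2sq; under eq_integral => x _.
  rewrite normcr real_normK ?num_real// (_ : \1_A x ^+ 2 = \1_A x); last first.
    by rewrite indicE; case: (x \in A); rewrite ?expr1n ?expr0n.
  over.
by rewrite integral_indic// setIT.
Qed.

Lemma restrictC_cintegrable f : L2 mu f -> cintegrable mu (restrictC f).
Proof. by move=> f2; apply: L2_cintegrable => //; exact: L2_indic. Qed.

Lemma bounded_restrictC f (M : R) : cmeasurable f -> (forall x, normc (f x) <= M) ->
  L2 mu (restrictC f) /\ cintegrable mu (restrictC f).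
Proof.
move=> mf fM; have f2 : L2 mu (restrictC f).
  exact: (L2_bounded_mul mf fM L2_indic).
split=> //; have := restrictC_cintegrable f2; congr cintegrable; apply/funext => x.
rewrite /restrictC -mulrA -rmorphM; congr (_ * _%:C).
by rewrite indicE; case: (x \in A); rewrite ?mulr1 ?mulr0.
Qed.

End exhaustion.

(** * The adjoint of a contraction with bounded kernel *)

Section bounded_kernel.
Context d1 d2 (T1 : measurableType d1) (T2 : measurableType d2) (R : realType).
Variables (m1 : {sigma_finite_measure set T1 -> \bar R})
  (m2 : {sigma_finite_measure set T2 -> \bar R}).
Variables (b : T1 * T2 -> R[i]) (kappa : R).
Hypothesis mb : cmeasurable b.
Hypothesis b_le : forall p, normc (b p) <= kappa.

Definition kernel_op (h : T1 -> R[i]) (y : T2) : R[i] :=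
  cintegral m1 (fun x => h x * b (x, y)).

Hypothesis kernel_op_L2 : forall h, cintegrable m1 h -> L2 m1 h ->
  L2 m2 (kernel_op h) /\ l2n m2 (kernel_op h) <= l2n m1 h.

Definition kernel_adj (G : T2 -> R[i]) (x : T1) : R[i] :=
  cintegral m2 (fun y => G y * conjc (b (x, y))).

Lemma kernel_adj_cintegrable G x : cintegrable m2 G ->
  cintegrable m2 (fun y => G y * conjc (b (x, y))).
Proof.
move=> Gi; have mG := cintegrable_cmeasurable Gi.
apply: (cintegrable_le (g := fun y => kappa * normc (G y))).
- apply: cmeasurableM => //; apply: cmeasurableJ.
  exact: (cmeasurable_comp (pair1_measurable x) mb).
- exact: (integrableZl measurableT kappa (integrable_normc Gi)).
- by move=> y; rewrite normcM normc_conj mulrC ler_wpM2r ?normc_ge0.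
Qed.

(** The kernel is bounded and both functions are integrable, which is what legitimates Fubini. For
    this reason integrability is carried beside square integrability in the section. *)
Lemma kernel_adjE G h : cintegrable m2 G -> cintegrable m1 h ->
  cdot m1 (kernel_adj G) h = cdot m2 G (kernel_op h).
Proof.
move=> Gi hi; have mG := cintegrable_cmeasurable Gi; have mh := cintegrable_cmeasurable hi.
pose K (p : T1 * T2) := conjc (h p.1) * (G p.2 * conjc (b p)).
have Ki : cintegrable (m1 \x m2)%E K.
  have [ti _] := cintegral_tensor hi Gi.
  apply: (cintegrable_le (g := fun p => kappa * normc (h p.1 * G p.2))).
  - apply: cmeasurableM.
      by apply: cmeasurableJ; apply: (cmeasurable_comp (h := fst)).
    apply: cmeasurableM; last exact: cmeasurableJ.
    by apply: (cmeasurable_comp (h := snd)).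
  - exact: (integrableZl measurableT kappa (integrable_normc ti)).
  - move=> p; rewrite /K !normcM !normc_conj mulrA mulrC ler_wpM2r//.
    by rewrite mulr_ge0 ?normc_ge0.
transitivity (cintegral m1 (fun x => cintegral m2 (fun y => K (x, y)))).
  apply: eq_cintegral => x; rewrite mulrC -cintegralZ//.
  exact: kernel_adj_cintegrable.
rewrite cfubini//; apply: eq_cintegral => y.
rewrite /kernel_op -cintegralJ; last first.
  apply: (cintegrable_le (g := fun x => kappa * normc (h x))).
  - apply: cmeasurableM => //; exact: (cmeasurable_comp (pair2_measurable y) mb).
  - exact: (integrableZl measurableT kappa (integrable_normc hi)).
  - by move=> x; rewrite normcM mulrC ler_wpM2r ?normc_ge0.
rewrite -cintegralZ; last first.
  apply: cintegrableJ; apply: (cintegrable_le (g := fun x => kappa * normc (h x))).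
  - apply: cmeasurableM => //; exact: (cmeasurable_comp (pair2_measurable y) mb).
  - exact: (integrableZl measurableT kappa (integrable_normc hi)).
  - by move=> x; rewrite normcM mulrC ler_wpM2r ?normc_ge0.
by apply: eq_cintegral => x; rewrite /K conjcM mulrCA.
Qed.

(** Let [u] be the squared norm of the adjoint restricted to a set of finite measure. Pairing the
    adjoint with this restriction gives [u^2 <= |G|^2 u], by Cauchy-Schwarz and the contraction
    property, so [u <= |G|^2]. Fatou's lemma removes the restriction. *)
Lemma kernel_adj_L2 G : cintegrable m2 G -> L2 m2 G ->
  L2 m1 (kernel_adj G) /\ l2n m1 (kernel_adj G) <= l2n m2 G.
Proof.
move=> Gi G2; have mG := cintegrable_cmeasurable Gi.
have mA : cmeasurable (kernel_adj G).
  apply: (cmeasurable_cintegral2 m2 (f := fun p => G p.2 * conjc (b p))).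
  apply: cmeasurableM; last exact: cmeasurableJ.
  by apply: (cmeasurable_comp (h := snd)).
have Ab x : normc (kernel_adj G x) <= kappa * \int[m2]_y normc (G y).
  apply: le_trans (normc_cintegral (kernel_adj_cintegrable x Gi)) _.
  have Gn := integrable_normc Gi; rewrite -RintegralZl//.
  apply: le_Rintegral => //.
  - exact: (integrable_normc (kernel_adj_cintegrable x Gi)).
  - exact: (integrableZl measurableT kappa Gn).
  - by move=> y _; rewrite normcM normc_conj mulrC ler_wpM2r ?normc_ge0.
have [B [mB Bfin Bx]] := exhaustion m1.
pose h k := restrictC (B k) (kernel_adj G).
have h12 k : L2 m1 (h k) /\ cintegrable m1 (h k) by exact: bounded_restrictC.
have hle k : l2n m1 (h k) <= l2n m2 G.
  have [h2 hi] := h12 k; have [W2 Wle] := kernel_op_L2 hi h2.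
  have e : cdot m1 (kernel_adj G) (h k) = (l2n m1 (h k))%:C.
    rewrite -cdot_normal; apply: eq_cintegral => x; rewrite /h /restrictC indicE.
    by case: (x \in B k); rewrite ?mulr1// !mulr0 conjcr mul0r mulr0.
  have := cauchy_schwarz G2 W2; rewrite -kernel_adjE// e normcr ger0_norm ?l2n_ge0//.
  have := l2n_ge0 m1 (h k); have := l2n_ge0 m2 G.
  set u := l2n m1 (h k) in Wle *; set v := l2n m2 G => v0 u0 H.
  have [->//|up] := eqVneq u 0.
  have {}up : 0 < u by rewrite lt_def up.
  have : u ^+ 2 <= v * u by apply: (le_trans H); rewrite ler_wpM2l.
  by rewrite expr2 ler_pM2r.
have le2 : (l2sq m1 (kernel_adj G) <= (l2n m2 G)%:E)%E.
  apply: (l2sq_fatou (f_ := h)).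
  - by move=> k; have [[]] := h12 k.
  - move=> x; apply: cvg_near_cst; apply: filterS (Bx x) => k Bkx.
    by rewrite /h /restrictC indicE mem_set// mulr1 subrr normc0.
  - by apply: nearW => k; rewrite -l2nE ?lee_fin//; case: (h12 k).
have A2 : L2 m1 (kernel_adj G) by split=> //; apply: (le_lt_trans le2); rewrite ltry.
by split=> //; rewrite -lee_fin l2nE.
Qed.

(** For integrable [G] the integral adjoint is the representing function. A general [G] is cut off
    to sets of finite measure, and the adjoints of the cut-offs form a Cauchy sequence because the
    adjoint is a contraction. *)
Lemma kernel_riesz G : L2 m2 G -> exists2 f, L2 m1 f &
  forall h, cintegrable m1 h -> L2 m1 h -> cdot m1 f h = cdot m2 G (kernel_op h).
Proof.
move=> G2; have [mG _] := G2; have [B [mB Bfin Bx]] := exhaustion m2.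
pose Gk k := restrictC (B k) G.
have Gk2 k : L2 m2 (Gk k) by exact: L2_restrictC.
have Gki k : cintegrable m2 (Gk k) by exact: restrictC_cintegrable.
have Gkc : l2n m2 (fun x => Gk k x - G x) @[k --> \oo] --> (0 : R).
  apply: fine_cvg.
  apply: (integral_dominated0 _ _ _ (integrable_sqr_normc G2)).
  - move=> k; apply: measurable_funX; apply: measurable_normc.
    by apply: cmeasurableB => //; have [] := Gk2 k.
  - by move=> k x; exact: sqr_ge0.
  - move=> x; apply: cvg_near_cst; apply: filterS (Bx x) => k Bkx.
    by rewrite /Gk /restrictC indicE mem_set// mulr1 subrr normc0 expr0n.
  - move=> k x; rewrite ler_sqr ?nnegrE ?normc_ge0//.
    rewrite /Gk /restrictC indicE; case: (x \in B k).
      by rewrite mulr1 subrr normc0 normc_ge0.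
    by rewrite mulr0 sub0r normcN.
pose f k := kernel_adj (Gk k).
have f2 k : L2 m1 (f k) by have [] := kernel_adj_L2 (Gki k) (Gk2 k).
have [F F2 fF] : exists2 F, L2 m1 F & l2n m1 (fun x => f k x - F x) @[k --> \oo] --> (0 : R).
  apply: riesz_fischer => // e e0.
  have e4 : 0 < e / 4 by rewrite divr_gt0.
  have /cvgr0Pnorm_le/(_ _ e4)[N _ HN] := Gkc.
  exists N => k l Nk Nl.
  have -> : (fun x => f k x - f l x) = kernel_adj (fun y => Gk k y - Gk l y).
    apply/funext => x; rewrite /f /kernel_adj -cintegralB; try exact: kernel_adj_cintegrable.
    by apply: eq_cintegral => y; rewrite mulrBl.
  have D2 : L2 m2 (fun y => Gk k y - Gk l y) by exact: L2B.
  have Di : cintegrable m2 (fun y => Gk k y - Gk l y) by exact: cintegrableB.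
  have [_ le1] := kernel_adj_L2 Di D2; apply: (le_trans le1).
  have := l2nD_le (L2B (Gk2 k) G2) (L2N (L2B (Gk2 l) G2)).
  rewrite (eq_l2n _ (f := fun x => - (Gk l x - G x)) (g := fun x => Gk l x - G x)); last first.
    by move=> x; rewrite normcN.
  have -> : (fun x => Gk k x - G x - (Gk l x - G x)) = (fun y => Gk k y - Gk l y).
    by apply/funext => x; ring.
  have := HN k Nk; have := HN l Nl; rewrite /= !ger0_norm ?l2n_ge0//; lra.
exists F => // h hi h2; have [W2 _] := kernel_op_L2 hi h2.
have c1 := cdot_cvg f2 F2 h2 fF.
have c2 := cdot_cvg Gk2 G2 W2 Gkc.
apply: (normc_cvg_unique c1).
by under eq_fun do rewrite kernel_adjE//.
Qed.

End bounded_kernel.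

Section countable_fibers.
Context d d' (T : measurableType d) (U : measurableType d').

Lemma measurable_fun_countable_fibers (I : countType) (E : T -> I) (g : I -> U) :
  (forall i, measurable (E @^-1` [set i])) -> measurable_fun setT (g \o E).
Proof.
move=> mE _ Y mY; rewrite setTI.
have -> : (g \o E) @^-1` Y = \bigcup_k (match unpickle k with
    | Some i => if `[< Y (g i) >] then E @^-1` [set i] else set0 | None => set0 end).
  apply/seteqP; split=> [x Yx|x [k _]].
    by exists (pickle (E x)) => //; rewrite pickleK; case: asboolP.
  by case: (unpickle k) => // i; case: asboolP => // Yi /= Ei; rewrite /= Ei.
apply: bigcup_measurable => k _; case: (unpickle k) => [i|]; last exact: measurable0.
by case: asboolP => _; [exact: mE|exact: measurable0].
Qed.

End countable_fibers.

(** * Measurability of entire functions through sampling on lattices *)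

Section discretization.
Variables (R : realType) (n : nat).
Notation Rn := (n.+1.-tuple (measurableTypeR R)).
Notation Cn := 'rV[R[i]]_n.+1.

(** Rounding down to the lattice of mesh [1 / (k + 1)], with values in a countable type. Continuity
    of [F] refers to the topology of row vectors and measurability to the product sigma-algebra of
    tuples; step functions on these lattices connect the two. *)
Definition grid (k : nat) (p : Rn * Rn) : {ffun 'I_n.+1 -> int} * {ffun 'I_n.+1 -> int} :=
  ([ffun j => Num.floor (k.+1%:R * (tnth p.1 j : R))],
   [ffun j => Num.floor (k.+1%:R * (tnth p.2 j : R))]).

Definition grid_point (k : nat) (q : {ffun 'I_n.+1 -> int} * {ffun 'I_n.+1 -> int}) : Cn :=
  \row_j ((k.+1%:R^-1 * (q.1 j)%:~R : R) +i* (k.+1%:R^-1 * (q.2 j)%:~R : R)).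

Lemma measurable_grid k q : measurable (grid k @^-1` [set q]).
Proof.
have mf (g : Rn * Rn -> R) (i : int) : measurable_fun setT g ->
    measurable [set p | Num.floor (k.+1%:R * g p) = i].
  move=> mg.
  have -> : [set p | Num.floor (k.+1%:R * g p) = i] =
      (fun p => k.+1%:R * g p) @^-1` `[i%:~R, (i + 1)%:~R[%classic.
    apply/seteqP; split => p /=; rewrite in_itv/=.
      by move=> <-; exact: floor_itv.
    exact: floor_def.
  rewrite -[X in measurable X]setTI.
  have mk : measurable_fun setT (fun p => k.+1%:R * g p) by exact: measurable_funM.
  by apply: mk.
have -> : grid k @^-1` [set q] =
    \bigcap_(j in [set: 'I_n.+1]) [set p | Num.floor (k.+1%:R * (tnth p.1 j : R)) = q.1 j] `&`
    \bigcap_(j in [set: 'I_n.+1]) [set p | Num.floor (k.+1%:R * (tnth p.2 j : R)) = q.2 j].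
  apply/seteqP; split => p /=.
    by move=> <-; split => j _ /=; rewrite ffunE.
  move=> [h1 h2]; case: q h1 h2 => q1 q2 /= h1 h2; congr (_, _); apply/ffunP => j; rewrite ffunE.
    exact: h1.
  exact: h2.
apply: measurableI; apply: fin_bigcap_measurable => // j _; apply: mf.
  by apply: (measurableT_comp (measurable_tnth j)); exact: measurable_fst.
by apply: (measurableT_comp (measurable_tnth j)); exact: measurable_snd.
Qed.

Lemma grid_point_near k p j :
  normc (grid_point k (grid k p) 0 j - complex_vec p 0 j) <= 2 * k.+1%:R^-1.
Proof.
have H (a : R) : `|k.+1%:R^-1 * (Num.floor (k.+1%:R * a))%:~R - a| <= k.+1%:R^-1.
  have k0 : 0 < (k.+1%:R : R) by [].
  have /andP[f1 f2] := floor_itv (k.+1%:R * a).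
  rewrite -(ler_pM2l k0) -{1}(gtr0_norm k0) -normrM mulrBr mulVKf ?gt_eqF//.
  rewrite divff ?gt_eqF// ler_norml; apply/andP; split; last by lra.
  by move: f2; rewrite intrD; lra.
rewrite !mxE !ffunE; apply: le_trans (normc_le_ReIm _) _; rewrite !ReImE.
by rewrite mulr2n mulrDl !mul1r lerD.
Qed.

End discretization.

Section continuity.
Variables (K : numFieldType) (n : nat).

Lemma norm_entries_le (h : 'rV[K]_n.+1) (e : K) : 0 <= e ->
  (forall j, `|h 0 j| <= e) -> `|h| <= e.
Proof.
move=> e0 he; rewrite [leLHS]/Num.norm /=.
have [->//|/mx_norm_neq0[[i j] ->]] := eqVneq (mx_norm h) 0.
by rewrite (ord1 i).
Qed.

Lemma differentiable_eps (F : 'rV[K]_n.+1 -> K^o) (z : 'rV[K]_n.+1) (e : K) :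
  differentiable F z -> 0 < e ->
  exists2 d, 0 < d & forall w, `|w - z| < d -> `|F w - F z| < e.
Proof.
move=> /differentiable_continuous cF e0.
have /(_ _ _ e0) := (@cvgrPdist_lt K K^o _ (nbhs z) _ F (F z)).1 cF.
move/(@nbhs_normP K 'rV[K]_n.+1) => [d d0 hd]; exists d => // w wd.
by rewrite distrC; apply: hd; rewrite /ball_/= distrC.
Qed.

End continuity.

(** * Coherent states, the reproducing kernel and surjectivity *)

Section fock_functions.
Variables (R : realType) (n : nat).
Notation Rn := (n.+1.-tuple (measurableTypeR R)).
Notation Cn := 'rV[R[i]]_n.+1.
Notation mu := (lebesgue_n R n.+1).
Notation leb2 := (lebesgue_n R n.+1 \x lebesgue_n R n.+1)%E.
Implicit Types (F : Cn -> R[i]^o).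

Lemma entire_grid_cvg F (p : Rn * Rn) : entire F ->
  normc (F (grid_point R k (grid k p)) - F (complex_vec p)) @[k --> \oo] --> (0 : R).
Proof.
move=> eF; apply/cvgr0Pnorm_le => e e0.
have e0C : 0 < e%:C :> R[i] by rewrite ltcR.
have [_ /vnorm_gt0[d d0 ->] hd] := differentiable_eps (eF (complex_vec p)) e0C.
have d4 : 0 < d / 4 by rewrite divr_gt0.
have /cvgr0Pnorm_le/(_ _ d4) := @cvg_harmonic R.
apply: filterS => k; rewrite ger0_norm ?invr_ge0// => hk.
rewrite ger0_norm ?normc_ge0// -lecR -normr_normc ltW//.
apply: hd; apply: (@le_lt_trans _ _ (d / 2)%:C); last first.
  by rewrite ltcR ltr_pdivrMr// ltr_pMr// ltr1n.
apply: norm_entries_le => [|j]; first by rewrite lecR divr_ge0// ltW.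
rewrite !mxE normr_normc lecR; have := grid_point_near k p j; rewrite !mxE.
move=> /le_trans; apply; move: hk; rewrite /harmonic /= => hk.
by rewrite (_ : d / 2 = 2 * (d / 4)); [rewrite ler_wpM2l|field].
Qed.

Lemma cmeasurable_entire F : entire F -> cmeasurable (F \o @complex_vec R n.+1).
Proof.
move=> eF.
have mk k : cmeasurable (fun p : Rn * Rn => F (grid_point R k (grid k p))).
  split.
    have := @measurable_fun_countable_fibers _ _ _ _ _ _
      (fun q => complex.Re (F (grid_point R k q)) : measurableTypeR R) (@measurable_grid R n k).
    exact.
  have := @measurable_fun_countable_fibers _ _ _ _ _ _
    (fun q => complex.Im (F (grid_point R k q)) : measurableTypeR R) (@measurable_grid R n k).
  exact.
split.
- apply: (measurable_fun_cvg (h := fun k p => complex.Re (F (grid_point R k (grid k p))))).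
    by move=> k; case: (mk k).
  move=> p _; apply/cvgrPdist_le => e e0.
  have /cvgr0Pnorm_le/(_ _ e0) := entire_grid_cvg p eF.
  apply: filterS => k; rewrite ger0_norm ?normc_ge0//; apply: le_trans.
  by rewrite distrC -cReN -cReD le_Re_normc.
- apply: (measurable_fun_cvg (h := fun k p => complex.Im (F (grid_point R k (grid k p))))).
    by move=> k; case: (mk k).
  move=> p _; apply/cvgrPdist_le => e e0.
  have /cvgr0Pnorm_le/(_ _ e0) := entire_grid_cvg p eF.
  apply: filterS => k; rewrite ger0_norm ?normc_ge0//; apply: le_trans.
  by rewrite distrC -cImN -cImD le_Im_normc.
Qed.

Lemma fock_L2 F : fock_space F -> L2 leb2 (weighted F).
Proof.
move=> [eF Ffin]; split; last by rewrite -fock_sqnormE.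
by apply: cmeasurableM; [exact: cmeasurable_entire|exact: cmeasurable_weight].
Qed.

Lemma bargmann_fock f : L2 mu f -> fock_space (bargmann f : Cn -> R[i]^o).
Proof.
move=> f2; split; first exact: entire_bargmann.
by rewrite fock_sqnormE l2sq_weighted_bargmann//; case: f2.
Qed.

Definition coherent (z : Cn) (x : Rn) : R[i] := conjc (bargmann_kernel x z).

Lemma L2_coherent z : L2 mu (coherent z).
Proof. exact/L2J/L2_bargmann_kernel. Qed.

Lemma bargmann_cdot f z : bargmann f z = cdot mu f (coherent z).
Proof. by apply: eq_cintegral => x; rewrite /coherent conjcK. Qed.

(** This is the reproducing kernel of the Fock space. The Gaussian integral produces [e^(- v.v / 2)]
    with [v = w - conj z], which cancels the factor split off by [dotc_shifted]. *)
Lemma bargmann_coherent z w : bargmann (coherent z) w = cexp (dotc w (conj_vec z)).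
Proof.
have [fi fE] := @cexp_gaussian_integral R n.+1 (w - conj_vec z).
set v := w - conj_vec z in fi fE.
transitivity (cintegral mu (fun x => (bargmann_const R n.+1 ^+ 2)%:C *
    cexp (dotc w (conj_vec z)) * cexp (dotc v v / 2) * fourier_kernel x v)).
  apply: eq_cintegral => x; rewrite mulrC bargmann_kernelM dotc_shifted.
  by rewrite mulrA.
rewrite cintegralZ// fE cexpN.
set a := cexp (dotc v v / 2).
have a0 : a != 0 by exact: cexp_neq0.
set c := cexp _; set s := Num.sqrt (pi / 2) ^+ _; set k := bargmann_const _ _.
have -> : (k ^+ 2)%:C * c * a * (s%:C * a^-1) = (k ^+ 2)%:C * s%:C * c by field.
by rewrite -rmorphM sqr_bargmann_const_gaussian mul1r.
Qed.

Lemma fock_reproducing F z : fock_space F ->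
  F z = cdot leb2 (weighted F) (weighted (bargmann (coherent z))).
Proof.
move=> FF; have [eF _] := FF; have F2 := fock_L2 FF.
have K2 := L2_weighted_bargmann (L2_coherent z).
have E p : weighted F p * conjc (weighted (bargmann (coherent z)) p) =
   F (complex_vec p) * cexp (dotc z (conj_vec (complex_vec p))) *
   (gauss_density (complex_vec p))%:C.
  rewrite /weighted bargmann_coherent conjcM conjcr conj_cexp conj_dotc conj_vecK dotcC.
  by rewrite mulrACA -rmorphM -expr2 sqr_weight.
rewrite -(@reproducing R n.+1 F z).
- by apply/esym; exact: eq_cintegral.
- by move=> v; exact: entire_cdiff_line.
- have := cdot_cintegrable F2 K2; congr cintegrable; exact/funext.
Qed.

(** The coherent states are the test functions inserted into [kernel_riesz], which have to be
    integrable as well as square integrable. *)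
Lemma cintegrable_coherent z : cintegrable mu (coherent z).
Proof.
apply: cintegrableJ; rewrite -(vec_pairK z); move: (vec_pair z) => -[y t].
have w0 := weight_gt0 (y, t).
have sgi : cintegrable mu (fun x => (shifted_gaussian t x)%:C).
  have h1 : 0 < (1 : R) by [].
  have := transports_cintegrable (transports_shift t)
    (cintegrable_real (@integrable_gaussian R n.+1 1 h1)).
  congr cintegrable; apply/funext => x.
  by rewrite /comp mul1r -[RHS]/((shifted_gaussian t x)%:C) shifted_gaussianC.
have [mk _] := L2_bargmann_kernel (complex_vec (y, t)).
pose c := (weight (y, t))^-1 * (bargmann_const R n.+1 * Num.sqrt (pi ^- n.+1)).
apply: (cintegrable_le (g := fun x => c * normc (shifted_gaussian t x)%:C)) => //.
  exact: (integrableZl measurableT c (integrable_normc sgi)).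
move=> x.
have -> : bargmann_kernel x (complex_vec (y, t)) = (weight (y, t))^-1%:C *
    (bargmann_kernel x (complex_vec (y, t)) * (weight (y, t))%:C).
  by rewrite mulrCA -rmorphM mulVf ?gt_eqF// mulr1.
rewrite bargmann_kernel_weight normcM [normc (_ * cexp _ * _)]normcM.
rewrite [normc (_ * cexp _)]normcM normc_cexp Re_mk expR0 mulr1.
rewrite [normc (_ * wave _ _)]normcM normc_wave mulr1 !normcr.
rewrite ger0_norm ?invr_ge0 ?(ltW w0)// ger0_norm /c ?mulrA//.
by rewrite mulr_ge0 ?sqrtr_ge0// ltW// bargmann_const_gt0.
Qed.

Lemma bargmann_surj F : fock_space F -> exists2 f, L2 mu f & F = bargmann f.
Proof.
move=> FF; have F2 := fock_L2 FF.
(* With the weight the kernel is bounded, as [kernel_riesz] requires; without it the kernel grows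
   with the real part of [z]. *)
pose b (q : Rn * (Rn * Rn)) := bargmann_kernel q.1 (complex_vec q.2) * (weight q.2)%:C.
have mb : cmeasurable b.
  have h : measurable_fun setT (fun q : Rn * (Rn * Rn) => (q.2, q.1)) by exact: measurable_swap.
  apply: cmeasurableM.
    exact: (cmeasurable_comp h (@cmeasurable_bargmann_kernel R n.+1)).
  by apply: (cmeasurable_comp (h := snd)) (@cmeasurable_weight R n.+1).
have bE q : normc (b q) <= bargmann_const R n.+1 * Num.sqrt (pi ^- n.+1).
  case: q => x [y t]; rewrite /b bargmann_kernel_weight.
  rewrite normcM [normc (_ * cexp _)]normcM normc_cexp Re_mk expR0 mulr1.
  rewrite [normc (_ * wave _ _)]normcM normc_wave mulr1 !normcr.
  have c0 : 0 <= bargmann_const R n.+1 * Num.sqrt (pi ^- n.+1).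
    by rewrite mulr_ge0 ?sqrtr_ge0// ltW// bargmann_const_gt0.
  rewrite !ger0_norm ?shifted_gaussian_ge0//.
  by rewrite ler_piMr// shifted_gaussian_le1.
have opE h : L2 mu h -> kernel_op mu b h = weighted (bargmann h).
  move=> h2; apply/funext => p; rewrite /kernel_op /weighted mulrC -cintegralZ; last first.
    exact: bargmann_cintegrable.
  by apply: eq_cintegral => x; rewrite /b mulrA mulrC.
have iso h : cintegrable mu h -> L2 mu h ->
    L2 (sfprod mu mu) (kernel_op mu b h) /\ l2n (sfprod mu mu) (kernel_op mu b h) <= l2n mu h.
  move=> hi h2; rewrite opE//; split; first exact: L2_weighted_bargmann.
  by rewrite -(l2n_weighted_bargmann h2).
have [f f2 fE] := kernel_riesz (m2 := sfprod mu mu) mb bE iso F2.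
exists f => //; apply/funext => z; rewrite fock_reproducing// bargmann_cdot.
rewrite fE ?opE//; [exact: L2_coherent|exact: cintegrable_coherent|exact: L2_coherent].
Qed.

End fock_functions.

(** * Multiplication operators *)

Section null_sets.
Context d (T : measurableType d) (R : realType).
Variable mu : {measure set T -> \bar R}.
Implicit Types (f g m : T -> R[i]) (A B Z : set T).

Lemma measurable_normc_preimage f (Y : set (measurableTypeR R)) : cmeasurable f -> measurable Y ->
  measurable [set x | Y (normc (f x))].
Proof.
move=> mf mY; rewrite -[X in measurable X]setTI.
by have /(_ measurableT _ mY) := measurable_normc mf.
Qed.

Lemma measurable_normc_lt f (e : R) : cmeasurable f -> measurable [set x | normc (f x) < e].
Proof.
move=> mf; have := measurable_normc_preimage mf (measurable_itv `]-oo, e[).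
by congr measurable; apply/seteqP; split => x /=; rewrite in_itv.
Qed.

Lemma measurable_normc_ge f (e : R) : cmeasurable f -> measurable [set x | e <= normc (f x)].
Proof.
move=> mf; have := measurable_normc_preimage mf (measurable_itv `[e, +oo[).
by congr measurable; apply/seteqP; split => x /=; rewrite in_itv/= andbT.
Qed.

Lemma measurable_eq0 f : cmeasurable f -> measurable [set x | f x = 0].
Proof.
move=> mf; have := measurable_normc_preimage mf (measurable_itv `]-oo, 0]).
congr measurable; apply/seteqP; split => x /=; rewrite in_itv/= => H.
  by apply/eqP; rewrite -normc_eq0 eq_le H normc_ge0.
by rewrite H normc0.
Qed.

Lemma measurable_neq0 f : cmeasurable f -> measurable [set x | f x <> 0].
Proof. by move=> mf; have := measurableC (measurable_eq0 mf). Qed.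

Lemma measure_pos_sub A B Z : measurable A -> measurable B -> measurable Z ->
  A `<=` B `|` Z -> mu Z = 0 -> (0 < mu A)%E -> (0 < mu B)%E.
Proof.
move=> mA mB mZ AB Z0 A0; apply: (lt_le_trans A0).
apply: (le_trans (le_measure _ _ _ AB)); rewrite ?inE//; first exact: measurableU.
apply: (le_trans (measureU2 _ mB mZ)).
by rewrite [X in (_ + X <= _)%E](_ : _ = 0%E) ?adde0.
Qed.

Lemma positive_subset A (C : nat -> set T) : measurable A -> (forall k, measurable (C k)) ->
  A `<=` \bigcup_k C k -> (0 < mu A)%E -> exists k, (0 < mu (A `&` C k))%E.
Proof.
move=> mA mC AC; apply: contraTP => /forallNP H.
have nA : mu.-negligible A.
  have AS : A `<=` \bigcup_k (A `&` C k).
    by move=> x Ax; have [k _ Ck] := AC x Ax; exists k.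
  apply: (negligibleS AS).
  apply: negligible_bigcup => k; apply/negligibleP; first exact: measurableI.
  by apply/eqP; have := H k; rewrite lt0e measure_ge0 andbT => /negP; rewrite negbK.
by rewrite (measure_negligible mA nA) ltxx.
Qed.

Lemma l2n_eq0P f : L2 mu f -> l2n mu f = 0 <-> mu [set x | f x <> 0] = 0.
Proof.
move=> f2; have [mf _] := f2.
have mf2 := measurable_sqr_normc mf.
have e : (\int[mu]_x `|(normc (f x) ^+ 2)%:E| = l2sq mu f)%E.
  by apply: eq_integral => x _; rewrite gee0_abs ?lee_fin ?sqr_ge0.
have H := ae_eq_integral_abs mu measurableT mf2.
have nz : (ae_eq mu setT (fun x => (normc (f x) ^+ 2)%:E) (cst 0%E)) <->
    mu [set x | f x <> 0] = 0.
  split=> [h|h].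
    apply: measure_negligible; first exact: measurable_neq0.
    apply: negligibleS h => x /= fx /(_ I) [] H0; apply: fx.
    by apply/eqP; rewrite -normc_eq0 -sqrf_eq0 H0.
  exists [set x | f x <> 0]; split=> //; first exact: measurable_neq0.
  by move=> x /= + fx; apply => _; rewrite fx normc0 expr0n.
split=> [h|/nz/H h].
  by apply/nz/H; rewrite e -l2nE// h.
by apply: EFin_inj; rewrite l2nE// -e.
Qed.

Lemma l2n_eq0 f Z : L2 mu f -> measurable Z -> mu Z = 0 -> (forall x, ~ Z x -> f x = 0) ->
  l2n mu f = 0.
Proof.
move=> f2 mZ Z0 fZ; apply/l2n_eq0P => //; apply: measure_negligible.
  by apply: measurable_neq0; case: f2.
by exists Z; split=> // x /= fx; apply: contrapT => /fZ.
Qed.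

Lemma cintegral_ae_eq f g Z : cmeasurable f -> cmeasurable g -> measurable Z -> mu Z = 0 ->
  (forall x, ~ Z x -> f x = g x) -> cintegral mu f = cintegral mu g.
Proof.
move=> [mf1 mf2] [mg1 mg2] mZ Z0 fg; rewrite /cintegral /Rintegral; congr (fine _ +i* fine _).
  apply: ae_eq_integral => //; try exact/measurable_EFinP.
  by exists Z; split=> // x /= h; apply: contrapT => /fg e; apply: h => _; rewrite e.
apply: ae_eq_integral => //; try exact/measurable_EFinP.
by exists Z; split=> // x /= h; apply: contrapT => /fg e; apply: h => _; rewrite e.
Qed.

(** Cutting [m] off above a finite essential bound changes it on a null set only. The operator
    arguments need a bound at every point. *)
Lemma Linfty_bounded m : Linfty mu m -> exists m' (M : R),
  [/\ cmeasurable m', forall x, normc (m' x) <= M & mu [set x | m x - m' x <> 0] = 0].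
Proof.
move=> [mm]; rewrite unlock; case: ifPn => [muT|].
  move=> esl; have [M [M0 HM]] : exists M : R, 0 <= M /\
      \forall x \ae mu, ((abse \o (fun x => (normc (m x))%:E)) x <= M%:E)%E.
    case: (ess_sup_inf.ess_sup _ _) (ess_sup_inf.ess_sup_ge mu (abse \o (fun x => (normc (m x))%:E))) esl => //=.
      move=> r H _; exists `|r|; split=> //; apply: filterS H => x /= /le_trans; apply.
      by rewrite lee_fin ler_norm.
    move=> H _; exists 0; split=> //; apply: filterS H => x /=.
    by rewrite leeNy_eq => /eqP.
  exists (fun x => m x * (\1_[set x | normc (m x) <= M] x)%:C), M; split.
  - apply: cmeasurable_restrict => //.
    have := measurable_normc_preimage mm (measurable_itv `]-oo, M]).
    by congr measurable; apply/seteqP; split => x /=; rewrite in_itv.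
  - move=> x; rewrite indicE; case: (boolP (x \in _)) => [/set_mem//=|_].
      by rewrite mulr1.
    by rewrite mulr0 normc0.
  - apply: measure_negligible.
      apply: measurable_neq0; apply: cmeasurableB => //; apply: cmeasurable_restrict => //.
      have := measurable_normc_preimage mm (measurable_itv `]-oo, M]).
      by congr measurable; apply/seteqP; split => x /=; rewrite in_itv.
    apply: negligibleS HM => x /= + h; apply.
    rewrite indicE mem_set ?mulr1 ?subrr//=.
    by move: h; rewrite /= lee_fin ger0_norm ?normc_ge0.
(* Here the whole space is null, so the zero function agrees with [m] almost everywhere. *)
move=> muT _; exists (fun=> 0), 0; split.
- exact: cmeasurable_cst.
- by move=> x; rewrite normc0.
- apply/eqP; rewrite eq_le measure_ge0 andbT; move: muT; rewrite -leNgt.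
  apply: le_trans; apply: le_measure; rewrite ?inE//.
  by apply: measurable_neq0; apply: cmeasurableB => //; exact: cmeasurable_cst.
Qed.

Definition unit_fun A x : R[i] := ((Num.sqrt (fine (mu A)))^-1 * \1_A x)%:C.

Section unit_fun.
Variable A : set T.
Hypotheses (mA : measurable A) (A0 : (0 < mu A)%E) (Afin : (mu A < +oo)%E).

Lemma unit_funE : unit_fun A = fun x => ((Num.sqrt (fine (mu A)))^-1)%:C * (\1_A x)%:C.
Proof. by apply/funext => x; rewrite -rmorphM. Qed.

Lemma unit_fun_L2 : L2 mu (unit_fun A) /\ l2n mu (unit_fun A) = 1.
Proof.
have a0 : 0 < fine (mu A) by rewrite fine_gt0// A0 Afin.
have mI : measurable_fun setT (\1_A : T -> R) by exact: measurable_indic.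
have I2 : l2sq mu (fun x => (\1_A x)%:C) = mu A.
  rewrite /l2sq; under eq_integral => x _.
    rewrite normcr real_normK ?num_real// (_ : \1_A x ^+ 2 = \1_A x); last first.
      by rewrite indicE; case: (x \in A); rewrite ?expr1n ?expr0n.
    over.
  by rewrite integral_indic// setIT.
have L : L2 mu (fun x => (\1_A x)%:C) by split; [exact: cmeasurable_real|rewrite I2].
rewrite unit_funE; split; first exact: L2Z.
rewrite l2nZ// normcr ger0_norm ?invr_ge0 ?sqrtr_ge0// exprVn sqr_sqrtr ?ltW//.
by rewrite /l2n I2 mulVf// gt_eqF.
Qed.

Lemma unit_fun_mul_le (c : T -> R[i]) (M : R) : cmeasurable c -> 0 <= M ->
  (forall x, A x -> normc (c x) <= M) ->
  L2 mu (fun x => c x * unit_fun A x) /\ l2n mu (fun x => c x * unit_fun A x) <= M ^+ 2.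
Proof.
move=> mc M0 cM; have [u2 u1] := unit_fun_L2; have [mu_ _] := u2.
have le x : normc (c x * unit_fun A x) <= normc (M%:C * unit_fun A x).
  rewrite !(normcM _ (unit_fun A x)) normcr ger0_norm//.
  rewrite /unit_fun indicE; case: (boolP (x \in A)) => [/set_mem Ax|_].
    by rewrite ler_wpM2r ?normc_ge0// cM.
  by rewrite mulr0 normc0 !mulr0.
have mcu : cmeasurable (fun x => c x * unit_fun A x) by exact: cmeasurableM.
split; first exact: (le_L2 mcu (L2Z M%:C u2)).
apply: (le_trans (le_l2n mcu (L2Z M%:C u2) le)).
by rewrite l2nZ// u1 mulr1 normcr ger0_norm.
Qed.

End unit_fun.

End null_sets.

Lemma cmeasurableV d (T : measurableType d) (R : realType) (f : T -> R[i]) :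
  cmeasurable f -> cmeasurable (fun x => (f x)^-1).
Proof.
(* [z^-1 = conj z / |z|^2] also at [z = 0], where both sides are 0 by convention; [powR] with
   exponent [-1] is a measurable form of the real inverse. *)
move=> mf; have -> : (fun x => (f x)^-1) =
    (fun x => conjc (f x) * ((normc (f x) ^+ 2) `^ (-1))%:C).
  apply/funext => x; rewrite powR_inv1 ?sqr_ge0//.
  have [->|f0] := eqVneq (f x) 0; first by rewrite invr0 normc0 expr0n invr0 mulr0.
  apply: (mulfI f0); rewrite divff// mulrA mulcJ -rmorphM divff//.
  by rewrite sqrf_eq0 normc_eq0.
apply: cmeasurableM; first exact: cmeasurableJ.
apply: cmeasurable_real; apply: (measurableT_comp (measurable_powR (-1))).
by apply: measurable_funX; exact: measurable_normc.
Qed.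

(** * Spectra of an operator conjugate to multiplication by a bounded function *)

Section multiplication_operator.
Context d (T : measurableType d) (R : realType).
Variable mu : {sigma_finite_measure set T -> \bar R}.
Variables (V : lmodType R[i]) (H : set V) (N : V -> R) (A : (T -> R[i]) -> V).
Variables (m : T -> R[i]) (Mm : R) (Tm : V -> V) (t : T -> R).
Implicit Types (f g : T -> R[i]) (F G : V).

(** [A] stands for the unitary transform. It acts on functions and not on classes, and [N] is an
    arbitrary function on [V], so [A_eq0] states separately that functions of norm zero are sent to
    0. *)
Hypothesis A_H : forall f, L2 mu f -> H (A f).
Hypothesis A_surj : forall F, H F -> exists2 f, L2 mu f & F = A f.
Hypothesis A_lin : forall a f g, L2 mu f -> L2 mu g ->
  A (fun x => a * f x + g x) = a *: A f + A g.
Hypothesis A_N : forall f, L2 mu f -> N (A f) = Num.sqrt (l2n mu f).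
Hypothesis A_eq0 : forall f, L2 mu f -> l2n mu f = 0 -> A f = 0.
Hypothesis mm : cmeasurable m.
Hypothesis m_le : forall x, normc (m x) <= Mm.
Hypothesis TmE : forall f, L2 mu f -> Tm (A f) = A (fun x => m x * f x).
(* [t] witnesses that the measure has no atoms. *)
Hypothesis mt : measurable_fun setT t.
Hypothesis t_null : forall c, mu [set x | t x = c] = 0.

Lemma transform0 : A (fun=> 0) = 0.
Proof.
apply: A_eq0; first exact: L2_0.
by rewrite /l2n /l2sq; under eq_integral do rewrite normc0 expr0n; rewrite integral0.
Qed.

Lemma transformB f g : L2 mu f -> L2 mu g -> A (fun x => f x - g x) = A f - A g.
Proof.
move=> f2 g2; have := A_lin (-1) g2 f2; rewrite scaleN1r addrC => <-; congr A.
by apply/funext => x; rewrite mulN1r addrC.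
Qed.

Lemma transform_eq f g : L2 mu f -> L2 mu g -> l2n mu (fun x => f x - g x) = 0 -> A f = A g.
Proof.
by move=> f2 g2 fg; apply/eqP; rewrite -subr_eq0 -transformB// A_eq0//; exact: L2B.
Qed.

Lemma transform_inj0 f : L2 mu f -> A f = 0 -> l2n mu f = 0.
Proof.
move=> f2 Af; have N0 : N 0 = 0.
  rewrite -transform0 A_N; last exact: L2_0.
  by rewrite /l2n /l2sq; under eq_integral do rewrite normc0 expr0n; rewrite integral0 sqrtr0.
have := A_N f2; rewrite Af N0 => /esym/eqP; rewrite sqrtr_eq0 => h.
by apply/eqP; rewrite eq_le h l2n_ge0.
Qed.

Lemma cmeasurable_shifted a : cmeasurable (fun x => m x - a).
Proof. by apply: cmeasurableB => //; exact: cmeasurable_cst. Qed.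

Lemma L2_mul_m f : L2 mu f -> L2 mu (fun x => m x * f x).
Proof. exact: L2_bounded_mul. Qed.

Lemma L2_mul_shifted a f : L2 mu f -> L2 mu (fun x => (m x - a) * f x).
Proof.
apply: (L2_bounded_mul (M := Mm + normc a)); first exact: cmeasurable_shifted.
by move=> x; rewrite (le_trans (le_normcB _ _))// lerD2r.
Qed.

Lemma shift_transform a f : L2 mu f -> shift_operator Tm a (A f) = A (fun x => (m x - a) * f x).
Proof.
move=> f2; rewrite /shift_operator TmE// addrC -scaleNr -A_lin//; last exact: L2_mul_m.
by congr A; apply/funext => x; ring.
Qed.

(** A classically chosen preimage. It is determined only up to functions of norm zero, and [mul_opE]
    shows that [mul_op] does not depend on the choice. *)
Definition representative F : T -> R[i] :=
  if pselect (exists f, L2 mu f /\ F = A f) is left e then projT1 (cid e) else fun=> 0.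

Lemma representativeP F : H F -> L2 mu (representative F) /\ F = A (representative F).
Proof.
move=> /A_surj[f f2 FE]; rewrite /representative; case: pselect => [e|[]].
  exact: (projT2 (cid e)).
by exists f.
Qed.

Definition mul_op (b : T -> R[i]) F : V := A (fun x => b x * representative F x).

Section mul_op.
Variables (b : T -> R[i]) (Mb : R).
Hypotheses (mb : cmeasurable b) (b_le : forall x, normc (b x) <= Mb).

Lemma L2_mul_b f : L2 mu f -> L2 mu (fun x => b x * f x).
Proof. exact: L2_bounded_mul. Qed.

Lemma l2n_mul_b f : L2 mu f -> l2n mu (fun x => b x * f x) <= Mb ^+ 2 * l2n mu f.
Proof.
(* On an empty [T] the bound [Mb] could be negative, but there every norm vanishes. *)
move=> f2; have bf2 := L2_mul_b f2; have [x0|T0] := pselect (exists x : T, True); last first.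
  have e0 (g : T -> R[i]) : l2n mu g = 0.
    rewrite /l2n /l2sq (_ : (fun x => _) = cst 0%E) ?integral0//.
    by apply/funext => x; exfalso; apply: T0; exists x.
  by rewrite !e0 mulr0.
have Mb0 : 0 <= Mb by have [x _] := x0; exact: le_trans (normc_ge0 _) (b_le x).
have -> : Mb ^+ 2 * l2n mu f = l2n mu (fun x => Mb%:C * f x).
  by rewrite l2nZ// normcr ger0_norm.
have [mbf _] := bf2; apply: (le_l2n mbf (L2Z _ f2)) => x.
by rewrite !normcM normcr (ger0_norm Mb0) ler_wpM2r ?normc_ge0.
Qed.

Lemma mul_opE f : L2 mu f -> mul_op b (A f) = A (fun x => b x * f x).
Proof.
move=> f2; have [r2 rE] := representativeP (A_H f2); rewrite /mul_op.
set r := representative _ in r2 rE *.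
have D2 := L2B r2 f2.
have D0 : l2n mu (fun x => r x - f x) = 0.
  by apply: transform_inj0 => //; rewrite transformB// -rE subrr.
apply: transform_eq; try exact: L2_mul_b.
have -> : (fun x => b x * r x - b x * f x) = (fun x => b x * (r x - f x)).
  by apply/funext => x; rewrite mulrBr.
by apply/eqP; rewrite eq_le l2n_ge0 andbT (le_trans (l2n_mul_b D2))// D0 mulr0.
Qed.

Lemma mul_op_bounded : bounded_operator H N (mul_op b).
Proof.
split.
- move=> F /A_surj[f f2 ->]; rewrite mul_opE//; apply: A_H; exact: L2_mul_b.
- move=> a F G /A_surj[f f2 ->] /A_surj[g g2 ->].
  rewrite -A_lin// !mul_opE//; last by apply: L2D => //; exact: L2Z.
  rewrite -A_lin; [|exact: L2_mul_b..].
  by congr A; apply/funext => x; rewrite mulrDr mulrCA.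
- exists `|Mb| => F /A_surj[f f2 ->]; rewrite mul_opE// !A_N//; last exact: L2_mul_b.
  rewrite -sqrtr_sqr -sqrtrM ?sqr_ge0// ler_sqrt ?(mulr_ge0 (sqr_ge0 _) (l2n_ge0 _ _))//.
  exact: l2n_mul_b.
Qed.

End mul_op.

Notation range_m := (essential_range mu m).
Notation Sh a := (shift_operator Tm a).

Lemma spectrum_sub : spectrum H N Tm `<=` range_m.
Proof.
move=> a; apply: contraPP => /= /existsNP[e /not_implyP[e0 /negP]].
rewrite -leNgt => he; apply; set Z := [set x | normc (m x - a) < e] in he.
have mZ : measurable Z by exact: (measurable_normc_lt e (cmeasurable_shifted a)).
have Z0 : mu Z = 0 by apply/eqP; rewrite eq_le he measure_ge0.
(* Setting the inverse to 0 on the null set [Z] makes the bound [e^-1] hold at every point. *)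
pose b x : R[i] := (m x - a)^-1 * (\1_(~` Z) x)%:C.
have mb : cmeasurable b.
  apply: cmeasurable_restrict; first exact: measurableC.
  exact/cmeasurableV/cmeasurable_shifted.
have b_le x : normc (b x) <= e^-1.
  rewrite /b indicE; case: (boolP (x \in _)) => [/set_mem/negP|_]; last first.
    by rewrite mulr0 normc0 invr_ge0 ltW.
  rewrite -leNgt mulr1 => ex; have xp := lt_le_trans e0 ex.
  by rewrite normcV lef_pV2.
have id0 f : L2 mu f -> l2n mu (fun x => b x * ((m x - a) * f x) - f x) = 0.
  move=> f2; apply: (l2n_eq0 _ mZ Z0).
    by apply: L2B => //; apply: (L2_mul_b mb b_le); exact: L2_mul_shifted.
  move=> x Zx; rewrite /b indicE mem_set// mulr1 mulrA mulVf ?mul1r ?subrr//.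
  by apply/eqP => x0; apply: Zx; rewrite /Z /= x0 normc0.
have ba2 f : L2 mu f -> L2 mu (fun x => b x * ((m x - a) * f x)).
  by move=> f2; apply: (L2_mul_b mb b_le); exact: L2_mul_shifted.
exists (mul_op b); split; first exact: (mul_op_bounded mb b_le).
- move=> F /A_surj[f f2 ->]; rewrite shift_transform// (mul_opE mb b_le); last exact: L2_mul_shifted.
  by apply: transform_eq => //; [exact: ba2|exact: id0].
- move=> F /A_surj[f f2 ->]; rewrite (mul_opE mb b_le)// shift_transform; last exact: (L2_mul_b mb b_le).
  have -> : (fun x => (m x - a) * (b x * f x)) = (fun x => b x * ((m x - a) * f x)).
    by apply/funext => x; rewrite mulrCA.
  by apply: transform_eq => //; [exact: ba2|exact: id0].
Qed.

(** A bounded inverse with constant [M] forces [1 <= M * N (Sh a F)] for unit vectors [F], against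
    the convergence to 0. *)
Lemma approx_sub_spectrum : approximate_point_spectrum H N Tm `<=` spectrum H N Tm.
Proof.
move=> a [F [HF NF cF]] [S [[SH SL [M SM]] STF _]].
have le1 k : 1 <= M * N (Sh a (F k)).
  rewrite -(NF k) -{1}(STF _ (HF k)); apply: SM.
  have [f f2 ->] := A_surj (HF k); rewrite shift_transform//; apply: A_H; exact: L2_mul_shifted.
have c0 : M * N (Sh a (F k)) @[k --> \oo] --> (0 : R).
  by rewrite -[X in _ --> X](mulr0 M); apply: cvgM => //; exact: cvg_cst.
have /cvgrPdist_lt/(_ 1 ltr01)[k _ /(_ k (leqnn k))] := c0.
by rewrite sub0r normrN => /(le_lt_trans (ler_norm _)); rewrite ltNge le1.
Qed.

(** Finite measure is needed to normalize an indicator, and lying in a single [C k] turns a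
    pointwise property, such as being bounded or nonzero, into a uniform one. *)
Lemma positive_piece (E : set T) (C : nat -> set T) : measurable E ->
  (forall k, measurable (C k)) -> E `<=` \bigcup_k C k -> (0 < mu E)%E ->
  exists E', [/\ measurable E', E' `<=` E, exists k, E' `<=` C k, (0 < mu E')%E &
    (mu E' < +oo)%E].
Proof.
move=> mE mC EC E0; have [k Ek] := positive_subset mE mC EC E0.
have [B [mB Bfin Bx]] := exhaustion mu.
have mEk := measurableI _ _ mE (mC k).
have EB : E `&` C k `<=` \bigcup_j B j.
  by move=> x _; have [j _ /(_ j (leqnn j)) Bj] := Bx x; exists j.
have [j Ej] := positive_subset mEk mB EB Ek.
exists (E `&` C k `&` B j); split=> //.
- exact: measurableI.
- by move=> x [[]].
- by exists k => x [[]].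
- apply: le_lt_trans (Bfin j); apply: le_measure; rewrite ?inE//; last exact: measurableI.
Qed.

Lemma range_sub_approx : range_m `<=` approximate_point_spectrum H N Tm.
Proof.
move=> a ra.
have pk (k : nat) : exists E, [/\ measurable E, E `<=` [set x | normc (m x - a) < k.+1%:R^-1],
    (0 < mu E)%E & (mu E < +oo)%E].
  have k0 : 0 < (k.+1%:R^-1 : R) by rewrite invr_gt0.
  have mE := measurable_normc_lt k.+1%:R^-1 (cmeasurable_shifted a).
  have [//|||E [mE' EE _ E0 Efin]] := @positive_piece _ (fun=> setT) mE.
  - by move=> x _; exists 0.
  - exact: ra.
  by exists E.
have [E HE] := choice pk.
have u2 k : L2 mu (unit_fun mu (E k)) /\ l2n mu (unit_fun mu (E k)) = 1.
  by have [mE _ E0 Ef] := HE k; exact: unit_fun_L2.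
exists (fun k => A (unit_fun mu (E k))); split.
- by move=> k; apply: A_H; have [] := u2 k.
- by move=> k; have [uk u1] := u2 k; rewrite A_N// u1 sqrtr1.
have le k : N (Sh a (A (unit_fun mu (E k)))) <= k.+1%:R^-1.
  have [uk _] := u2 k; have [mE Esub E0 Ef] := HE k.
  rewrite shift_transform// A_N; last exact: L2_mul_shifted.
  rewrite -[leRHS]ger0_norm ?invr_ge0// -sqrtr_sqr ler_sqrt ?sqr_ge0//.
  have M0 : 0 <= (k.+1%:R^-1 : R) by rewrite invr_ge0.
  exact: (unit_fun_mul_le mE E0 Ef (cmeasurable_shifted a) M0 (fun x Ex => ltW (Esub x Ex))).2.
apply: (squeeze_cvgr (f := cst 0) (h := fun k => k.+1%:R^-1)).
- apply: nearW => k; rewrite le andbT.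
  have [uk _] := u2 k; rewrite shift_transform// A_N ?sqrtr_ge0//; exact: L2_mul_shifted.
- exact: cvg_cst.
- exact: cvg_harmonic.
Qed.

Lemma eigenvalueP a : is_eigenvalue H Tm a <-> (0 < mu [set x | m x = a])%E.
Proof.
have mE : measurable [set x | m x = a].
  have := measurable_eq0 (cmeasurable_shifted a).
  by congr measurable; apply/seteqP; split=> x /= => [/eqP|->]; rewrite ?subr_eq0 ?subrr// => /eqP.
split=> [[F [/A_surj[f f2 ->] F0 TF]]|E0].
  rewrite lt0e measure_ge0 andbT; apply/eqP => E0; apply: F0; apply: A_eq0 => //.
  have : A (fun x => (m x - a) * f x) = 0 by rewrite -shift_transform// /shift_operator TF subrr.
  move/(transform_inj0 (L2_mul_shifted a f2))/(l2n_eq0P (L2_mul_shifted a f2)) => z0.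
  apply: (l2n_eq0 f2 (Z := [set x | m x = a] `|` [set x | (m x - a) * f x <> 0])).
  - apply: measurableU => //; apply: measurable_neq0.
    by have [] := L2_mul_shifted a f2.
  - apply: measure_negligible.
      by apply: measurableU => //; apply: measurable_neq0; have [] := L2_mul_shifted a f2.
    apply: negligibleU; apply/negligibleP => //.
    by apply: measurable_neq0; have [] := L2_mul_shifted a f2.
  - move=> x /= /not_orP[ma /contrapT/eqP]; rewrite mulf_eq0 => /orP[|/eqP//].
    by rewrite subr_eq0 => /eqP.
have [//||E' [mE' EE _ E'0 Efin]] := @positive_piece _ (fun=> setT) mE _ _ E0.
  by move=> x _; exists 0.
have [u2 u1] := unit_fun_L2 mE' E'0 Efin.
exists (A (unit_fun mu E')); split; first exact: A_H.
  by move=> /(transform_inj0 u2)/eqP; rewrite u1 oner_eq0.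
apply/eqP; rewrite -subr_eq0 -/(Sh a (A (unit_fun mu E'))) shift_transform//; apply/eqP.
rewrite -transform0; congr A; apply/funext => x; rewrite /unit_fun indicE.
case: (boolP (x \in E')) => [/set_mem/EE/= ->|_]; first by rewrite subrr mul0r.
by rewrite mulr0 mulr0.
Qed.

(** An invertible shift has zero kernel and full range, so empty families ([k = 0]) witness both
    finiteness conditions. *)
Lemma essential_sub_spectrum : essential_spectrum H N Tm `<=` spectrum H N Tm.
Proof.
move=> a; apply: contra_not => -[S [[SH SL [M SM]] ST TS]].
have T0 : Sh a 0 = 0.
  rewrite -{1}transform0 shift_transform; last exact: L2_0.
  by rewrite -transform0; congr A; apply/funext => x; rewrite mulr0.
have H0 : H 0 by rewrite -transform0; apply: A_H; exact: L2_0.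
have ShH F : H F -> H (Sh a F).
  by move=> /A_surj[f f2 ->]; rewrite shift_transform//; apply: A_H; exact: L2_mul_shifted.
split.
- exists 0, (fun=> 0); split; first by case.
  move=> F HF TF; exists (fun=> 0); rewrite big_ord0 -(ST F HF) TF.
  by rewrite -{2}(ST 0 H0) T0.
- move=> F G HF HG _; exists (S G); first exact: SH.
  exact: TS.
- exists 0, (fun=> 0); split; first by case.
  by move=> G HG; exists (S G), (fun=> 0); rewrite big_ord0 addr0 TS//; split=> //; exact: SH.
Qed.

Lemma transform_sum (k : nat) (f : 'I_k -> T -> R[i]) (v : 'I_k -> R[i]) :
  (forall j, L2 mu (f j)) ->
  A (fun x => \sum_(j < k) v j * f j x) = \sum_(j < k) v j *: A (f j).
Proof.
elim: k f v => [|k IH] f v f2.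
  by rewrite big_ord0 -transform0; congr A; apply/funext => x; rewrite big_ord0.
rewrite big_ord_recl -IH// -A_lin//.
  by congr A; apply/funext => x; rewrite big_ord_recl.
by apply: L2_sum => j; exact: L2Z.
Qed.

Lemma measurable_polynomial (p : {poly R[i]}) : measurable [set x | p.[(t x)%:C] = 0].
Proof.
apply: measurable_eq0; under eq_fun do rewrite horner_coef.
apply: cmeasurable_sum => j; apply: cmeasurableM; first exact: cmeasurable_cst.
under eq_fun do rewrite -rmorphXn.
by apply: cmeasurable_real; exact: measurable_funX.
Qed.

(** Over an algebraically closed field [p] has a list of roots. The real number [t x] can only be
    the real part of one of them, and each level set of [t] is null. *)
Lemma null_polynomial (p : {poly R[i]}) : p != 0 -> mu [set x | p.[(t x)%:C] = 0] = 0.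
Proof.
move=> p0; have [r pE] := closed_field_poly_normal p.
apply: measure_negligible; first exact: measurable_polynomial.
have rS : [set x | p.[(t x)%:C] = 0] `<=` \bigcup_j [set x | t x = complex.Re (nth 0 r j)].
  move=> x /= /eqP; rewrite -[_ == 0]/(root p (t x)%:C) pE rootZ ?lead_coef_eq0//.
  by rewrite root_prod_XsubC => /(nthP 0)[j _ jE]; exists j => //=; rewrite jE.
apply: (negligibleS rS); apply: negligible_bigcup => j; apply/negligibleP; last exact: t_null.
rewrite -[X in measurable X]setTI.
exact: (mt measurableT (measurable_set1 (complex.Re (nth 0 r j)))).
Qed.

(* On a piece of [m = a] where [t] is bounded, the powers of [t] are independent elements of the
   kernel, because a nonzero polynomial in [t] vanishes only on a null set. *)
Lemma kernel_infinite a : (0 < mu [set x | m x = a])%E ->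
  ~ finite_dim_kernel H (Sh a).
Proof.
move=> E0 [k [b [_ span]]].
have mE : measurable [set x | m x = a].
  have := measurable_eq0 (cmeasurable_shifted a).
  by congr measurable; apply/seteqP; split=> x /= => [/eqP|->]; rewrite ?subr_eq0 ?subrr// => /eqP.
have mtC j : measurable [set x | `|t x| <= j%:R].
  have mat : measurable_fun setT (fun x => `|t x|) by exact: measurableT_comp.
  have /(_ measurableT _ (@measurable_itv R `]-oo, j%:R])) := mat.
  by rewrite setTI; congr measurable; apply/seteqP; split => x /=; rewrite in_itv.
have [|E' [mE' EE [K EK] E'0 Efin]] := positive_piece mE mtC _ E0.
  move=> x _; exists (Num.truncn `|t x|).+1 => //=; apply: ltW; exact: truncnS_gt.
pose u := unit_fun mu E'.
pose f (j : 'I_k.+1) x := (t x ^+ j)%:C * u x.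
have f2 j : L2 mu (f j).
  have mtj : cmeasurable (fun x => (t x ^+ j)%:C).
    by apply: cmeasurable_real; exact: measurable_funX.
  have K0 : 0 <= (K%:R ^+ j : R) by rewrite exprn_ge0.
  have tK x : E' x -> normc (t x ^+ j)%:C <= K%:R ^+ j.
    by move=> /EK/= tx; rewrite normcr normrX lerXn2r ?nnegrE.
  exact: (unit_fun_mul_le mE' E'0 Efin mtj K0 tK).1.
have fz j : Sh a (A (f j)) = 0.
  rewrite shift_transform// -transform0; congr A; apply/funext => x; rewrite /f /u /unit_fun indicE.
  case: (boolP (x \in E')) => [/set_mem/EE/= ->|_]; first by rewrite subrr mul0r.
  by rewrite !mulr0.
have [c cE] := choice (fun j => span (A (f j)) (A_H (f2 j)) (fz j)).
(* The [k + 1] vectors [A (f j)] lie in the span of [k] vectors. A nonzero row [v] with [v *m C = 0]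
   is a linear dependence among them. *)
pose C : 'M[R[i]]_(k.+1, k) := \matrix_(j, i) c j i.
have kn0 : kermx C != 0.
  rewrite kermx_eq0 /row_free; apply/eqP => rk.
  by have := rank_leq_col C; rewrite rk ltnn.
pose v := nz_row (kermx C).
have v0 : v != 0 by rewrite nz_row_eq0.
have vC : v *m C = 0 by apply/sub_kermxP; exact: nz_row_sub.
have Av : A (fun x => \sum_(j < k.+1) v 0 j * f j x) = 0.
  rewrite transform_sum//; under eq_bigr do rewrite cE scaler_sumr.
  rewrite exchange_big /= big1// => i _; under eq_bigr do rewrite scalerA.
  have sE : \sum_(j < k.+1) v 0 j * c j i = (v *m C) 0 i.
    by rewrite mxE; apply: eq_bigr => j _; rewrite mxE.
  by rewrite -scaler_suml sE vC mxE scale0r.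
have g2 : L2 mu (fun x => \sum_(j < k.+1) v 0 j * f j x).
  by apply: L2_sum => j; exact: L2Z.
have gz := (l2n_eq0P g2).1 (transform_inj0 g2 Av).
pose p : {poly R[i]} := \poly_(j < k.+1) v 0 (inord j).
have pv (j : 'I_k.+1) : p`_j = v 0 j by rewrite coef_poly ltn_ord inord_val.
have p0 : p != 0.
  apply: contraNneq v0 => pz; apply/eqP/rowP => j; rewrite mxE -pv pz coef0.
  by [].
have gE x : \sum_(j < k.+1) v 0 j * f j x = p.[(t x)%:C] * u x.
  rewrite (@horner_coef_wide _ k.+1) ?size_poly// mulr_suml; apply: eq_bigr => j _.
  by rewrite pv /f rmorphXn mulrA.
have := @measure_pos_sub _ _ _ mu E' set0
  ([set x | \sum_(j < k.+1) v 0 j * f j x <> 0] `|` [set x | p.[(t x)%:C] = 0]) mE' measurable0.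
have mg : measurable [set x | \sum_(j < k.+1) v 0 j * f j x <> 0].
  by apply: measurable_neq0; case: g2.
have mp := measurable_polynomial p.
move=> W; suff : (0 < mu set0)%E by rewrite measure0 ltxx.
apply: (W _ _ _ E'0).
- exact: measurableU.
- move=> x E'x; right; have [px|px] := eqVneq p.[(t x)%:C] 0; first by right.
  left => /=; rewrite gE; apply/eqP; rewrite mulf_neq0//.
  rewrite -normc_eq0 /u /unit_fun indicE mem_set// mulr1 normcr normr_eq0 invr_eq0.
  by rewrite gt_eqF// sqrtr_gt0 fine_gt0// E'0.
- apply: measure_negligible; first exact: measurableU.
  apply: negligibleU; apply/negligibleP => //; exact: null_polynomial.
Qed.

(** Splitting off the first term with [|f + g|^2 <= 2 |f|^2 + 2 |g|^2] turns a constant [c] into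
    [2 + c / 2]; the constant 4 is the fixed point, so it survives the induction. *)
Lemma geometric_tail_le (e : nat -> T -> R[i]) : (forall j, L2 mu (e j)) ->
  (forall j, l2n mu (e j) <= 1) -> forall d l,
  l2n mu (fun x => \sum_(j < d) (2^-1 ^+ (l + j))%:C * e (l + j)%N x) <= 4 * 4^-1 ^+ l.
Proof.
move=> e2 e1; elim=> [|k IH] l.
  under [X in l2n _ X]eq_fun do rewrite big_ord0.
  have -> : l2n mu (fun=> 0 : R[i]) = 0.
    by rewrite /l2n /l2sq; under eq_integral do rewrite normc0 expr0n; rewrite integral0.
  by rewrite mulr_ge0// exprn_ge0// invr_ge0.
have s2 : L2 mu (fun x => \sum_(j < k) (2^-1 ^+ (l.+1 + j))%:C * e (l.+1 + j)%N x).
  by apply: L2_sum => j; exact: L2Z.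
have h2 := L2Z (2^-1 ^+ l)%:C (e2 l).
have -> : (fun x => \sum_(j < k.+1) (2^-1 ^+ (l + j))%:C * e (l + j)%N x) =
    (fun x => (2^-1 ^+ l)%:C * e l x +
      \sum_(j < k) (2^-1 ^+ (l.+1 + j))%:C * e (l.+1 + j)%N x).
  apply/funext => x; rewrite big_ord_recl addn0; congr (_ + _).
  by apply: eq_bigr => j _; rewrite /bump /= addnA addn1.
apply: (le_trans (l2nD_le h2 s2)).
have q4 : normc (2^-1 ^+ l)%:C ^+ 2 = 4^-1 ^+ l :> R.
  rewrite normcr ger0_norm ?exprn_ge0 ?invr_ge0// -exprM mulnC exprM; congr (_ ^+ _).
  by field.
have := IH l.+1; rewrite l2nZ// q4 exprS.
have q0 : 0 <= (4^-1 ^+ l : R) by rewrite exprn_ge0// invr_ge0.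
have := ler_wpM2l q0 (e1 l); rewrite mulr1; set q := 4^-1 ^+ l in q0 *.
set w := q * l2n _ _; set y := l2n _ _.
move=> w1 y1; have : 2 * w + 2 * y <= 2 * q + 2 * (4 * (4^-1 * q)).
  by rewrite lerD// ler_wpM2l.
by move=> /le_trans; apply; rewrite le_eqVlt; apply/orP; left; apply/eqP; field.
Qed.

(* Unit vectors [e_j] supported where [|m - a| < 4^-j] but away from [m = a] have preimages, so
   [G = \sum_j 2^-j e_j] is a limit of the range; [(m - a) f = G] would give
   [2^-j <= |<G, e_j>| <= 4^-j |f|] for all [j]. *)
Lemma range_not_closed a : range_m a -> mu [set x | m x = a] = 0 ->
  ~ closed_range H N (Sh a).
Proof.
move=> ra ma0 cl; have msa := cmeasurable_shifted a.
have mE : measurable [set x | m x = a].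
  have := measurable_eq0 msa.
  by congr measurable; apply/seteqP; split=> x /= => [/eqP|->]; rewrite ?subr_eq0 ?subrr// => /eqP.
pose C (k : nat) := [set x | k.+1%:R^-1 <= normc (m x - a)].
have mC k : measurable (C k) by exact: measurable_normc_ge.
have pk (j : nat) : exists E, [/\ measurable E,
    E `<=` [set x | normc (m x - a) < 4^-1 ^+ j], exists k, E `<=` C k,
    (0 < mu E)%E & (mu E < +oo)%E].
  have j0 : 0 < (4^-1 ^+ j : R) by rewrite exprn_gt0// invr_gt0.
  have mF := measurable_normc_lt (4^-1 ^+ j) msa.
  have mG : measurable ([set x | normc (m x - a) < 4^-1 ^+ j] `&` ~` [set x | m x = a]).
    by apply: measurableI => //; exact: measurableC.
  have Gp := measure_pos_sub mF mG mE _ ma0 (ra _ j0).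
  have [||E [mE' EG EC E0 Ef]] := positive_piece mG mC _ (Gp _).
  - move=> x [_ /= xa]; have : 0 < normc (m x - a).
      by rewrite normc_gt0 subr_eq0; apply/eqP.
    move=> /ltr_add_invr[k]; rewrite add0r => hk; exists k => //; exact: ltW.
  - by move=> x /= xF; have [xa|xa] := pselect (m x = a); [right|left; split].
  by exists E; split=> // x /EG[].
have [E HE] := choice pk.
pose e j := unit_fun mu (E j).
have e2 j : L2 mu (e j) /\ l2n mu (e j) = 1.
  by have [mEj _ _ E0 Ef] := HE j; exact: unit_fun_L2.
have e2' j : L2 mu (e j) by case: (e2 j).
pose f j x := (m x - a)^-1 * e j x.
have f2 j : L2 mu (f j).
  have [mEj _ [k Ek] E0 Ef] := HE j.
  apply: (unit_fun_mul_le mEj E0 Ef (cmeasurableV msa) (M := k.+1%:R) _ _).1 => // x /Ek.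
  rewrite /C/= => h; have xp : 0 < normc (m x - a) by apply: lt_le_trans h; rewrite invr_gt0.
  by rewrite normcV invf_ple ?posrE.
have fE j x : (m x - a) * f j x = e j x.
  rewrite /f; have [mEj _ [k Ek] _ _] := HE j.
  have [xa|xa] := eqVneq (m x - a) 0; last by rewrite mulrA divff// mul1r.
  rewrite xa mul0r /e /unit_fun indicE memNset ?mulr0// => /Ek.
  by rewrite /C/= xa normc0 leNgt invr_gt0 ltr0Sn.
pose g (k : nat) x := \sum_(j < k) (2^-1 ^+ j)%:C * e j x.
pose h (k : nat) x := \sum_(j < k) (2^-1 ^+ j)%:C * f j x.
have g2 k : L2 mu (g k) by apply: L2_sum => j; exact: L2Z.
have h2 k : L2 mu (h k) by apply: L2_sum => j; exact: L2Z.
have hg k : (fun x => (m x - a) * h k x) = g k.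
  apply/funext => x; rewrite /h /g mulr_sumr; apply: eq_bigr => j _.
  by rewrite mulrCA fE.
have gtail k l : (l <= k)%N -> l2n mu (fun x => g k x - g l x) <= 4 * 4^-1 ^+ l.
  move=> lk; have e1 j : l2n mu (e j) <= 1 by rewrite (e2 j).2.
  have := geometric_tail_le e2' e1 (k - l) l; rewrite (_ : (fun x => _) = fun x => g k x - g l x)//.
  apply/funext => x; rewrite /g.
  rewrite -(big_mkord predT (fun j => (2^-1 ^+ j)%:C * e j x)).
  rewrite -(big_mkord predT (fun j => (2^-1 ^+ j)%:C * e j x)).
  rewrite (big_cat_nat (n := l))//= [X in _ = X - _]addrC addrK.
  rewrite (_ : \sum_(l <= i < k) _ = \sum_(0 + l <= i < k) (2^-1 ^+ i)%:C * e i x)// big_addn big_mkord; apply: eq_bigr => j _.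
  by rewrite addnC.
have q0 : 4 * 4^-1 ^+ k @[k --> \oo] --> (0 : R).
  rewrite -[X in _ --> X](mulr0 4); apply: cvgM; first exact: cvg_cst.
  by apply: cvg_expr; rewrite ger0_norm ?invr_ge0// invf_lt1// ltr1n.
have [G G2 gG] : exists2 G, L2 mu G & l2n mu (fun x => g k x - G x) @[k --> \oo] --> (0 : R).
  apply: riesz_fischer => // eps eps0.
  have /cvgr0Pnorm_le/(_ _ eps0)[n0 _ Hn] := q0.
  exists n0 => k l nk nl; wlog lk : k l nk nl / (l <= k)%N.
    move=> W; have [|/ltnW kl] := leqP l k; first exact: W.
    rewrite (eq_l2n mu (g := fun x => g l x - g k x)); first exact: W.
    by move=> x; exact: normc_distC.
  apply: (le_trans (gtail k l lk)); apply: le_trans (Hn l nl).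
  exact: ler_norm.
have Hh k : H (A (h k)) by exact: A_H.
have [|F HF FG] := cl _ _ Hh (A_H G2).
  have : Num.sqrt (l2n mu (fun x => g k x - G x)) @[k --> \oo] --> (0 : R).
    rewrite -[X in _ --> X]sqrtr0; apply: (cvg_comp _ _ gG); exact: sqrt_continuous.
  suff E1 k : N (Sh a (A (h k)) - A G) = Num.sqrt (l2n mu (fun x => g k x - G x)).
    by under eq_fun do rewrite -E1.
  by rewrite shift_transform// hg -transformB// A_N//; exact: L2B.
have [f0 f02 FE] := A_surj HF.
have m2 := L2_mul_shifted a f02.
have D2 := L2B m2 G2.
have D0 : l2n mu (fun x => (m x - a) * f0 x - G x) = 0.
  by apply: transform_inj0 => //; rewrite transformB// -shift_transform// -FE FG subrr.
have upper j : normc (cdot mu G (e j)) ^+ 2 <= l2n mu f0 * (4^-1 ^+ j) ^+ 2.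
  have -> : cdot mu G (e j) = cdot mu (fun x => (m x - a) * f0 x) (e j).
    apply/esym/eqP; rewrite -subr_eq0 -cdotBl// -normc_eq0 -sqrf_eq0.
    by rewrite eq_le sqr_ge0 andbT (le_trans (cauchy_schwarz D2 (e2' j)))// D0 mul0r.
  have [mEj Ej _ E0 Ef] := HE j.
  have jp : 0 <= (4^-1 ^+ j : R) by rewrite exprn_ge0// invr_ge0.
  have jle x : E j x -> normc (conjc (m x - a)) <= 4^-1 ^+ j.
    by move=> Ex; rewrite normc_conj; exact: ltW (Ej x Ex).
  have [c2 cle] := unit_fun_mul_le mEj E0 Ef (cmeasurableJ msa) jp jle.
  have -> : cdot mu (fun x => (m x - a) * f0 x) (e j) =
      cdot mu f0 (fun x => conjc (m x - a) * e j x).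
    by apply: eq_cintegral => x; rewrite conjcM conjcK; ring.
  apply: (le_trans (cauchy_schwarz f02 c2)).
  exact: (ler_wpM2l (l2n_ge0 mu f0) cle).
(* The supports of the [e j] may overlap, so these vectors need not be orthogonal. Nonnegative inner
   products are enough for the lower bound. *)
have ee i j : 0 <= complex.Re (cdot mu (e i) (e j)).
  apply: Rintegral_ge0 => x _; rewrite /e /unit_fun conjc_real -rmorphM.
  by rewrite mulr_ge0// mulr_ge0// invr_ge0 sqrtr_ge0.
have gS k j : complex.Re (cdot mu (g k.+1) (e j)) =
    complex.Re (cdot mu (g k) (e j)) + 2^-1 ^+ k * complex.Re (cdot mu (e k) (e j)).
  have -> : g k.+1 = (fun x => g k x + (2^-1 ^+ k)%:C * e k x).
    by apply/funext => x; rewrite /g big_ord_recr.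
  rewrite cdotDl//; last exact: L2Z.
  by rewrite cdotZl// cReD cReM !ReImE mul0r subr0.
have p2 k : 0 <= (2^-1 ^+ k : R) by rewrite exprn_ge0// invr_ge0.
have g_ge k j : 0 <= complex.Re (cdot mu (g k) (e j)) /\
    ((j < k)%N -> 2^-1 ^+ j <= complex.Re (cdot mu (g k) (e j))).
  elim: k => [|k [IH0 IH]].
    split=> //; have -> : g 0 = (fun x => 0 * e j x).
      by apply/funext => x; rewrite /g big_ord0 mul0r.
    by rewrite cdotZl// mul0r.
  have pk0 := mulr_ge0 (p2 k) (ee k j); rewrite gS; split; first exact: addr_ge0.
  rewrite ltnS leq_eqVlt => /orP[/eqP jk|/IH jk].
    by move: IH0; rewrite -jk cdot_normal (e2 j).2 mulr1 lerDr.
  by apply: (le_trans jk); rewrite lerDl.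
have lower j : 2^-1 ^+ j <= normc (cdot mu G (e j)).
  rewrite leNgt; apply/negP => lt; have cv := cdot_cvg g2 G2 (e2' j) gG.
  have d0 : 0 < 2^-1 ^+ j - normc (cdot mu G (e j)) by rewrite subr_gt0.
  have /cvgr0Pnorm_lt/(_ _ d0)[k0 _ Hk] := cv.
  pose k := maxn k0 j.+1; have := Hk k (leq_maxl _ _).
  rewrite ger0_norm ?normc_ge0// ltNge => /negP; apply; rewrite lerBlDr.
  have [_ /(_ (leq_maxr _ _)) h1] := g_ge k j.
  apply: (le_trans h1); apply: (le_trans (le_trans (ler_norm _) (le_Re_normc _))).
  by rewrite -{1}(subrK (cdot mu G (e j)) (cdot mu (g k) (e j))); exact: le_normcD.
have bound j : 4 ^+ j <= l2n mu f0.
  have q4 : 0 < (4 ^+ j : R) by rewrite exprn_gt0.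
  have := le_trans (lerXn2r 2 _ _ (lower j)) (upper j).
  rewrite !nnegrE p2 normc_ge0 => /(_ isT isT).
  rewrite -!exprM !(mulnC j) !exprM (_ : (2^-1 ^+ 2 : R) = 4^-1); last by field.
  rewrite (_ : (4^-1 ^+ 2 : R) = 4^-1 * 4^-1)// exprMn mulrA exprVn.
  by rewrite -[X in X <= _]mul1r ler_pM2r ?invr_gt0// ler_pdivlMr// mul1r.
have := bound (Num.truncn (l2n mu f0)).+1; rewrite leNgt => /negP; apply.
apply: (lt_le_trans (truncnS_gt _)); rewrite -natrX ler_nat.
by apply: ltnW; exact: ltn_expl.
Qed.

Lemma range_sub_essential : range_m `<=` essential_spectrum H N Tm.
Proof.
move=> a ra [fk cl _]; have [a0|a0] := ltP 0%E (mu [set x | m x = a]).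
  exact: (kernel_infinite a0 fk).
apply: (range_not_closed ra _ cl).
by apply/eqP; rewrite eq_le a0 measure_ge0.
Qed.

Theorem multiplication_operator_spectra :
  [/\ spectrum H N Tm = range_m,
      forall a, is_eigenvalue H Tm a <-> (0 < mu [set x | m x = a])%E,
      spectrum H N Tm = approximate_point_spectrum H N Tm &
      spectrum H N Tm = essential_spectrum H N Tm].
Proof.
have sE : spectrum H N Tm = range_m.
  apply/seteqP; split; first exact: spectrum_sub.
  by move=> a /range_sub_approx; exact: approx_sub_spectrum.
split=> //; first exact: eigenvalueP.
- apply/seteqP; split; last exact: approx_sub_spectrum.
  by rewrite sE; exact: range_sub_approx.
- apply/seteqP; split; last exact: essential_sub_spectrum.
  by rewrite sE; exact: range_sub_essential.
Qed.

End multiplication_operator.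

(** * Conjugation of S_phi to a multiplication operator *)

Section reduction.
Variables (R : realType) (n : nat).
Notation Rn := (n.+1.-tuple (measurableTypeR R)).
Notation Cn := 'rV[R[i]]_n.+1.
Notation mu := (lebesgue_n R n.+1).
Notation leb2 := (lebesgue_n R n.+1 \x lebesgue_n R n.+1)%E.

Lemma powR_half_natr (a : R) (k : nat) : 0 <= a -> a `^ (k%:R / 2) = Num.sqrt a ^+ k.
Proof.
by move=> a0; rewrite mulrC powRrM powR12_sqrt// powR_mulrn// sqrtr_ge0.
Qed.

Lemma hyperplane_null (c : R) : mu [set x : Rn | thead x = c] = 0.
Proof.
have := @cons_measureE _ _ R n (@lebesgue_measure R) (lebesgue_n R n) [set c] setT
  (measurable_set1 c) measurableT.
move=> E; apply: etrans (etrans _ E) _.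
  by congr (cons_measure _ _ _); apply/seteqP; split => x //= -[].
by rewrite -[RHS](mul0e (lebesgue_n R n setT)); congr (_ * _)%E; exact: lebesgue_measure_set1.
Qed.

Lemma gauss_transform_cintegrable (m : Rn -> R[i]) (M : R) (v : Cn) :
  cmeasurable m -> (forall x, normc (m x) <= M) ->
  cintegrable mu (fun x =>
    let u := real_vec x - ('i%C / 2) *: v in m x * cexp (- 2 * dotc u u)).
Proof.
move=> mm mM; have [fi _] := @cexp_gaussian_integral R n.+1 v.
have := cintegrableZ (cexp (dotc v v / 2)) fi.
set F := fun x => _ => Fi; have mF := cintegrable_cmeasurable Fi.
have -> : (fun x => let u := real_vec x - ('i%C / 2) *: v in m x * cexp (- 2 * dotc u u)) =
    (fun x => m x * F x) by apply/funext => x; rewrite /F -dotc_shifted.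
have M0 : 0 <= M by exact: (le_trans (normc_ge0 (m [tuple of nseq n.+1 0])) (mM _)).
have /cintegrableP[_ Ffin] := Fi.
apply/cintegrableP; split; first exact: cmeasurableM.
have mn : measurable_fun setT (fun x => (normc (F x))%:E).
  by apply/measurable_EFinP; exact: measurable_normc.
have mmn : measurable_fun setT (fun x => (normc (m x * F x))%:E).
  by apply/measurable_EFinP; apply: measurable_normc; exact: cmeasurableM.
apply: (@le_lt_trans _ _ (\int[mu]_x (M%:E * (normc (F x))%:E))%E).
  apply: ge0_le_integral => //.
  - by move=> x _; rewrite lee_fin normc_ge0.
  - exact: measurable_funeM.
  - by move=> x _; rewrite -EFinM lee_fin normcM ler_wpM2r ?normc_ge0.
rewrite ge0_integralZl// ?lte_mul_pinfty//; try by move=> x _; rewrite lee_fin normc_ge0.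
Qed.

(** With [g = conj (m k_z)] the integral defining the left side at [z] is the inner product of the
    transforms of [f] and [g]. The isometry replaces it by the inner product of [f] and [g], which
    takes the place of an exchange of integrals. *)
Lemma S_operator_bargmann (m : Rn -> R[i]) (M : R) (phi : Cn -> R[i]^o) (f : Rn -> R[i]) :
  cmeasurable m -> (forall x, normc (m x) <= M) ->
  (forall z, phi z = gauss_transform m z) -> L2 mu f ->
  S_operator phi (bargmann f) = bargmann (fun x => m x * f x).
Proof.
move=> mm mM phiE f2; apply/funext => z.
pose g x := conjc (m x * bargmann_kernel x z).
have k2 := L2_bargmann_kernel z.
have g2 : L2 mu g.
  apply: L2J; exact: (L2_mul_m mm mM k2).
have gE w : conjc (bargmann g w) = cexp (dotc z (conj_vec w)) * phi (z - conj_vec w).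
  rewrite -cintegralJ; last exact: bargmann_cintegrable.
  rewrite phiE /gauss_transform powR_half_natr ?divr_ge0 ?pi_ge0// -sqr_bargmann_const.
  rewrite mulrA -[in RHS]cintegralZ; last exact: (gauss_transform_cintegrable _ mm mM).
  apply: eq_cintegral => x; rewrite conjcM /g conjcK -mulrA bargmann_kernelM.
  set e1 := cexp _; set e2 := cexp _; ring.
transitivity (cdot leb2 (weighted (bargmann f)) (weighted (bargmann g))).
  apply: eq_cintegral => p; rewrite /S_integrand /weighted.
  move: (gE (complex_vec p)); move: (bargmann g _) (bargmann f _) => b b' gE'.
  rewrite conjcM conjc_real -sqr_weight rmorphXn -[_ * cexp _ * phi _]mulrA -gE'; ring.
rewrite cdot_weighted_bargmann//; apply: eq_cintegral => x.
by rewrite /g conjcK; move: (bargmann_kernel x z) => b; ring.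
Qed.

Lemma bargmann_eq0 (f : Rn -> R[i]) : L2 mu f -> l2n mu f = 0 -> bargmann f = fun=> 0.
Proof.
move=> f2 f0; apply/funext => z; apply/eqP; rewrite -normc_eq0 -sqrf_eq0.
rewrite eq_le sqr_ge0 andbT bargmann_cdot (le_trans (cauchy_schwarz f2 (L2_coherent z)))//.
by rewrite f0 mul0r.
Qed.

Lemma fock_norm_bargmann (f : Rn -> R[i]) : L2 mu f ->
  fock_norm (bargmann f) = Num.sqrt (l2n mu f).
Proof. by move=> f2; rewrite /fock_norm fock_sqnormE l2sq_weighted_bargmann. Qed.

Lemma gauss_transform_ae_eq (m m' : Rn -> R[i]) (z : Cn) : cmeasurable m -> cmeasurable m' ->
  mu [set x | m x - m' x <> 0] = 0 -> gauss_transform m z = gauss_transform m' z.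
Proof.
move=> mm mm' mm'0; have [fi _] := @cexp_gaussian_integral R n.+1 z.
have mF := cintegrable_cmeasurable (cintegrableZ (cexp (dotc z z / 2)) fi).
have me : cmeasurable (fun x : Rn => let u := real_vec x - ('i%C / 2) *: z in
    cexp (- 2 * dotc u u)).
  rewrite (_ : (fun x => _) = (fun x => cexp (dotc z z / 2) * fourier_kernel x z))//.
  by apply/funext => x; rewrite -dotc_shifted.
congr (_ * _); apply: (cintegral_ae_eq _ _ _ mm'0).
- exact: (cmeasurableM mm me).
- exact: (cmeasurableM mm' me).
- by apply: measurable_neq0; exact: cmeasurableB.
- by move=> x /contrapT/eqP; rewrite subr_eq0 => /eqP ->.
Qed.

End reduction.

Section ae_invariance.
Context d (T : measurableType d) (R : realType) (mu : {measure set T -> \bar R}).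
Variables m m' : T -> R[i].
Hypotheses (mm : cmeasurable m) (mm' : cmeasurable m').
Hypothesis mm'0 : mu [set x | m x - m' x <> 0] = 0.

Let mZ : measurable [set x | m x - m' x <> 0].
Proof. by apply: measurable_neq0; exact: cmeasurableB. Qed.

Lemma essential_range_ae_sub : essential_range mu m `<=` essential_range mu m'.
Proof.
move=> a ra e e0; apply: (measure_pos_sub _ _ mZ _ mm'0 (ra e e0)).
- by apply: measurable_normc_lt; apply: cmeasurableB => //; exact: cmeasurable_cst.
- by apply: measurable_normc_lt; apply: cmeasurableB => //; exact: cmeasurable_cst.
- move=> x /= mx; have [E|E] := eqVneq (m x - m' x) 0; last by right; apply/eqP.
  by left; rewrite (_ : m' x = m x)//; apply/esym/eqP; rewrite -subr_eq0; apply/eqP.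
Qed.

Lemma level_set_pos_ae a : (0 < mu [set x | m x = a])%E -> (0 < mu [set x | m' x = a])%E.
Proof.
have lev (f : T -> R[i]) : cmeasurable f -> measurable [set x | f x = a].
  move=> mf; have := measurable_eq0 (cmeasurableB mf (cmeasurable_cst _ a)).
  by congr measurable; apply/seteqP; split=> x /= => [/eqP|->]; rewrite ?subr_eq0 ?subrr// => /eqP.
apply: (measure_pos_sub _ _ mZ _ mm'0); try exact: lev.
move=> x /= <-; have [E|E] := eqVneq (m x - m' x) 0; last by right; apply/eqP.
by left; apply/esym/eqP; rewrite -subr_eq0; apply/eqP.
Qed.

End ae_invariance.

(* The dimension is n.+1, so that n ranges over all dimensions >= 1. *)
Theorem theorem5p4 (R : realType) (n : nat)
    (phi : 'rV[R[i]]_n.+1 -> R[i]^o)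
    (m : n.+1.-tuple (measurableTypeR R) -> R[i])
    (phi_fock : fock_space phi)
    (S_bdd : S_bounded phi)
    (m_Linfty : Linfty (lebesgue_n R n.+1) m)
    (phiE : forall z, phi z = gauss_transform m z) :
  let H := @fock_space R n in
  let N := @fock_norm R n.+1 in
  let T := S_operator phi in
  let range_m := essential_range (lebesgue_n R n.+1) m in
  [/\ spectrum H N T = range_m,
      forall mu : R[i], range_m mu ->
        (is_eigenvalue H T mu <->
         (0 < lebesgue_n R n.+1 [set x | m x = mu])%E),
      spectrum H N T = approximate_point_spectrum H N T &
      spectrum H N T = essential_spectrum H N T].
Proof.
move=> H N T range_m; have [mm _] := m_Linfty.
(* [m] is bounded only almost everywhere. The bounded [m'] gives the same [phi], the same essential
   range and level sets that are null for the same values. *)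
have [m' [M [mm' m'M mm'0]]] := Linfty_bounded m_Linfty.
have m'm0 : lebesgue_n R n.+1 [set x | m' x - m x <> 0] = 0.
  rewrite -mm'0; congr (lebesgue_n R n.+1 _).
  by apply/funext => x; apply/propext; split; apply: contra_not => /eqP;
    rewrite subr_eq0 eq_sym -subr_eq0 => /eqP.
have phiE' z : phi z = gauss_transform m' z by rewrite phiE; exact: gauss_transform_ae_eq.
have rE : range_m = essential_range (lebesgue_n R n.+1) m'.
  by apply/seteqP; split; exact: essential_range_ae_sub.
(* The first coordinate serves as [t]: its level sets are hyperplanes, hence null. It exists because
   the dimension is positive. *)
have mt : measurable_fun setT (fun x : n.+1.-tuple (measurableTypeR R) => thead x : R).
  exact: (measurable_tnth ord0).
pose A (f : n.+1.-tuple (measurableTypeR R) -> R[i]) : 'rV[R[i]]_n.+1 -> R[i]^o := bargmann f.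
have A_H f : L2 (lebesgue_n R n.+1) f -> H (A f) by exact: bargmann_fock.
have A_lin a f g : L2 (lebesgue_n R n.+1) f -> L2 (lebesgue_n R n.+1) g ->
    A (fun x => a * f x + g x) = a *: A f + A g.
  move=> f2 g2; apply/funext => z; rewrite /A bargmannD//; last exact: L2Z.
  by rewrite bargmannZ.
have A_N f : L2 (lebesgue_n R n.+1) f -> N (A f) = Num.sqrt (l2n (lebesgue_n R n.+1) f).
  exact: fock_norm_bargmann.
have A_eq0 f : L2 (lebesgue_n R n.+1) f -> l2n (lebesgue_n R n.+1) f = 0 -> A f = 0.
  exact: bargmann_eq0.
have TE f : L2 (lebesgue_n R n.+1) f -> T (A f) = A (fun x => m' x * f x).
  exact: (S_operator_bargmann mm' m'M phiE').
have [s1 s2 s3 s4] := multiplication_operator_spectra A_H (@bargmann_surj R n) A_lin A_N A_eq0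
  mm' m'M TE mt (@hyperplane_null R n).
split=> //; first by rewrite rE.
move=> a _; split=> [/s2|a0]; first exact: level_set_pos_ae.
by apply/s2; exact: level_set_pos_ae a0.
Qed.
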